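(* (Second Weierstrass–Erdmann condition.) Let $t_0<t_1$, $0<\alpha\le 1$, $\beta>0$, $x_0,x_1\in\mathbb{R}^n$, and let $L=L(t,x,y)$ be a real function of $2n+1$ variables ($t\in\mathbb{R}$, $x,y\in\mathbb{R}^n$). Consider the problem ($P_2$): extremize $$J(x(\cdot))=\int_{t_0}^{t_1}(t_1-t)^{\beta-1}L\big(t,x(t),({}^{c}D^{\alpha}_{t_0+}x)(t)\big)\,dt,\qquad x(t_0)=x_0,\quad x(t_1)=x_1,$$ over $x\in PC^{\alpha}([t_0,t_1],\mathbb{R}^n)$. Suppose that $x^0$ provides a strong local minimum in ($P_2$), and that $L,L_x,L_y$ are continuous in some neighborhood of the graph $\{(t,x^0(t),({}^{c}D^{\alpha}_{t_0+}x^0)(t)):t\in[t_0,t_1]\}$. Then at every corner point $t\in A$ of $x^0$, writing $p_{\pm}=({}^{c}D^{\alpha}_{t_0+}x^0)(t\pm0)$, $$L\big(t,x^0(t),p_-\big)-\big\langle L_y\big(t,x^0(t),p_-\big),p_-\big\rangle=L\big(t,x^0(t),p_+\big)-\big\langle L_y\big(t,x^0(t),p_+\big),p_+\big\rangle.$$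
   Context: $PC([t_0,t_1],\mathbb{R}^n)$ is the set of piecewise continuous functions: continuous on $[t_0,t_1]$ except at finitely many points of $(t_0,t_1)$, where they have discontinuities of the first kind (finite one-sided limits). For $\alpha>0$: $(I^{\alpha}_{t_0+}\varphi)(t)=\frac{1}{\Gamma(\alpha)}\int_{t_0}^{t}(t-\tau)^{\alpha-1}\varphi(\tau)\,d\tau$. For $0<\alpha<1$ and continuous $\varphi$: $({}^{c}D^{\alpha}_{t_0+}\varphi)(t)=\frac{d}{dt}\big(I^{1-\alpha}_{t_0+}(\varphi(\cdot)-\varphi(t_0))\big)(t)$; for $\alpha=1$ it is the ordinary derivative. $PC^{\alpha}([t_0,t_1],\mathbb{R}^n)$ is the set of all continuous $\varphi$ with $\varphi(t)=\varphi(t_0)+(I^{\alpha}_{t_0+}\psi)(t)$ on $[t_0,t_1]$ for some $\psi\in PC([t_0,t_1],\mathbb{R}^n)$; then ${}^{c}D^{\alpha}_{t_0+}\varphi=\psi$ at the continuity points of $\psi$. A function $x\in PC^{\alpha}([t_0,t_1],\mathbb{R}^n)$ is admissible if $x(t_0)=x_0$, $x(t_1)=x_1$. An admissible $x^0$ provides a strong local minimum if there is $\delta>0$ such that $J(x(\cdot))\ge J(x^0(\cdot))$ for every admissible $x$ with $\|x-x^0\|_{C([t_0,t_1],\mathbb{R}^n)}<\delta$. $A\subset(t_0,t_1)$ is the set of discontinuity points (of the first kind) of ${}^{c}D^{\alpha}_{t_0+}x^0$; its elements are the corner points of $x^0$, and $(t\pm0)$ denotes one-sided limits. At a corner point $t$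 the graph is understood to contain both points $(t,x^0(t),p_{\pm})$. $L_x,L_y$ denote the gradients in $x$ and $y$; $\langle\cdot,\cdot\rangle$ is the scalar product. *)

(* Defs.v *)
From HB Require Import structures.
From mathcomp Require Import all_boot all_order all_algebra.
From mathcomp Require Import all_classical all_reals all_analysis.

Set Implicit Arguments.
Unset Strict Implicit.
Unset Printing Implicit Defensive.

Import Order.TTheory GRing.Theory Num.Theory.
Import numFieldNormedType.Exports.

Local Open Scope classical_set_scope.
Local Open Scope ring_scope.

(* Functions on [t0, t1] are represented by total functions R -> 'rV[R]_n.
   The notions below read only their restriction to [t0, t1], except for values
   of derivatives at t0 and t1, which the integrals (null sets) and the graph
   (one-sided limits) never use. *)

Definition dotv (R : realType) (n : nat) (u v : 'rV[R]_n) : R :=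
  \sum_(i < n) u 0 i * v 0 i.

Definition eulerGamma (R : realType) (a : R) : R :=
  \int[lebesgue_measure]_(s in `]0, +oo[) (s `^ (a - 1) * expR (- s)).

Definition fracint (R : realType) (n : nat) (a t0 : R) (phi : R -> 'rV[R]_n)
    (t : R) : 'rV[R]_n :=
  (eulerGamma a)^-1 *:
    \row_i \int[lebesgue_measure]_(s in `[t0, t[)
             ((t - s) `^ (a - 1) * phi s 0 i).

Definition caputo (R : realType) (n : nat) (a t0 : R) (phi : R -> 'rV[R]_n)
    (t : R) : 'rV[R]_n :=
  if a == 1 then derive1 phi t
  else derive1 (fracint (1 - a) t0 (fun s => phi s - phi t0)) t.

Definition piecewise_continuous (R : realType) (n : nat) (t0 t1 : R)
    (psi : R -> 'rV[R]_n) : Prop :=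
  exists s : seq R,
    [/\ forall t, t \in s -> t0 < t < t1,
        forall t, t0 <= t <= t1 -> t \notin s ->
          psi @ within `[t0, t1] (nbhs t) --> psi t
      & forall t, t \in s -> cvg (psi @ t^'-) /\ cvg (psi @ t^'+)].

Definition PCalpha (R : realType) (n : nat) (a t0 t1 : R)
    (phi : R -> 'rV[R]_n) : Prop :=
  {within `[t0, t1], continuous phi} /\
  exists2 psi : R -> 'rV[R]_n, piecewise_continuous t0 t1 psi &
    forall t, t0 <= t <= t1 -> phi t = phi t0 + fracint a t0 psi t.

Definition admissible (R : realType) (n : nat) (a t0 t1 : R)
    (x0 x1 : 'rV[R]_n) (x : R -> 'rV[R]_n) : Prop :=
  [/\ PCalpha a t0 t1 x, x t0 = x0 & x t1 = x1].

Definition integrand (R : realType) (n : nat) (a b t0 t1 : R)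
    (L : R -> 'rV[R]_n -> 'rV[R]_n -> R) (x : R -> 'rV[R]_n) (t : R) : R :=
  (t1 - t) `^ (b - 1) * L t (x t) (caputo a t0 x t).

Definition J (R : realType) (n : nat) (a b t0 t1 : R)
    (L : R -> 'rV[R]_n -> 'rV[R]_n -> R) (x : R -> 'rV[R]_n) : R :=
  \int[lebesgue_measure]_(t in `[t0, t1]) integrand a b t0 t1 L x t.

(* J(x) has a meaning: far from the graph of the minimizer nothing is assumed
   on L, so the integrand of a competitor may fail to be integrable. *)
Definition J_defined (R : realType) (n : nat) (a b t0 t1 : R)
    (L : R -> 'rV[R]_n -> 'rV[R]_n -> R) (x : R -> 'rV[R]_n) : Prop :=
  lebesgue_measure.-integrable `[t0, t1] (EFin \o integrand a b t0 t1 L x).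

(* `|_| on 'rV[R]_n is the max norm; as the radius in strong_local_min is
   existentially quantified, any other norm of R^n gives the same notion. *)
Definition Cnorm (R : realType) (n : nat) (t0 t1 : R)
    (f : R -> 'rV[R]_n) : R :=
  sup [set `|f t| | t in `[t0, t1]].

Definition strong_local_min (R : realType) (n : nat) (a b t0 t1 : R)
    (x0 x1 : 'rV[R]_n) (L : R -> 'rV[R]_n -> 'rV[R]_n -> R)
    (xm : R -> 'rV[R]_n) : Prop :=
  admissible a t0 t1 x0 x1 xm /\
  exists2 delta : R, 0 < delta &
    forall x : R -> 'rV[R]_n, admissible a t0 t1 x0 x1 x ->
      Cnorm t0 t1 (fun t => x t - xm t) < delta ->
      J_defined a b t0 t1 L x ->
      J a b t0 t1 L xm <= J a b t0 t1 L x.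

Definition corner_point (R : realType) (n : nat) (a t0 t1 : R)
    (x : R -> 'rV[R]_n) (t : R) : Prop :=
  [/\ t0 < t < t1, ~ {for t, continuous (caputo a t0 x)},
      cvg (caputo a t0 x @ t^'-) & cvg (caputo a t0 x @ t^'+)].

(* Points (t, x(t), p) with p a one-sided limit of the Caputo derivative at t:
   where the derivative is continuous p is its value, at a corner point both
   limits are included, and at t0, t1 p is the limit from inside [t0, t1]. *)
Definition graph_caputo (R : realType) (n : nat) (a t0 t1 : R)
    (x : R -> 'rV[R]_n) : set (R * 'rV[R]_n * 'rV[R]_n) :=
  [set z | exists t p, [/\ t0 <= t <= t1, z = (t, x t, p) &
     (t0 < t /\ caputo a t0 x @ t^'- --> p) \/
     (t < t1 /\ caputo a t0 x @ t^'+ --> p)]].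

Definition has_grad (R : realType) (n : nat) (f : 'rV[R]_n -> R)
    (v : 'rV[R]_n) : Prop :=
  forall i : 'I_n, derivable f v (delta_mx 0 i).

Definition grad (R : realType) (n : nat) (f : 'rV[R]_n -> R)
    (v : 'rV[R]_n) : 'rV[R]_n :=
  \row_i 'D_(delta_mx 0 i) f v.

Definition gradx (R : realType) (n : nat) (L : R -> 'rV[R]_n -> 'rV[R]_n -> R)
    (t : R) (x y : 'rV[R]_n) : 'rV[R]_n := grad (fun u => L t u y) x.

Definition grady (R : realType) (n : nat) (L : R -> 'rV[R]_n -> 'rV[R]_n -> R)
    (t : R) (x y : 'rV[R]_n) : 'rV[R]_n := grad (L t x) y.

Definition C01_near (R : realType) (n : nat)
    (L : R -> 'rV[R]_n -> 'rV[R]_n -> R)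
    (G : set (R * 'rV[R]_n * 'rV[R]_n)) : Prop :=
  exists U : set (R * 'rV[R]_n * 'rV[R]_n),
    [/\ open U, G `<=` U &
      forall z, U z ->
        [/\ has_grad (fun u => L z.1.1 u z.2) z.1.2,
            has_grad (L z.1.1 z.1.2) z.2,
            {for z, continuous (fun w => L w.1.1 w.1.2 w.2)},
            {for z, continuous (fun w => gradx L w.1.1 w.1.2 w.2)}
          & {for z, continuous (fun w => grady L w.1.1 w.1.2 w.2)}]].

(* Main.v *)
(* The extremal is perturbed by one needle-type variation.  Let phi be the Caputo
   derivative of xm, p_b its limit on the side b of t, and p_b' the limit on the
   other side.  On an interval N of length r^2 next to t on the side b, phi is
   moved from p_b to p_b'; the added p_b' - p_b is compensated by adding about
   r p_b on the interval of length r on the side b and about - r p_b' on the one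
   on the opposite side, the exact coefficients being chosen so that the fractional
   integral of the perturbation vanishes at t1.  The perturbation is a difference
   of steps of equal mass concentrated near t, so its fractional integral vanishes
   on the left of the support and is o(r^2) in the weighted L^1 norm.  Dividing the
   increment of J by r^2 yields, with q_c the y-gradient of L at (t, xm t, p_c),
     0 <= L(p_b') - L(p_b) + <q_b, p_b> - <q_b', p_b'>
   and exchanging the two sides gives equality. *)

Require Import Defs.
From HB Require Import structures.
From mathcomp Require Import all_boot all_order all_algebra.
From mathcomp Require Import all_classical all_reals all_analysis.
From mathcomp Require Import measurable_realfun ring lra.

Import Order.TTheory GRing.Theory Num.Theory.
Import numFieldNormedType.Exports.

Set Implicit Arguments.
Unset Strict Implicit.
Unset Printing Implicit Defensive.

Local Open Scope classical_set_scope.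
Local Open Scope ring_scope.

(** The compensation is split over the two sides so that the two inequalities are exact opposites.
    Compensating all of p_b' - p_b on the side b would pair q_b with both limits, and exchanging the
    sides would then give equality only if q_b = q_b'. The lengths separate the orders: the needle
    has amplitude O(1) on length r^2, a compensation has amplitude about r on length r. All
    contribute at order r^2, while linearizing [L] in its last variable on the compensations costs
    only o(r^2). The obstacle is the memory of the fractional integral: a perturbation supported
    near t moves the trajectory all the way to t1, even if its mass is zero, and may miss x1. Hence
    the vectors p_b' and - p_b each multiply their own scalar profile [vstep], whose ratio [vratio],
    asymptotically r, is tuned to the endpoint t1. The displacement is estimated with two scales: a
    distance rho fixed first, which gives O(r^2 rho^al) near t, then r much smaller than rho, so
    that beyond t + rho the needle and its compensation act almost like multiples of the same kernel
    and cancel. *)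

Lemma measurable_affine (R : realType) (c d : R) :
  measurable_fun [set: R] (fun x => c * x + d).
Proof. exact: measurable_funD. Qed.

(** Uniqueness of Lebesgue measure: the right-hand side is a measure, so half-open intervals
    suffice. For c < 0 the preimage of such an interval is closed on the other end, hence the two
    computations. *)
Lemma lebesgue_measure_affine (R : realType) (c d : R) (A : set R) :
  c != 0 -> measurable A ->
  lebesgue_measure A = (`|c|%:E * pushforward lebesgue_measure
    (fun x : measurableTypeR R => (c * x + d)%R : measurableTypeR R) A)%E.
Proof.
move=> c0 mA.
pose phi := fun x : measurableTypeR R => c * x + d : measurableTypeR R.
have mphi : measurable_fun setT phi by exact: measurable_affine.
pose m := mscale (NngNum (normr_ge0 c)) (pushforward lebesgue_measure phi).
apply: (@lebesgue_measure_unique _ (m mphi)) => // _ [[a b]] _ <-.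
rewrite -[RHS]/(`|c|%:E * lebesgue_measure (phi @^-1` `]a, b]%classic))%E.
have [c_gt0|c_lt0] : 0 < c \/ c < 0 by apply/orP; rewrite orbC -neq_lt.
  rewrite (_ : _ @^-1` _ = `](a - d) / c, (b - d) / c]%classic); last first.
    by apply/seteqP; split=> x/=;
      rewrite !in_itv/= /phi ltr_pdivrMr ?ler_pdivlMr// ltrBlDr lerBrDr (mulrC x).
  rewrite !lebesgue_measure_itv/= !lte_fin ltr_pM2r ?invr_gt0// ltrD2r gtr0_norm//.
  by case: ifPn => _; rewrite ?mule0// -!EFinD -EFinM; congr (_%:E); field.
rewrite (_ : _ @^-1` _ = `[(b - d) / c, (a - d) / c[%classic); last first.
  by apply/seteqP; split=> x/=;
    rewrite !in_itv/= /phi ltr_ndivlMr// ler_ndivrMr// ltrBlDr lerBrDr (mulrC x) andbC.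
rewrite !lebesgue_measure_itv/= !lte_fin ltr_nM2r ?invr_lt0// ltrD2r ltr0_norm//.
by case: ifPn => _; rewrite ?mule0// -!EFinD -EFinM; congr (_%:E); field.
Qed.

(** Stated for nonnegative extended-real functions, so that it applies to the singular kernels
    before their integrability is known. *)
Lemma ge0_integral_affine (R : realType) (c d : R) (D : set R) (f : R -> \bar R) :
  c != 0 -> measurable D -> measurable_fun D f -> (forall x, D x -> 0 <= f x)%E ->
  (\int[lebesgue_measure]_(y in D) f y = `|c|%:E *
   \int[lebesgue_measure]_(x in [set x | D (c * x + d)%R]) f (c * x + d)%R)%E.
Proof.
move=> c0 mD mf f0.
pose phi := fun x : measurableTypeR R => c * x + d : measurableTypeR R.
have mphi : measurable_fun setT phi by exact: measurable_affine.
have f0' : {in D, forall y, 0 <= f y}%E by move=> y; rewrite inE; exact: f0.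
have <- := ge0_integral_pushforward mphi lebesgue_measure mD mf f0'.
have <- := @ge0_integral_mscale _ _ _ (pushforward lebesgue_measure phi) _ mD
   (NngNum (normr_ge0 c)) f mf f0.
by apply: eq_measure_integral => A mA _; exact: lebesgue_measure_affine.
Qed.

(** * Integrals of powers and the Beta integral *)

Lemma continuous_powR_gt0 (R : realType) (g x : R) : 0 < x ->
  {for x, continuous (fun y : R => y `^ g)}.
Proof.
move=> x0; have [+ _] := is_derive1_powR g x0.
by move=> /derivable1_diffP/differentiable_continuous.
Qed.

(** The truncation at 0 matters: [powR] does not vanish at negative reals, and the truncated power
    is the one produced by fractional integrals of steps. *)
Lemma continuous_pospow (R : realType) (g : R) : 0 < g ->
  continuous (fun x : R => Num.max x 0 `^ g).
Proof.
move=> g0 x; have [x0|x0|->] := ltgtP x 0.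
- apply: (@near_cst_continuous _ _ (0 : R)); near=> y.
  rewrite max_r ?powR0 ?gt_eqF//; apply/ltW; near: y; exact: lt_nbhsl.
- rewrite /continuous_at max_l ?ltW//.
  apply: cvg_trans (@continuous_powR_gt0 _ g _ x0); apply: near_eq_cvg; near=> y.
  rewrite max_l//; apply/ltW; near: y; exact: lt_nbhsr.
- rewrite /continuous_at maxxx powR0 ?gt_eqF//; apply/cvgrPdist_lt => e e0.
  have /cvgrPdist_lt/(_ e e0) := powR_cvg0 g0.
  rewrite near_simpl => -[d/= d0 H].
  near=> y; have [y0|y0] := leP y 0; first by rewrite powR0 ?gt_eqF// subrr normr0.
  apply: H => //=; near: y; apply/nbhs_ballP; exists d => //.
Unshelve. all: by end_near. Qed.

(** The integrand may blow up at 0: the fundamental theorem of calculus is applied on intervals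
    [[e i, 1]] exhausting []0, 1]], followed by monotone convergence. *)
Lemma integral_powR01 (R : realType) (g : R) : 0 < g ->
  (\int[lebesgue_measure]_(x in `]0%R, 1%R]) (x `^ (g - 1))%:E = (g^-1)%:E)%E.
Proof.
move=> g0.
(* The shift by 2 keeps [e i] strictly below 1, so that every interval [F i] is nondegenerate. *)
pose e (i : nat) : R := i.+2%:R^-1.
have e0 i : 0 < e i by rewrite invr_gt0.
have e1 i : e i < 1 by rewrite invf_lt1// ltr1n.
pose F i := `[e i, 1%R]%classic : set R.
have UF : \bigcup_i F i = `]0%R, 1%R]%classic.
  apply/seteqP; split=> x/=.
    by move=> [i _]; rewrite /F /= !in_itv/= => /andP[eix ->]; rewrite (lt_le_trans (e0 i)).
  rewrite in_itv/= => /andP[x0 x1].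
  exists (Num.truncn x^-1) => //; rewrite /F/= in_itv/= x1 andbT /e.
  rewrite -[leRHS]invrK lef_pV2 ?posrE ?invr_gt0//.
  by rewrite ltW// (lt_le_trans (truncnS_gt _))// ler_nat.
have cF : (\int[lebesgue_measure]_(x in F i) (x `^ (g - 1))%:E @[i --> \oo] -->
    \int[lebesgue_measure]_(x in \bigcup_i F i) (x `^ (g - 1))%:E)%E.
  apply: ge0_nondecreasing_set_cvg_integral.
  - move=> i j ij; rewrite subsetEset; apply: subset_itvr.
    by rewrite bnd_simp lef_pV2 ?posrE// ler_nat.
  - by move=> i; exact: measurable_itv.
  - move=> i; apply/measurable_EFinP; apply: measurable_funTS; exact: measurable_powR.
  - by move=> i x _; rewrite lee_fin powR_ge0.
rewrite UF in cF; apply: (cvg_unique _ cF) => //.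
have FE i : (\int[lebesgue_measure]_(x in F i) (x `^ (g - 1))%:E =
   (g^-1 * (1 - e i `^ g))%:E)%E.
  rewrite (@continuous_FTC2 _ _ (fun x => g^-1 * x `^ g))//.
  - by rewrite powR1 -EFinB -mulrBr.
  - apply: continuous_in_subspaceT => x; rewrite inE/= in_itv/= => /andP[x0 _].
    have /= := is_derive1_powR (g - 1) (lt_le_trans (e0 i) x0).
    by case=> /derivable1_diffP/differentiable_continuous.
  - split.
    + move=> x; rewrite in_itv/= => /andP[x0 _].
      have /= [H _] := is_derive1_powR g (lt_trans (e0 i) x0).
      exact: derivableZ.
    + by apply: cvg_at_right_filter; apply: cvgMr; exact: continuous_powR_gt0.
    + by apply: cvg_at_left_filter; apply: cvgMr; exact: continuous_powR_gt0.
  - move=> x; rewrite in_itv/= => /andP[x0 _].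
    have [H] := is_derive1_powR g (lt_trans (e0 i) x0).
    rewrite derive1E deriveZ//= => ->.
    by rewrite /GRing.scale/= mulKf ?gt_eqF.
rewrite (_ : (fun i => _) = (fun i => (g^-1 * (1 - e i `^ g))%:E)); last exact/funext.
apply: cvg_EFin; first exact: nearW.
rewrite /comp/= (_ : nbhs g^-1 = nbhs (g^-1 * (1 - 0))); last by rewrite subr0 mulr1.
apply: cvgMr; apply: cvgB; first exact: cvg_cst.
have he : (e i @[i --> \oo] --> (0 : R)).
  by have := @cvg_harmonic R; rewrite -cvg_shiftS.
have := cvg_comp _ _ he (@continuous_pospow _ _ g0 0).
rewrite maxxx powR0 ?gt_eqF//; apply: cvg_trans; apply: near_eq_cvg.
by apply: nearW => i /=; rewrite max_l// ltW.
Qed.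

Lemma measurable_powR_subl (R : realType) (p a : R) D :
  measurable_fun D (fun x : R => (x - a) `^ p).
Proof.
apply: (measurableT_comp (measurable_powR _)).
by apply: measurable_funTS; exact: measurable_funB.
Qed.

Lemma measurable_powR_subr (R : realType) (p b : R) D :
  measurable_fun D (fun x : R => (b - x) `^ p).
Proof.
apply: (measurableT_comp (measurable_powR _)).
by apply: measurable_funTS; exact: measurable_funB.
Qed.

Lemma integral_powR_left (R : realType) (g a b : R) : 0 < g -> a <= b ->
  (\int[lebesgue_measure]_(x in `]a, b]) ((x - a) `^ (g - 1))%:E =
   ((b - a) `^ g / g)%:E)%E.
Proof.
move=> g0; rewrite le_eqVlt => /predU1P[->|ab].
  by rewrite set_itvoc0 integral_set0 subrr powR0 ?gt_eqF// mul0r.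
have ba0 : 0 < b - a by rewrite subr_gt0.
have ba : b - a != 0 by rewrite gt_eqF.
have mf D : measurable_fun D (fun x : R => ((x - a) `^ (g - 1))%:E).
  by apply/measurable_EFinP; exact: measurable_powR_subl.
rewrite (ge0_integral_affine a ba)//; last by move=> x _; rewrite lee_fin powR_ge0.
rewrite (_ : [set x | _] = `]0, 1]%classic); last first.
  apply/seteqP; split=> x/=; rewrite !in_itv/= ltrDr -lerBrDr pmulr_rgt0//.
    by rewrite -{2}(mulr1 (b - a)) ler_pM2l.
  by rewrite -{2}(mulr1 (b - a)) ler_pM2l.
under eq_integral.
  move=> x; rewrite inE/= in_itv/= => /andP[x0 _].
  rewrite addrK powRM ?ltW// EFinM; over.
rewrite ge0_integralZl//; last 3 first.
- by apply/measurable_EFinP; apply: measurable_funTS; exact: measurable_powR.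
- by move=> x _; rewrite lee_fin powR_ge0.
- by rewrite lee_fin powR_ge0.
rewrite integral_powR01// -!EFinM gtr0_norm// mulrA; congr ((_ / _)%:E).
by rewrite mulr_powRB1// ltW.
Qed.

(** Obtained from the left version by the reflection x -> a + b - x. *)
Lemma integral_powR_right (R : realType) (g a b : R) : 0 < g -> a <= b ->
  (\int[lebesgue_measure]_(x in `[a, b[) ((b - x) `^ (g - 1))%:E =
   ((b - a) `^ g / g)%:E)%E.
Proof.
move=> g0 ab; have N1 : -1 != 0 :> R by rewrite oppr_eq0.
have mf D : measurable_fun D (fun x : R => ((b - x) `^ (g - 1))%:E).
  by apply/measurable_EFinP; exact: measurable_powR_subr.
rewrite (ge0_integral_affine (a + b) N1)//; last first.
  by move=> x _; rewrite lee_fin powR_ge0.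
rewrite normrN1 mul1e.
rewrite (_ : [set x : R | `[a, b[%classic (-1 * x + (a + b))] = `]a, b]%classic); last first.
  by apply/seteqP; split=> x/=; rewrite !in_itv/= => /andP[? ?]; apply/andP; split; lra.
rewrite -(integral_powR_left g0 ab); apply: eq_integral => x _.
by congr ((_ `^ _)%:E); ring.
Qed.

Lemma ler_powR_npos (R : realType) (p x y : R) : p <= 0 -> 0 < x -> x <= y ->
  y `^ p <= x `^ p.
Proof.
rewrite -oppr_ge0 -(opprK p); move: (- p) => {}p; rewrite opprK => p0 x0 xy.
rewrite !powRN lef_pV2 ?posrE ?powR_gt0 ?(lt_le_trans x0)//.
by apply: ge0_ler_powR; rewrite ?nnegrE// ltW// (lt_le_trans x0).
Qed.

(** Product of the kernels of orders 1 - a and a, the exponent (1 - a) - 1 being written - a. Its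
    integral from tau to t is Euler's B(a, 1 - a). *)
Definition beta_kernel (R : realType) (a tau t s : R) : R :=
  (t - s) `^ (- a) * (s - tau) `^ (a - 1).

Definition beta_const (R : realType) (a : R) : \bar R :=
  (\int[lebesgue_measure]_(s in `]0%R, 1%R[) (beta_kernel a 0 1 s)%:E)%E.

Lemma measurable_beta_kernel (R : realType) (a tau t : R) D :
  measurable_fun D (beta_kernel a tau t).
Proof.
by apply: measurable_funM; [exact: measurable_powR_subr|exact: measurable_powR_subl].
Qed.

Lemma beta_kernel_ge0 (R : realType) (a tau t s : R) : 0 <= beta_kernel a tau t s.
Proof. by rewrite mulr_ge0// powR_ge0. Qed.

(** Each singularity is isolated on its half of the interval: the other factor is bounded there by
    its value at 1/2, because both exponents are negative. The kernel is thus dominated by a sum of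
    two integrable powers. *)
Lemma beta_const_fin (R : realType) (a : R) : 0 < a < 1 -> beta_const a \is a fin_num.
Proof.
move=> /andP[a0 a1]; rewrite ge0_fin_numE; last first.
  by apply: integral_ge0 => x _; rewrite lee_fin beta_kernel_ge0.
pose C : R := 2^-1 `^ (- a); pose C' : R := 2^-1 `^ (a - 1).
have m1 D : measurable_fun D (fun x : R => ((x - 0) `^ (a - 1))%:E).
  by apply/measurable_EFinP; exact: measurable_powR_subl.
have m2 D : measurable_fun D (fun x : R => ((1 - x) `^ (1 - a - 1))%:E).
  by apply/measurable_EFinP; exact: measurable_powR_subr.
have m1C D : measurable_fun D (fun x : R => C%:E * ((x - 0) `^ (a - 1))%:E)%E.
  apply/measurable_EFinP; apply: measurable_funM => //; exact: measurable_powR_subl.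
have m2C D : measurable_fun D (fun x : R => C'%:E * ((1 - x) `^ (1 - a - 1))%:E)%E.
  apply/measurable_EFinP; apply: measurable_funM => //; exact: measurable_powR_subr.
apply: (@le_lt_trans _ _ (\int[lebesgue_measure]_(x in `]0%R, 1%R[)
   (C%:E * ((x - 0) `^ (a - 1))%:E + C'%:E * ((1 - x) `^ (1 - a - 1))%:E))%E).
  apply: ge0_le_integral => //.
  - by move=> x _; rewrite lee_fin beta_kernel_ge0.
  - by apply/measurable_EFinP; exact: measurable_beta_kernel.
  - by apply: emeasurable_funD; [exact: m1C|exact: m2C].
  - move=> x /=; rewrite in_itv/= => /andP[x0 x1].
    rewrite -!EFinM -EFinD lee_fin /beta_kernel.
    rewrite (_ : 1 - a - 1 = - a); last by ring.
    have [xh|hx] := leP x 2^-1.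
      apply: (@le_trans _ _ (C * (x - 0) `^ (a - 1))).
        by rewrite ler_wpM2r ?powR_ge0// ler_powR_npos//; lra.
      by rewrite lerDl mulr_ge0// powR_ge0.
    apply: (@le_trans _ _ (C' * (1 - x) `^ (- a))).
      by rewrite mulrC ler_wpM2r ?powR_ge0// ler_powR_npos//; lra.
    by rewrite lerDr mulr_ge0// powR_ge0.
rewrite ge0_integralD//; last 4 first.
- by move=> x _; rewrite -EFinM lee_fin mulr_ge0// powR_ge0.
- exact: m1C.
- by move=> x _; rewrite -EFinM lee_fin mulr_ge0// powR_ge0.
- exact: m2C.
have p1 D x : D x -> (0 <= ((x - 0) `^ (a - 1))%:E)%E by rewrite lee_fin powR_ge0.
have p2 D x : D x -> (0 <= ((1 - x) `^ (1 - a - 1))%:E)%E by rewrite lee_fin powR_ge0.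
rewrite ge0_integralZl ?lee_fin ?powR_ge0//; last 2 first.
- exact: m1.
- exact: p1.
rewrite ge0_integralZl ?lee_fin ?powR_ge0//; last 2 first.
- exact: m2.
- exact: p2.
apply: lte_add_pinfty; (apply: lte_mul_pinfty; rewrite ?lee_fin ?powR_ge0//).
  apply: (@le_lt_trans _ _ (\int[lebesgue_measure]_(x in `]0%R, 1%R])
    ((x - 0) `^ (a - 1))%:E)%E).
    by apply: ge0_subset_integral => //; [exact: m1|exact: p1|by apply: subset_itvl; rewrite bnd_simp].
  by rewrite integral_powR_left// ltry.
apply: (@le_lt_trans _ _ (\int[lebesgue_measure]_(x in `[0%R, 1%R[)
  ((1 - x) `^ (1 - a - 1))%:E)%E).
  by apply: ge0_subset_integral => //; [exact: m2|exact: p2|by apply: subset_itvr; rewrite bnd_simp].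
by rewrite integral_powR_right ?subr_gt0// ltry.
Qed.

(** The exponents - a and a - 1 add up to -1, which cancels the Jacobian t - tau. This is why
    composing the orders a and 1 - a yields a multiple of plain integration. *)
Lemma integral_beta_kernel (R : realType) (a tau t : R) : tau < t ->
  (\int[lebesgue_measure]_(s in `]tau, t[) (beta_kernel a tau t s)%:E)%E = beta_const a.
Proof.
move=> taut; have ba0 : 0 < t - tau by rewrite subr_gt0.
have ba : t - tau != 0 by rewrite gt_eqF.
rewrite (ge0_integral_affine tau ba)//; last 2 first.
- by apply/measurable_EFinP; exact: measurable_beta_kernel.
- by move=> x _; rewrite lee_fin beta_kernel_ge0.
rewrite (_ : [set x | _] = `]0, 1[%classic); last first.
  apply/seteqP; split=> x/=; rewrite !in_itv/= ltrDr -ltrBrDr pmulr_rgt0//.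
    by rewrite -{2}(mulr1 (t - tau)) ltr_pM2l.
  by rewrite -{2}(mulr1 (t - tau)) ltr_pM2l.
rewrite -ge0_integralZl//; last 2 first.
- apply: measurable_funTS; apply/measurable_EFinP.
  by apply: measurableT_comp; [exact: measurable_beta_kernel|exact: measurable_affine].
- by move=> x _; rewrite lee_fin beta_kernel_ge0.
apply: eq_integral => x; rewrite inE/= in_itv/= => /andP[x0 x1].
rewrite -EFinM gtr0_norm//; congr EFin; rewrite /beta_kernel.
rewrite addrK (_ : t - (_ + _) = (t - tau) * (1 - x)); last by ring.
rewrite !powRM ?subr_ge0 ?ltW// mulrACA mulrA.
rewrite -powRD ?ba ?implybT// (_ : - a + (a - 1) = -1); last by ring.
by rewrite powR_inv1 ?ltW// !mulrA mulfV// mul1r subr0.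
Qed.

Lemma lebesgue_measure_bounded_itv (R : realType) (b0 b1 : bool) (x y : R) :
  (lebesgue_measure [set` Interval (BSide b0 x) (BSide b1 y)] < +oo)%E.
Proof. by rewrite lebesgue_measure_itv/=; case: ifP => _; rewrite ?ltry// -EFinD ltry. Qed.

Lemma bounded_integrable_itv (R : realType) (b0 b1 : bool) (x y M : R) (g : R -> R) :
  let D := [set` Interval (BSide b0 x) (BSide b1 y)] in
  measurable_fun D g -> (forall s, D s -> `|g s| <= M) ->
  lebesgue_measure.-integrable D (EFin \o g).
Proof.
move=> D mg gM; apply: measurable_bounded_integrable => //.
- exact: measurable_itv.
- exact: lebesgue_measure_bounded_itv.
exists M; split; first exact: num_real.
by move=> r Mr s /= /gM; move=> /le_trans; apply; exact: ltW.
Qed.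

(** * Scalar fractional integrals *)

Definition fint (R : realType) (a t0 : R) (g : R -> R) (t : R) : R :=
  \int[lebesgue_measure]_(s in `[t0, t[) ((t - s) `^ (a - 1) * g s).

(** A bounded function against a kernel whose only singularity, at s = t, is integrable because a >
    0. *)
Lemma integrable_fint (R : realType) (a t0 t M : R) (g : R -> R) : 0 < a ->
  measurable_fun `[t0, t[ g -> (forall s, t0 <= s < t -> `|g s| <= M) ->
  lebesgue_measure.-integrable `[t0, t[ (EFin \o (fun s => (t - s) `^ (a - 1) * g s)).
Proof.
move=> a0 mg gM.
apply: (@le_integrable _ _ _ lebesgue_measure _ _ _
  (fun s => M%:E * ((t - s) `^ (a - 1))%:E)%E) => //.
- apply/measurable_EFinP; apply: measurable_funM => //.
  exact: measurable_powR_subr.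
- move=> s /=; rewrite in_itv/= => st; rewrite lee_fin normrM mulrC.
  rewrite normrM ler_pM//; exact: le_trans (gM s st) (ler_norm _).
- apply: integrableZl => //; apply/integrableP; split.
    by apply/measurable_EFinP; exact: measurable_powR_subr.
  under eq_integral do rewrite /= ger0_norm ?powR_ge0//.
  have [t0t|tt0] := leP t0 t; first by rewrite integral_powR_right// ltry.
  by rewrite set_itv_ge ?integral_set0// bnd_simp -leNgt ltW.
Qed.

(** Kernel extended by 0 to u <= 0: the order constraints between the variables move into the
    integrand, and Tonelli applies on the whole plane. [powR] alone would be nonzero at negative
    arguments. *)
Definition pker (R : realType) (p u : R) : R := if 0 < u then u `^ p else 0.

Lemma measurable_pker (R : realType) (p : R) : measurable_fun [set: R] (pker p).
Proof.
rewrite (_ : pker p = (fun u => u `^ p) \_ `]0, +oo[).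
  by apply/(measurable_restrictT _ _).1 => //; apply: measurable_funTS; exact: measurable_powR.
by apply/funext => u; rewrite patchE mem_setE in_itv/= andbT.
Qed.

Lemma pker_ge0 (R : realType) (p u : R) : 0 <= pker p u.
Proof. by rewrite /pker; case: ifP => // _; exact: powR_ge0. Qed.

(** Tonelli on the triangle t0 <= u < s < t: for fixed u the integral in s is that of the Beta
    kernel, a constant. Integrability of the composed integrand falls out of the same identity. *)
Lemma ge0_fint_comp (R : realType) (a t0 t M : R) (g : R -> R) :
  0 < a < 1 -> t0 <= t ->
  measurable_fun `[t0, t[ g -> (forall s, t0 <= s < t -> 0 <= g s <= M) ->
  lebesgue_measure.-integrable `[t0, t[
    (EFin \o (fun s => (t - s) `^ (1 - a - 1) * fint a t0 g s)) /\
  fint (1 - a) t0 (fint a t0 g) t =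
  fine (beta_const a) * \int[lebesgue_measure]_(s in `[t0, t[) g s.
Proof.
move=> a01 t0t mg gM; have [a0 a1] := andP a01.
have g0 u : t0 <= u -> u < t -> 0 <= g u.
  by move=> t0u ut; have := gM u; rewrite t0u ut => /(_ isT)/andP[].
have pointE : point = 0 :> R by [].
pose g' := g \_ `[t0, t[.
have mg' : measurable_fun setT g' by apply/(measurable_restrictT _ _).1.
have g'0 s : 0 <= g' s.
  rewrite /g' patchE; case: ifPn => //; rewrite mem_setE in_itv/= => /gM.
  by case/andP.
(* Double integrand with s outer and u inner variable; [FE] and [GE] below compute its two partial
   integrals. *)
pose F (z : R * R) : R := pker (- a) (t - z.1) * pker (a - 1) (z.1 - z.2) * g' z.2.
have F0 z : (0 <= (F z)%:E)%E by rewrite lee_fin !mulr_ge0 ?pker_ge0.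
have mF : measurable_fun setT (EFin \o F).
  apply/measurable_EFinP; apply: measurable_funM.
    apply: measurable_funM; apply: (measurableT_comp (measurable_pker _)).
      by apply: measurable_funB => //; exact: measurable_fst.
    by apply: measurable_funB; [exact: measurable_fst|exact: measurable_snd].
  by apply: (measurableT_comp mg'); exact: measurable_snd.
have fin s : t0 <= s < t ->
    (\int[lebesgue_measure]_(u in `[t0, s[) ((s - u) `^ (a - 1) * g u)%:E)%E
    = (fint a t0 g s)%:E.
  move=> /andP[t0s st]; rewrite fineK//; apply: integrable_fin_num => //.
  apply: (@integrable_fint _ _ _ _ M) => //.
    apply: measurable_funS mg => //; apply: subset_itvl; rewrite bnd_simp; exact: ltW.
  move=> u /andP[t0u us]; have ut := lt_trans us st.
  by rewrite ger0_norm ?g0//; have := gM u; rewrite t0u ut => /(_ isT)/andP[].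
have FE s : (\int[lebesgue_measure]_u (F (s, u))%:E)%E =
    (((fun s => (t - s) `^ (1 - a - 1) * fint a t0 g s) \_ `[t0, t[) s)%:E.
  rewrite patchE mem_setE in_itv/=.
  have [st|st] := boolP (t0 <= s < t); last first.
    apply: integral0_eq => u _; rewrite /F/= /pker !subr_gt0 /g' patchE mem_setE in_itv/=.
    move: st; rewrite negb_and -!ltNge -leNgt => /orP[st0|ts].
      have [us|su] := ltP u s; last by rewrite mulr0 mul0r.
      by rewrite (leNgt t0) (lt_trans us st0)/= pointE mulr0.
    by rewrite (ltNge s) ts /= !mul0r.
  rewrite EFinM -fin// -ge0_integralZl//; last 3 first.
  - apply/measurable_EFinP; apply: measurable_funM; first exact: measurable_powR_subr.
    by apply: measurable_funS mg => //; apply: subset_itvl; rewrite bnd_simp; case/andP: st => _ /ltW.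
  - move=> u; rewrite /= in_itv/= lee_fin => /andP[t0u us]; rewrite mulr_ge0 ?powR_ge0//.
    by apply: g0; rewrite // (lt_trans us)//; case/andP: st.
  - by rewrite lee_fin powR_ge0.
  rewrite [RHS]integral_mkcond; apply: eq_integral => u _.
  rewrite !patchE/= /F/= /pker !subr_gt0 mem_setE in_itv/= /g' patchE mem_setE in_itv/=.
  case/andP: (st) => t0s st'; rewrite st'.
  have [t0u|ut0]/= := leP t0 u; last by rewrite pointE mulr0.
  have [us|su] := ltP u s; last by rewrite mulr0 mul0r.
  rewrite (lt_trans us st')//= -EFinM; congr EFin.
  by rewrite (_ : 1 - a - 1 = - a) ?mulrA//; ring.
have GE u : (\int[lebesgue_measure]_s (F (s, u))%:E)%E = (beta_const a * (g' u)%:E)%E.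
  rewrite /F/= [in RHS]/g' patchE mem_setE in_itv/=.
  have [|] := boolP (t0 <= u < t) => [/[dup] ut /andP[t0u ult]|/negbTE ut]; last first.
    by rewrite pointE mule0; apply: integral0_eq => s _; rewrite /g' patchE mem_setE in_itv/= ut pointE mulr0.
  rewrite -(integral_beta_kernel a ult) -ge0_integralZr//; last 3 first.
  - by apply/measurable_EFinP; exact: measurable_beta_kernel.
  - by move=> s _; rewrite lee_fin beta_kernel_ge0.
  - by rewrite lee_fin g0.
  rewrite [RHS]integral_mkcond; apply: eq_integral => s _.
  rewrite patchE/= /pker !subr_gt0 mem_setE in_itv/= /g' patchE mem_setE in_itv/= ut.
  by case: (ltP u s); case: (ltP s t); rewrite ?(mul0r, mulr0).
(* The inner fractional integral is measurable as a partial integral in Tonelli's theorem. *)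
have mH : measurable_fun `[t0, t[ (EFin \o (fun s => (t - s) `^ (1 - a - 1) * fint a t0 g s)).
  apply/measurable_EFinP/(measurable_restrictT _ _).2 => //; apply/measurable_EFinP.
  rewrite (_ : EFin \o _ = fun s => (\int[lebesgue_measure]_u (F (s, u))%:E)%E).
    exact: (@measurable_fun_fubini_tonelli_F _ _ _ _ R lebesgue_measure (EFin \o F) mF F0).
  by apply/funext => s; rewrite FE.
have IE : (\int[lebesgue_measure]_(s in `[t0, t[)
    ((t - s) `^ (1 - a - 1) * fint a t0 g s)%:E =
    beta_const a * \int[lebesgue_measure]_(s in `[t0, t[) (g s)%:E)%E.
  rewrite integral_mkcond.
  transitivity (\int[lebesgue_measure]_s \int[lebesgue_measure]_u (F (s, u))%:E)%E.
    by apply: eq_integral => s _; rewrite FE !patchE; case: ifP.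
  rewrite (@fubini_tonelli _ _ _ _ R lebesgue_measure lebesgue_measure (EFin \o F) mF F0)/=.
  under eq_integral do rewrite GE.
  rewrite ge0_integralZl//; last 3 first.
  - exact/measurable_EFinP.
  - by move=> u _; rewrite lee_fin.
  - by apply: integral_ge0 => u _; rewrite lee_fin beta_kernel_ge0.
  rewrite [in RHS]integral_mkcond; congr (_ * _)%E.
  by apply: eq_integral => u _; rewrite /g' !patchE; case: ifP.
have ig : lebesgue_measure.-integrable `[t0, t[ (EFin \o g).
  apply: (bounded_integrable_itv (M := M)) => // u; rewrite /= in_itv/= => /andP[t0u ut].
  by rewrite ger0_norm ?g0//; have := gM u; rewrite t0u ut => /(_ isT)/andP[].
have Bfin := beta_const_fin a01.
have gfin : (\int[lebesgue_measure]_(s in `[t0, t[) (g s)%:E)%E \is a fin_num.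
  by apply: integrable_fin_num.
split; last by rewrite /fint {1}/Rintegral IE fineM.
apply/integrableP; split => //.
under eq_integral.
  move=> s; rewrite inE/= in_itv/= => st.
  rewrite ger0_norm; last first.
    rewrite mulr_ge0 ?powR_ge0//; apply: Rintegral_ge0 => u /=.
    rewrite in_itv/= => /andP[t0u us]; rewrite mulr_ge0 ?powR_ge0 ?g0//.
    by rewrite (lt_trans us)//; case/andP: st.
  over.
by rewrite IE ltey_eq fin_numM.
Qed.

Lemma fintD (R : realType) (a t0 t : R) (g1 g2 : R -> R) :
  lebesgue_measure.-integrable `[t0, t[ (EFin \o (fun s => (t - s) `^ (a - 1) * g1 s)) ->
  lebesgue_measure.-integrable `[t0, t[ (EFin \o (fun s => (t - s) `^ (a - 1) * g2 s)) ->
  fint a t0 (fun s => g1 s + g2 s) t = fint a t0 g1 t + fint a t0 g2 t.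
Proof.
move=> i1 i2; rewrite /fint -RintegralD//.
by apply: eq_Rintegral => s _; rewrite mulrDr.
Qed.

Lemma fintZ (R : realType) (a t0 t c : R) (g : R -> R) :
  lebesgue_measure.-integrable `[t0, t[ (EFin \o (fun s => (t - s) `^ (a - 1) * g s)) ->
  fint a t0 (fun s => c * g s) t = c * fint a t0 g t.
Proof.
move=> i1; rewrite /fint -RintegralZl//.
by apply: eq_Rintegral => s _; rewrite mulrCA.
Qed.

Lemma eq_fint (R : realType) (a t0 t : R) (g1 g2 : R -> R) :
  (forall s, t0 <= s < t -> g1 s = g2 s) -> fint a t0 g1 t = fint a t0 g2 t.
Proof. by move=> g12; apply: eq_Rintegral => s; rewrite inE/= in_itv/= => /g12 ->. Qed.

(* The index law up to the factor [B(a, 1 - a)], whose value is never needed. *)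
Lemma fint_comp (R : realType) (a t0 t M : R) (g : R -> R) :
  0 < a < 1 -> t0 <= t ->
  measurable_fun `[t0, t[ g -> (forall s, t0 <= s < t -> `|g s| <= M) ->
  lebesgue_measure.-integrable `[t0, t[
    (EFin \o (fun s => (t - s) `^ (1 - a - 1) * fint a t0 g s)) /\
  fint (1 - a) t0 (fint a t0 g) t =
  fine (beta_const a) * \int[lebesgue_measure]_(s in `[t0, t[) g s.
Proof.
move=> a01 t0t mg gM; have [a0 a1] := andP a01.
have mc D : measurable_fun D (cst M : R -> R) by exact: measurable_cst.
have mgM : measurable_fun `[t0, t[ (fun s => g s + M) by exact: measurable_funD.
(* The shift g + M is nonnegative, so the previous lemma applies to it and to the constant M;
   linearity removes M afterwards. *)
have gM2 s : t0 <= s < t -> 0 <= g s + M <= 2 * M.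
  by move=> /gM; rewrite ler_norml => /andP[? ?]; apply/andP; split; lra.
have cM s : t0 <= s < t -> 0 <= cst M s <= M.
  by move=> /gM; rewrite lexx andbT; exact: le_trans.
have [i1 e1] := ge0_fint_comp a01 t0t mgM gM2.
have [i2 e2] := ge0_fint_comp a01 t0t (mc _) cM.
have fE s : t0 <= s < t -> fint a t0 (fun s => g s + M) s = fint a t0 g s + fint a t0 (cst M) s.
  move=> /andP[t0s st].
  apply: fintD.
    apply: (integrable_fint (M := M)) => //.
      by apply: measurable_funS mg => //; apply: subset_itvl; rewrite bnd_simp ltW.
    by move=> u /andP[t0u us]; rewrite gM// t0u (lt_trans us).
  exact: (integrable_fint (M := `|M|)).
have i3 : lebesgue_measure.-integrable `[t0, t[
    (EFin \o (fun s => (t - s) `^ (1 - a - 1) * (- 1 * fint a t0 (cst M) s))).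
  rewrite (_ : (fun _ => _) = (fun s => -1 * ((t - s) `^ (1 - a - 1) * fint a t0 (cst M) s))).
    exact: (@integrableZl _ _ _ lebesgue_measure _ (measurable_itv _) (-1) _ i2).
  by apply/funext => s; rewrite mulrCA.
split.
  have i4 := integrableD (mu := lebesgue_measure) (measurable_itv _) i1 i3.
  apply: eq_integrable i4 => // s; rewrite inE/= in_itv/= => st.
  by rewrite -EFinD fE// -mulrDr mulN1r addrK.
rewrite (@eq_fint _ _ _ _ _ (fun s => fint a t0 (fun s => g s + M) s + - 1 * fint a t0 (cst M) s)); last first.
  by move=> s st; rewrite fE// mulN1r addrK.
rewrite fintD// fintZ// e1 e2 mulN1r -mulrBr; congr (_ * _).
rewrite -RintegralB//; first by apply: eq_Rintegral => s _; rewrite addrK.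
- apply: (bounded_integrable_itv (M := 2 * M)) => // u; rewrite /= in_itv/= => /gM2 /andP[? ?].
  by rewrite ger0_norm.
- by apply: (bounded_integrable_itv (M := `|M|)).
Qed.

(** * Caputo derivatives of piecewise smooth functions *)

(** Continuity gives measurability on the open set left after removing S, and every function is
    measurable on a finite set. The endpoints are put into the finite set, which covers all kinds of
    intervals. *)
Lemma measurable_fun_off_seq (R : realType) (a b : R) (S : seq R) (f : R -> R) (b0 b1 : bool) :
  (forall t, a < t < b -> t \notin S -> {for t, continuous f}) ->
  measurable_fun [set` Interval (BSide b0 a) (BSide b1 b)] f.
Proof.
move=> cf.
have fin_open (s : seq R) : closed [set` s].
  elim: s => [|x s ih]; first by rewrite set_nil; exact: closed0.
  rewrite (_ : [set` x :: s] = [set x] `|` [set` s]).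
    by apply: closedU => //; exact: closed_eq.
  by apply/seteqP; split=> y /=; rewrite inE => /predU1P.
pose D := `]a, b[%classic `\` [set` S] : set R.
have oD : open D by apply: openI; [exact: interval_open|rewrite openC].
have mD : measurable_fun D f.
  apply: open_continuous_measurable_fun => // t; rewrite inE => -[/= tab tS].
  by apply: cf; [rewrite in_itv in tab|exact/negP].
have mF : measurable_fun [set` [:: a, b & S]] f.
  move=> _ B mB; apply: countable_measurable => [t|]; first exact: measurable_set1.
  by apply: finite_set_countable; apply: finite_setIl; exact: finite_seq.
have mF' : measurable ([set` [:: a, b & S]] : set R).
  apply: countable_measurable => [t|]; first exact: measurable_set1.
  by apply: finite_set_countable; exact: finite_seq.
apply: (@measurable_funS _ _ _ _ (D `|` [set` [:: a, b & S]])).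
- by apply: measurableU => //; exact: open_measurable.
- move=> t /=; rewrite in_itv/= => H.
  have [ta|ta] := eqVneq t a; first by right; rewrite /= ta inE eqxx.
  have [tb|tb] := eqVneq t b; first by right; rewrite /= !inE tb eqxx orbT.
  case tS: (t \in S); first by right; rewrite /= !inE tS !orbT.
  left; split; last by rewrite /= tS.
  rewrite /= in_itv/=; move: H.
  by case: b0; case: b1; rewrite /= ?le_eqVlt ?(eq_sym a) ?(negbTE ta) ?(negbTE tb).
- by apply/measurable_funU => //; exact: open_measurable.
Qed.

Lemma at_left_within (R : realType) (a b t : R) : a < t <= b ->
  t^'- --> within `[a, b] (nbhs t).
Proof.
move=> /andP[at_ tb] A /= H.
change (\forall u \near t, u < t -> A u).
have {}H : \forall u \near t, u \in `[a, b] -> A u by exact: H.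
near=> u => ut; have au : a < u by near: u; exact: lt_nbhsr.
have : u \in `[a, b] by rewrite in_itv/= (ltW au) (ltW (lt_le_trans ut tb)).
by near: u.
Unshelve. all: by end_near. Qed.

Lemma at_right_within (R : realType) (a b t : R) : a <= t < b ->
  t^'+ --> within `[a, b] (nbhs t).
Proof.
move=> /andP[at_ tb] A /= H.
change (\forall u \near t, t < u -> A u).
have {}H : \forall u \near t, u \in `[a, b] -> A u by exact: H.
near=> u => tu; have ub : u < b by near: u; exact: lt_nbhsl.
have : u \in `[a, b] by rewrite in_itv/= (ltW ub) (ltW (le_lt_trans at_ tu)).
by near: u.
Unshelve. all: by end_near. Qed.

(** Compactness of the segment, in the form of near coverings. The left, right and pointwise
    conditions are separate because the functions in question may jump at t, where only one-sided
    limits control them. *)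
Lemma segment_near (R : realType) (I : Type) (F : set_system I) (P : I -> R -> Prop)
    (a b : R) : Filter F ->
  (forall t, a < t <= b -> \forall u \near t^'- & i \near F, P i u) ->
  (forall t, a <= t < b -> \forall u \near t^'+ & i \near F, P i u) ->
  (forall t, a <= t <= b -> \forall i \near F, P i t) ->
  \forall i \near F, `[a, b] `<=` P i.
Proof.
move=> FF Pl Pr Pt.
have /compact_near_coveringP/near_covering_withinP cpt := @segment_compact R a b.
apply: cpt => t; rewrite /= in_itv/= => /[dup] tab /andP[at_ tb].
have Hl : \forall u \near t & i \near F, u < t -> u \in `[a, b] -> P i u.
  move: at_; rewrite le_eqVlt => /predU1P[<-|at_].
    by near=> u i => ua; rewrite in_itv/= => /andP[/(lt_le_trans ua)]; rewrite ltxx.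
  have [[/= A B] [A' B'] AB] : \forall u \near t^'- & i \near F, P i u by apply: Pl; rewrite at_.
  by exists (fun u => u < t -> A u, B) => // -[u i] /= [Au Bi] ut _; apply: (AB (u, i)); split=> //; exact: Au.
have Hr : \forall u \near t & i \near F, t < u -> u \in `[a, b] -> P i u.
  move: tb; rewrite le_eqVlt => /predU1P[->|tb].
    by near=> u i => bu; rewrite in_itv/= => /andP[_ /(lt_le_trans bu)]; rewrite ltxx.
  have [[/= A B] [A' B'] AB] : \forall u \near t^'+ & i \near F, P i u by apply: Pr; rewrite tb andbT.
  by exists (fun u => t < u -> A u, B) => // -[u i] /= [Au Bi] ut _; apply: (AB (u, i)); split=> //; exact: Au.
have Hm : \forall u \near t & i \near F, u = t -> P i u.
  exists (setT, fun i => P i t) => /=; first by split; [exact: filterT|exact: Pt].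
  by move=> [u i] /= [_ Pit] ->.
apply: filterS3 Hl Hr Hm => -[u i] /= hl hr hm uab.
by have [ut|ut|ut] := ltgtP u t; [exact: hl|exact: hr|exact: hm].
Unshelve. all: by end_near. Qed.

Lemma ler_coord_norm (R : realType) (n : nat) (v : 'rV[R]_n) i : `|v 0 i| <= `|v|.
Proof.
rewrite [leRHS]/Num.Def.normr/= mx_normrE.
exact: (le_bigmax _ (fun ij : 'I_1 * 'I_n => `|v ij.1 ij.2|) (0, i)).
Qed.

Lemma rV_norm_le (R : realType) (n : nat) (v : 'rV[R]_n) c : 0 <= c ->
  (forall i, `|v 0 i| <= c) -> `|v| <= c.
Proof.
move=> c0 H; rewrite [leLHS]/Num.Def.normr/= mx_normrE.
by apply: bigmax_le => // -[i j] _ /=; rewrite ord1.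
Qed.

Lemma fracintE (R : realType) (n : nat) (a t0 t : R) (phi : R -> 'rV[R]_n) i :
  fracint a t0 phi t 0 i = (eulerGamma a)^-1 * fint a t0 (fun s => phi s 0 i) t.
Proof. by rewrite !mxE. Qed.

(* Equals 1 by the reflection formula for the Gamma function; only its
   independence of the function is used. *)
Definition caputo_const (R : realType) (a : R) : R :=
  if a == 1 then (eulerGamma a)^-1
  else (eulerGamma (1 - a))^-1 * (eulerGamma a)^-1 * fine (beta_const a).

Section piecewise_continuity.
Context {R : realType} {n : nat}.
Variables (t0 t1 : R) (psi : R -> 'rV[R]_n) (S : seq R).
Hypothesis St : forall t, t \in S -> t0 < t < t1.
Hypothesis cS : forall t, t0 <= t <= t1 -> t \notin S ->
  psi @ within `[t0, t1] (nbhs t) --> psi t.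
Hypothesis jS : forall t, t \in S -> cvg (psi @ t^'-) /\ cvg (psi @ t^'+).

Lemma pc_continuous t : t0 < t < t1 -> t \notin S -> {for t, continuous psi}.
Proof.
move=> /andP[t0t tt1] tS.
have := cS _ tS; rewrite !ltW// => /(_ isT); rewrite within_interior//.
suff : `]t0, t1[ `<=` interior `[t0, t1] by apply; rewrite /= in_itv/= t0t.
by rewrite -open_subsetE; [exact: subset_itvW|exact: interval_open].
Qed.

Lemma pc_cvg_left t : t0 < t <= t1 -> cvg (psi @ t^'-).
Proof.
move=> t01; have [/jS[]//|tS] := boolP (t \in S).
have /andP[t0t tt1] := t01.
apply/cvg_ex; exists (psi t); apply: cvg_trans (cS _ tS); last by rewrite (ltW t0t).
by apply: cvg_app; exact: at_left_within.
Qed.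

Lemma pc_cvg_right t : t0 <= t < t1 -> cvg (psi @ t^'+).
Proof.
move=> t01; have [/jS[]//|tS] := boolP (t \in S).
have /andP[t0t tt1] := t01.
apply/cvg_ex; exists (psi t); apply: cvg_trans (cS _ tS); last by rewrite t0t ltW.
by apply: cvg_app; exact: at_right_within.
Qed.

(** Each one-sided limit gives a bound on one side of a point; [segment_near] along M -> +oo makes
    the bound uniform. *)
Lemma pc_bounded : exists M : R, forall t, t0 <= t <= t1 -> `|psi t| <= M.
Proof.
have step (G : set_system R) : Filter G -> cvg (psi @ G) ->
    \forall u \near G & M \near +oo, `|psi u| <= M.
  move=> FG /cvg_ex[l] /cvgr_norm_le/(_ (`|l| + 1)); rewrite ltrDl ltr01 => /(_ isT) H.
  exists ([set u | `|psi u| <= `|l| + 1], [set M | `|l| + 1 <= M]) => /=.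
    by split => //; exact: nbhs_pinfty_ge.
  by move=> [u M]/= [] /le_trans; exact.
have : \forall M \near +oo, `[t0, t1] `<=` (fun t => `|psi t| <= M).
  apply: segment_near => t t01.
  - exact/step/pc_cvg_left.
  - exact/step/pc_cvg_right.
  - exact: nbhs_pinfty_ge.
move=> /filter_ex[M H]; exists M => t t01; by apply: H; rewrite /= in_itv.
Qed.

Lemma pc_coord_bounded i : exists M : R, forall t, t0 <= t <= t1 -> `|psi t 0 i| <= M.
Proof.
have [M H] := pc_bounded; exists M => t /H; apply: le_trans.
exact: ler_coord_norm.
Qed.

Lemma pc_coord_measurable i (b0 b1 : bool) a b : t0 <= a -> b <= t1 ->
  measurable_fun [set` Interval (BSide b0 a) (BSide b1 b)] (fun t => psi t 0 i).
Proof.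
move=> t0a bt1; apply: (@measurable_fun_off_seq _ _ _ S) => t /andP[at_ tb] tS.
apply: (@continuous_comp _ _ _ psi (fun M => M 0 i)); last exact: coord_continuous.
by apply: pc_continuous => //; rewrite (le_lt_trans t0a)// (lt_le_trans tb).
Qed.

Lemma pc_coord_integrable i (b0 b1 : bool) a b : t0 <= a -> b <= t1 ->
  lebesgue_measure.-integrable [set` Interval (BSide b0 a) (BSide b1 b)]
    (EFin \o (fun t => psi t 0 i)).
Proof.
move=> t0a bt1; have [M HM] := pc_coord_bounded i.
apply: (bounded_integrable_itv (M := M)); first exact: pc_coord_measurable.
move=> t; rewrite /= in_itv/= => H; apply: HM; move: H.
by case: b0; case: b1 => /= /andP[at_ tb];
  rewrite (le_trans t0a) ?(le_trans _ bt1) ?(ltW at_) ?(ltW tb).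
Qed.

Lemma derive1_primitive (Phi : R -> 'rV[R]_n) (c : 'rV[R]_n) (k : R) t :
  (forall u, t0 < u < t1 -> forall i, Phi u 0 i =
     c 0 i + k * \int[lebesgue_measure]_(s in `[t0, u]) psi s 0 i) ->
  t0 < t < t1 -> t \notin S -> derive1 Phi t = k *: psi t.
Proof.
move=> HP /[dup] t01 /andP[t0t tt1] tS.
have H i : is_derive t 1 (fun u => Phi u 0 i) (k * psi t 0 i).
  have [dI vI] : derivable (fun u => \int[lebesgue_measure]_(s in `[t0, u]) psi s 0 i) t 1 /\
      derive1 (fun u => \int[lebesgue_measure]_(s in `[t0, u]) psi s 0 i) t = psi t 0 i.
    apply: (continuous_FTC1_closed tt1) => //; first exact: pc_coord_integrable.
    apply: (@continuous_comp _ _ _ psi (fun M => M 0 i)); last exact: coord_continuous.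
    exact: pc_continuous.
  have dI' : is_derive t 1 (fun u => c 0 i + k * \int[lebesgue_measure]_(s in `[t0, u]) psi s 0 i)
      (0 + k * psi t 0 i).
    apply: is_deriveD; apply: is_deriveZ; rewrite -vI derive1E; exact: derivableP.
  rewrite -[k * _]add0r; apply: near_eq_is_derive dI' => //.
  near=> u; apply/esym/HP; apply/andP; split; near: u; [exact: lt_nbhsr|exact: lt_nbhsl].
have dP : derivable Phi t 1 by apply/derivable_mxP => i j; rewrite ord1; case: (H j).
rewrite derive1E derive_mx//; apply/rowP => j; rewrite !mxE.
by have [_ ->] := H j.
Unshelve. all: by end_near. Qed.

(** For a < 1, the index law turns the integral of order 1 - a of phi - phi t0 into a constant times
    an ordinary primitive of [psi]. For a = 1 the kernel exponent is 0 and phi itself is such a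
    primitive up to constants. *)
Lemma caputo_pc (a : R) (phi : R -> 'rV[R]_n) t : 0 < a <= 1 ->
  (forall t, t0 <= t <= t1 -> phi t = phi t0 + fracint a t0 psi t) ->
  t0 < t < t1 -> t \notin S -> caputo a t0 phi t = caputo_const a *: psi t.
Proof.
move=> /andP[a0 a1] phiE t01 tS.
have Ico u i : t0 < u < t1 -> \int[lebesgue_measure]_(s in `[t0, u[) psi s 0 i =
    \int[lebesgue_measure]_(s in `[t0, u]) psi s 0 i.
  move=> /andP[t0u ut1].
  by rewrite Rintegral_itv_bndo_bndc//; apply: pc_coord_integrable => //; exact: ltW.
rewrite /caputo /caputo_const; case: ifPn => [/eqP a_1|an1].
  apply: (derive1_primitive (c := phi t0)) => // u /[dup] t0u1 /andP[t0u ut1] i.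
  rewrite phiE ?ltW// mxE fracintE -Ico// a_1; congr (_ + _ * _).
  by apply: eq_Rintegral => s _; rewrite subrr powRr0 mul1r.
have a01 : 0 < a < 1 by rewrite a0 lt_neqAle an1.
apply: (derive1_primitive (c := 0)) => // u /[dup] t0u1 /andP[t0u ut1] i.
have [M HM] := pc_coord_bounded i.
rewrite fracintE mxE add0r -!mulrA; congr (_ * _).
have [int_a comp_a] : lebesgue_measure.-integrable `[t0, u[
    (EFin \o (fun s => (u - s) `^ (1 - a - 1) * fint a t0 (fun s => psi s 0 i) s)) /\
  fint (1 - a) t0 (fint a t0 (fun s => psi s 0 i)) u =
  fine (beta_const a) * \int[lebesgue_measure]_(s in `[t0, u[) psi s 0 i.
  apply: (fint_comp (M := M) a01); first exact: ltW.
    by apply: pc_coord_measurable => //; exact: ltW.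
  by move=> s /andP[t0s su]; rewrite HM// t0s ltW// (lt_trans su).
rewrite -Ico// -comp_a -fintZ//.
apply: eq_fint => s /andP[t0s su].
rewrite !mxE phiE ?t0s ?(ltW (lt_trans su ut1))// mxE fracintE.
by rewrite addrAC subrr add0r.
Unshelve. all: by end_near. Qed.

End piecewise_continuity.

(** * Fractional integrals of step functions *)

(** On [0, v + w] the power lies above its chord through 0, since y <= y^a for y in [0, 1]; the
    chord values at v and w add up to (v + w)^a. *)
Lemma powR_subadd (R : realType) (a v w : R) : 0 < a <= 1 -> 0 <= v -> 0 <= w ->
  (v + w) `^ a <= v `^ a + w `^ a.
Proof.
move=> /andP[a0 a1] v0 w0.
have [vw0|] := eqVneq (v + w) 0.
  by rewrite vw0 powR0 ?gt_eqF// addr_ge0// powR_ge0.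
rewrite neq_lt ltNge addr_ge0//= => vw0.
have key x : 0 <= x <= v + w -> (v + w) `^ a * (x / (v + w)) <= x `^ a.
  move=> /andP[x0 xvw].
  have [->|xn0] := eqVneq x 0; first by rewrite mul0r mulr0 powR_ge0.
  have xp : 0 < x by rewrite lt_neqAle eq_sym xn0.
  rewrite -[leRHS](_ : (v + w) `^ a * (x / (v + w)) `^ a = _); last first.
    by rewrite -powRM ?divr_ge0 ?ltW// mulrCA mulfV ?mulr1// gt_eqF.
  rewrite ler_wpM2l ?powR_ge0// ger1_powR//.
  by rewrite divr_gt0//= ler_pdivrMr// mul1r.
rewrite -[leLHS]mulr1 -(@mulfV _ (v + w)) ?gt_eqF// mulrDl mulrDr lerD//; apply: key.
  by rewrite v0 lerDl.
by rewrite w0 lerDr.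
Qed.

(** For a <= b, the indicator of [[a, b[], written with Heaviside functions so that its fractional
    integral is a difference of two explicit powers. *)
Definition step (R : realType) (a b s : R) : R := (a <= s)%R%:R - (b <= s)%R%:R.

(** The fractional integral of [step a b] of order al, without the factor 1 / Gamma(al). *)
Definition ramp (R : realType) (al a b s : R) : R :=
  (Num.max (s - a) 0 `^ al - Num.max (s - b) 0 `^ al) / al.

Section step_ramp.
Context {R : realType}.
Variables (al : R).
Hypothesis al01 : 0 < al <= 1.
Let al0 : 0 < al. Proof. by case/andP: al01. Qed.
Let al1 : al <= 1. Proof. by case/andP: al01. Qed.

Lemma step_in (a b s : R) : a <= s < b -> step a b s = 1.
Proof. by move=> /andP[as_ sb]; rewrite /step as_ leNgt sb subr0. Qed.

Lemma step_out (a b s : R) : a <= b -> ~~ (a <= s < b) -> step a b s = 0.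
Proof.
move=> ab; rewrite /step negb_and -ltNge -leNgt => /orP[sa|bs].
  by rewrite !leNgt sa (lt_le_trans sa)//= subrr.
by rewrite bs (le_trans ab)//= subrr.
Qed.

Lemma measurable_step (a b : R) D : measurable_fun D (@step R a b).
Proof.
apply: measurable_funTS.
have m c : measurable_fun setT (fun s : R => (c <= s)%R%:R : R).
  rewrite (_ : (fun _ => _) = \1_`[c, +oo[%classic); first exact: measurable_indic.
  by apply/funext => s; rewrite indicE mem_setE in_itv/= andbT.
exact: measurable_funB.
Qed.

Lemma fint_heaviside (t0 a s : R) : t0 <= a ->
  fint al t0 (fun u => (a <= u)%R%:R) s = Num.max (s - a) 0 `^ al / al.
Proof.
move=> t0a; rewrite /fint.
transitivity (\int[lebesgue_measure]_(u in `[t0, s[)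
    ((fun u => (s - u) `^ (al - 1)) \_ `[a, +oo[) u).
  apply: eq_Rintegral => u _; rewrite patchE mem_setE in_itv/= andbT; case: ifP => _; first by rewrite mulr1.
  by rewrite mulr0.
rewrite -Rintegral_mkcondr (_ : _ `&` _ = `[a, s[%classic); last first.
  apply/seteqP; split=> u/=; rewrite !in_itv/= ?andbT.
    by move=> [/andP[_ ->] ->].
  by move=> /andP[au ->]; rewrite (le_trans t0a).
have [as_|sa] := leP a s.
  by rewrite /Rintegral integral_powR_right// max_l ?subr_ge0.
rewrite max_r ?powR0 ?gt_eqF// ?mul0r; last by rewrite subr_le0 ltW.
by rewrite set_itv_ge ?Rintegral_set0// bnd_simp -leNgt ltW.
Qed.

Lemma fint_step (t0 a b s : R) : t0 <= a -> t0 <= b -> fint al t0 (step a b) s = ramp al a b s.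
Proof.
move=> t0a t0b; rewrite /step /ramp mulrBl -!(@fint_heaviside t0)//.
have i c : lebesgue_measure.-integrable `[t0, s[
    (EFin \o (fun u => (s - u) `^ (al - 1) * (c <= u)%R%:R)).
  apply: (integrable_fint (M := 1)) => //.
    apply: measurable_funTS.
    rewrite (_ : (fun _ => _) = \1_`[c, +oo[%classic); first exact: measurable_indic.
    by apply/funext => u; rewrite indicE mem_setE in_itv/= andbT.
  by move=> u _; case: (c <= u); rewrite ?normr1 ?normr0.
rewrite -[X in _ = _ + X]mulN1r -fintZ// -fintD//.
  by apply: eq_fint => u _; rewrite mulN1r.
rewrite (_ : (fun _ => _) = (fun u => -1 * ((s - u) `^ (al - 1) * (b <= u)%R%:R))).
  exact: (@integrableZl _ _ _ lebesgue_measure _ (measurable_itv _) (-1) _ (i b)).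
by apply/funext => u; rewrite mulrCA.
Qed.

Lemma continuous_ramp (a b : R) : continuous (ramp al a b).
Proof.
have c x : continuous (fun s : R => Num.max (s - x) 0 `^ al).
  move=> s; apply: (@continuous_comp _ _ _ (fun s => s - x) (fun u => Num.max u 0 `^ al)).
    by apply: cvgB; [exact: cvg_id|exact: cvg_cst].
  exact: continuous_pospow.
by move=> s; apply: cvgM; [apply: cvgB; exact: c|exact: cvg_cst].
Qed.

Lemma ramp_eq0 (a b s : R) : a <= b -> s <= a -> ramp al a b s = 0.
Proof.
by move=> ab sa; rewrite /ramp !max_r ?subr_le0 ?(le_trans sa)// subrr mul0r.
Qed.

Lemma ramp_ge0 (a b s : R) : a <= b -> 0 <= ramp al a b s.
Proof.
move=> ab; apply: divr_ge0; [rewrite subr_ge0|exact: ltW].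
apply: (ge0_ler_powR (ltW al0)); rewrite ?nnegrE; first by rewrite le_max lexx orbT.
  by rewrite le_max lexx orbT.
by rewrite ge_max !le_max lexx !orbT lerB.
Qed.

(** Subadditivity of the power, applied to s - a = (s - b) + (b - a) after truncation at 0. *)
Lemma ramp_le (a b s : R) : a <= b -> ramp al a b s <= (b - a) `^ al / al.
Proof.
move=> ab; rewrite ler_pM2r ?invr_gt0// lerBlDl.
apply: (le_trans _ (powR_subadd al01 _ _)); last 2 first.
- by rewrite le_max lexx orbT.
- by rewrite subr_ge0.
apply: (ge0_ler_powR (ltW al0)); rewrite ?nnegrE; first by rewrite le_max lexx orbT.
  by rewrite addr_ge0 ?subr_ge0// le_max lexx orbT.
rewrite ge_max; apply/andP; split.
  apply: (@le_trans _ _ (s - b + (b - a))); first by rewrite addrA subrK.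
  by rewrite lerD2r le_max lexx.
by rewrite addr_ge0 ?subr_ge0// le_max lexx orbT.
Qed.

(** Mean value theorem for x^al between s - b and s - a, the derivative being nonincreasing. *)
Lemma ramp_bounds (a b s : R) : a <= b -> b < s ->
  (b - a) * (s - a) `^ (al - 1) <= ramp al a b s <= (b - a) * (s - b) `^ (al - 1).
Proof.
move=> ab bs; have sb0 : 0 < s - b by rewrite subr_gt0.
have sa0 : 0 < s - a by rewrite subr_gt0 (le_lt_trans ab).
rewrite /ramp (max_l (ltW sb0)) (max_l (ltW sa0)).
have [|||c] := @MVT_segment R (fun x => x `^ al) (fun x => al * x `^ (al - 1)) (s - b) (s - a).
- by rewrite lerB.
- by move=> x; rewrite in_itv/= => /andP[sbx _]; apply: is_derive1_powR; exact: lt_trans sbx.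
- apply: continuous_in_subspaceT => x; rewrite inE/= in_itv/= => /andP[sbx _].
  by apply: continuous_powR_gt0; exact: lt_le_trans sbx.
rewrite in_itv/= => /andP[sbc csa] ->.
rewrite (_ : s - a - (s - b) = b - a); last by ring.
rewrite (_ : _ / al = (b - a) * c `^ (al - 1)); last by field; rewrite gt_eqF.
have c0 : 0 < c by exact: lt_le_trans sbc.
by rewrite !ler_wpM2l ?subr_ge0// ler_powR_npos// subr_le0.
Qed.

End step_ramp.

(** The uniform bound serves on [[a, b]], the kernel bound beyond b. Both terms carry the factor b -
    a and a power al of a length, hence the order (b - a) rho^al on an interval of length about
    rho. *)
Lemma integral_ramp_le (R : realType) (al a b x y : R) : 0 < al <= 1 -> a <= b ->
  (\int[lebesgue_measure]_(s in `[x, y]) (ramp al a b s)%:E <=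
   ((b - a) `^ al / al * (b - a) + (b - a) * (Num.max (y - b) 0 `^ al / al))%:E)%E.
Proof.
move=> al01 ab; have /andP[al0 al1] := al01.
have C0 : 0 <= (b - a) `^ al / al by rewrite divr_ge0 ?powR_ge0// ltW.
have ba0 : 0 <= b - a by rewrite subr_ge0.
have mi : measurable_fun `[x, y] (\1_(`[a, b]%classic : set R) : R -> R).
  by apply: measurable_funTS; exact: measurable_indic.
have mk : measurable_fun `[x, y] (fun s => pker (al - 1) (s - b)).
  apply: measurable_funTS; apply: (measurableT_comp (measurable_pker _)).
  exact: measurable_funB.
apply: (@le_trans _ _ (\int[lebesgue_measure]_(s in `[x, y])
  (((b - a) `^ al / al)%:E * (\1_(`[a, b]%classic : set R) s)%:E +
   (b - a)%:E * (pker (al - 1) (s - b))%:E))%E).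
  apply: ge0_le_integral => //.
  - by move=> s _; rewrite lee_fin ramp_ge0.
  - apply/measurable_EFinP; apply: measurable_funTS; apply: continuous_measurable_fun.
    exact: continuous_ramp.
  - by apply/measurable_EFinP; apply: measurable_funD; apply: measurable_funM.
  - move=> s _; rewrite -!EFinM -EFinD lee_fin.
    have [sb|bs] := leP s b.
      rewrite /pker subr_gt0 ltNge sb mulr0 addr0.
      have [as_|sa] := leP a s; last first.
        by rewrite (ramp_eq0 _ ab (ltW sa)) mulr_ge0// indicE.
      by rewrite indicE mem_setE in_itv/= as_ sb mulr1 ramp_le.
    rewrite /pker subr_gt0 bs indicE mem_setE in_itv/= [s <= b]leNgt bs andbF mulr0 add0r.
    by have /andP[] := ramp_bounds al01 ab bs.
rewrite ge0_integralD//; last 4 first.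
- by move=> s _; rewrite -EFinM lee_fin mulr_ge0// indicE.
- by apply/measurable_EFinP; apply: measurable_funM.
- by move=> s _; rewrite -EFinM lee_fin mulr_ge0// pker_ge0.
- by apply/measurable_EFinP; apply: measurable_funM.
rewrite ge0_integralZl//; last exact/measurable_EFinP.
rewrite ge0_integralZl//; last 2 first.
- exact/measurable_EFinP.
- by move=> s _; rewrite lee_fin pker_ge0.
apply: (@le_trans _ _ (((b - a) `^ al / al)%:E * (b - a)%:E +
  (b - a)%:E * (Num.max (y - b) 0 `^ al / al)%:E)%E); last by rewrite -!EFinM -EFinD.
apply: leeD; apply: lee_wpmul2l; rewrite ?lee_fin//.
  rewrite integral_indic//.
  apply: (@le_trans _ _ (lebesgue_measure (`[a, b]%classic : set R))).
    by apply: le_measure; rewrite ?inE//; exact: measurableI.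
  rewrite lebesgue_measure_itv/= lte_fin; case: ifP => _; first by rewrite EFinB.
  by rewrite lee_fin subr_ge0.
have [yb|by_] := leP y b.
  rewrite integral0_eq; first by rewrite lee_fin divr_ge0 ?powR_ge0// ltW.
  move=> s; rewrite /= in_itv/= => /andP[_ sy].
  by rewrite /pker subr_gt0 ltNge (le_trans sy).
rewrite max_l; last by rewrite subr_ge0 ltW.
rewrite -(integral_powR_left al0 (ltW by_)) integral_mkcond [leRHS]integral_mkcond.
apply: ge0_le_integral => //.
- by move=> s _; rewrite patchE; case: ifP => // _; rewrite lee_fin pker_ge0.
- apply/(measurable_restrictT _ _).1 => //; exact/measurable_EFinP.
- apply/(measurable_restrictT _ _).1 => //.
  by apply/measurable_EFinP; exact: measurable_powR_subl.
- move=> s _; rewrite !patchE !mem_setE !in_itv/= /pker subr_gt0.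
  case: (ltP b s) => bs; case: (s <= y); rewrite ?andbF ?andbT ?lexx//.
    by case: ifP => // _; rewrite lee_fin powR_ge0.
  by case: ifP.
Qed.

(** * The scalar profile: a needle and its compensating step *)

Section corner_variation.
Context {R : realType}.
Variables (al t t1 r rho a0 b0 a1 b1 : R).
Hypothesis al01 : 0 < al <= 1.
Hypothesis r0 : 0 < r.
Hypothesis r1 : r <= 1.
Hypothesis r_rho : 3 * r <= rho.
Hypothesis rho_t1 : t + rho <= t1.
Hypothesis a0P : t - r <= a0.
Hypothesis b0P : b0 <= t + r.
Hypothesis ab0 : b0 - a0 = r ^+ 2.
Hypothesis a1P : t - r <= a1.
Hypothesis b1P : b1 <= t + r.
Hypothesis ab1 : b1 - a1 = r.

(* The needle is [a0, b0[; the step on [a1, b1[ is scaled by [vratio] so that the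
   fractional integral of [vstep] vanishes at t1. *)
Definition vratio : R := ramp al a0 b0 t1 / ramp al a1 b1 t1.
Definition vstep (s : R) : R := step a0 b0 s - vratio * step a1 b1 s.
Definition vramp (s : R) : R := ramp al a0 b0 s - vratio * ramp al a1 b1 s.

Ltac slra := move: r0 r1 r_rho rho_t1 a0P b0P a1P b1P ab1 => *; lra.

Let rhor : 0 < rho - r. Proof. slra. Qed.

(** Largest ratio of the distances from a point s >= t + rho to the two ends of [[t - r, t + r]]. It
    measures how far the kernel is from constant on the support, and tends to 1 as r -> 0 with rho
    fixed. The condition [3 * r <= rho] amounts to [Q <= 2]. *)
Let Q := (rho + r) / (rho - r).

Let Q_ge1 : 1 <= Q. Proof. by rewrite ler_pdivlMr//; slra. Qed.

Let Q_le2 : Q <= 2. Proof. by rewrite ler_pdivrMr//; slra. Qed.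

(** Recentring the bounds at the common point t - r makes ramps of different intervals comparable.
    Writing x^(al - 1) as x^al / x shows that the kernel changes by at most the ratio of the
    distances. *)
Let ramp_Q (a b s : R) : t - r <= a -> a <= b -> b <= t + r -> t + rho <= s ->
  (b - a) * (s - (t - r)) `^ (al - 1) <= ramp al a b s <=
  (b - a) * (Q * (s - (t - r)) `^ (al - 1)).
Proof.
move=> ta ab bt ts; have bs : b < s by slra.
have /andP[al0 al1] := al01.
have /andP[lo hi] := ramp_bounds al01 ab bs.
have ba0 : 0 <= b - a by rewrite subr_ge0.
apply/andP; split.
  apply: le_trans lo; rewrite ler_wpM2l// ler_powR_npos//; slra.
apply: (le_trans hi); rewrite ler_wpM2l//.
have sb0 : 0 < s - b by slra.
apply: (@le_trans _ _ ((s - (t - r)) / (s - b) * (s - (t - r)) `^ (al - 1))).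
  have E x : 0 < x -> x `^ (al - 1) = x `^ al / x.
    by move=> x0; rewrite powRB ?(gt_eqF x0) ?implybT// powRr1// ltW.
  rewrite !E//; last by slra.
  have sd0 : 0 < s - (t - r) by slra.
  rewrite [leRHS](_ : _ = (s - (t - r)) `^ al / (s - b)); last first.
    by field; rewrite !gt_eqF.
  rewrite ler_pM2r ?invr_gt0//.
  by apply: (ge0_ler_powR (ltW al0)); rewrite ?nnegrE; slra.
rewrite ler_wpM2r ?powR_ge0// /Q ler_pdivrMr// mulrAC ler_pdivlMr//.
move: r_rho r0 ta bt ts => *; nra.
Qed.

Let ler01 : a0 <= b0. Proof. by rewrite -subr_ge0 ab0 sqr_ge0. Qed.

Let ler11 : a1 <= b1. Proof. by rewrite -subr_ge0 ab1 ltW. Qed.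

Let Y := (t1 - (t - r)) `^ (al - 1).

Let Y0 : 0 < Y. Proof. by rewrite powR_gt0//; slra. Qed.

Let ramp1_gt0 : 0 < ramp al a1 b1 t1.
Proof.
have /andP[+ _] := ramp_Q a1P ler11 b1P rho_t1.
by apply: lt_le_trans; rewrite ab1 mulr_gt0.
Qed.

(** At t1 each ramp is its length, r^2 or r, times [Y] up to a factor Q; the quotient cancels
    [Y]. *)
Lemma vratio_bounds : r / Q <= vratio <= r * Q.
Proof.
have Q0 : 0 < Q by exact: lt_le_trans Q_ge1.
have /andP[lo0 hi0] := ramp_Q a0P ler01 b0P rho_t1.
have /andP[lo1 hi1] := ramp_Q a1P ler11 b1P rho_t1.
rewrite -/Y ab0 in lo0 hi0; rewrite -/Y ab1 in lo1 hi1.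
rewrite /vratio; apply/andP; split.
  rewrite ler_pdivlMr// mulrAC ler_pdivrMr//.
  apply: (@le_trans _ _ (r * (r * (Q * Y)))); first by rewrite ler_wpM2l// ltW.
  rewrite [leLHS](_ : _ = r ^+ 2 * Y * Q); last by ring.
  by rewrite ler_wpM2r// ltW.
rewrite ler_pdivrMr//; apply: (le_trans hi0).
rewrite [leLHS](_ : _ = r * Q * (r * Y)); last by ring.
by rewrite ler_wpM2l// mulr_ge0// ltW.
Qed.

Lemma vratio_ge0 : 0 <= vratio.
Proof. by rewrite divr_ge0// ramp_ge0. Qed.

Lemma vratio_le : vratio <= 2 * r.
Proof.
have /andP[_] := vratio_bounds; move=> /le_trans; apply.
by rewrite mulrC ler_wpM2r// ltW.
Qed.

Lemma vramp_t1 : vramp t1 = 0.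
Proof. by rewrite /vramp /vratio divfK ?subrr// gt_eqF. Qed.

Lemma vramp_eq0 (s : R) : s <= t - r -> vramp s = 0.
Proof.
move=> st; rewrite /vramp !ramp_eq0//; last 2 first.
- exact: le_trans a1P.
- exact: le_trans a0P.
by rewrite mulr0 subrr.
Qed.

Lemma continuous_vramp : continuous vramp.
Proof.
move=> s; apply: cvgB; first exact: continuous_ramp.
by apply: cvgMr; exact: continuous_ramp.
Qed.

(** In units of r^2 X, the needle term lies in [1, Q] and the compensating term in [1/Q, Q^2]. The
    leading parts cancel, which leaves the gap Q^2 - 1/Q. *)
Lemma vramp_far (s : R) : t + rho <= s ->
  `|vramp s| <= r ^+ 2 * (rho `^ (al - 1) * (Q ^+ 2 - Q^-1)).
Proof.
move=> ts; have Q0 : 0 < Q by exact: lt_le_trans Q_ge1.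
have /andP[al0 al1] := al01.
pose X := (s - (t - r)) `^ (al - 1).
have X0 : 0 <= X by exact: powR_ge0.
have XR : X <= rho `^ (al - 1) by apply: ler_powR_npos; slra.
have /andP[lo0 hi0] := ramp_Q a0P ler01 b0P ts.
have /andP[lo1 hi1] := ramp_Q a1P ler11 b1P ts.
rewrite -/X ab0 in lo0 hi0; rewrite -/X ab1 in lo1 hi1.
have /andP[clo chi] := vratio_bounds.
have lo2 : r ^+ 2 * X / Q <= vratio * ramp al a1 b1 s.
  rewrite [leLHS](_ : _ = (r / Q) * (r * X)); last by ring.
  apply: ler_pM => //; first by rewrite divr_ge0// ltW.
  by rewrite mulr_ge0// ltW.
have hi2 : vratio * ramp al a1 b1 s <= r ^+ 2 * X * Q ^+ 2.
  rewrite [leRHS](_ : _ = (r * Q) * (r * (Q * X))); last by ring.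
  by apply: ler_pM => //; [exact: vratio_ge0|exact: ramp_ge0].
have QV : Q^-1 <= 1 by rewrite invf_le1.
have QQ : Q <= Q ^+ 2 by rewrite expr2 ler_peMl// ltW.
have rX : 0 <= r ^+ 2 * X by rewrite mulr_ge0// sqr_ge0.
have Q2 : 0 <= Q ^+ 2 - Q^-1 by rewrite subr_ge0 (le_trans QV)// (le_trans Q_ge1).
apply: (@le_trans _ _ (r ^+ 2 * X * (Q ^+ 2 - Q^-1))); last first.
  by rewrite mulrA ler_wpM2r// ler_wpM2l// sqr_ge0.
rewrite /vramp ler_norml; apply/andP; split.
  have : r ^+ 2 * X * Q^-1 <= r ^+ 2 * X * 1 by rewrite ler_wpM2l.
  move: lo0 hi2 => *; lra.
have : r ^+ 2 * X * Q <= r ^+ 2 * X * Q ^+ 2 by rewrite ler_wpM2l.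
move: hi0 lo2 => *; lra.
Qed.

(** A crude bound without cancellation; it provides the closeness of the competitor in the sup
    norm. *)
Lemma vramp_sup (s : R) : `|vramp s| <= ((r ^+ 2) `^ al + 2 * r * r `^ al) / al.
Proof.
have /andP[al0 al1] := al01.
apply: (le_trans (ler_normB _ _)); rewrite mulrDl lerD//.
  by rewrite ger0_norm ?ramp_ge0// -ab0 ramp_le.
rewrite normrM (ger0_norm vratio_ge0) ger0_norm ?ramp_ge0// -mulrA.
apply: ler_pM => //; [exact: vratio_ge0|exact: ramp_ge0|exact: vratio_le|].
by rewrite -ab1 ramp_le.
Qed.

(** Both terms are O(r^2 rho^al), the second through [vratio <= 2 * r]. No cancellation occurs here:
    the gain is the factor rho^al. *)
Lemma integral_vramp_near :
  (\int[lebesgue_measure]_(s in `[(t - r)%R, (t + rho)%R]) (`|vramp s|)%:E <=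
   (r ^+ 2 * (6 * (2 * rho) `^ al / al))%:E)%E.
Proof.
have /andP[al0 al1] := al01.
pose P := (2 * rho) `^ al / al.
have Pbound x : 0 <= x -> x <= 2 * rho -> x `^ al / al <= P.
  move=> x0 xrho; rewrite ler_pM2r ?invr_gt0//.
  by apply: (ge0_ler_powR (ltW al0)); rewrite ?nnegrE//; exact: le_trans xrho.
have mrampr a b : measurable_fun `[t - r, t + rho] (ramp al a b).
  by apply: measurable_funTS; apply: continuous_measurable_fun; exact: continuous_ramp.
have mramp a b : measurable_fun `[t - r, t + rho] (fun s => (ramp al a b s)%:E).
  exact/measurable_EFinP.
have mx b : t - r <= b -> Num.max (t + rho - b) 0 `^ al / al <= P.
  move=> tb; apply: Pbound; first by rewrite le_max lexx orbT.
  by rewrite ge_max; apply/andP; split; slra.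
apply: (@le_trans _ _ (\int[lebesgue_measure]_(s in `[(t - r)%R, (t + rho)%R])
   ((ramp al a0 b0 s)%:E + vratio%:E * (ramp al a1 b1 s)%:E))%E).
  apply: ge0_le_integral => //.
  - apply/measurable_EFinP; apply: measurableT_comp => //; apply: measurable_funTS.
    by apply: continuous_measurable_fun; exact: continuous_vramp.
  - apply/measurable_EFinP; apply: measurable_funD; first exact: mrampr.
    by apply: measurable_funM => //; exact: mrampr.
  - move=> s _; rewrite -EFinM -EFinD lee_fin; apply: (le_trans (ler_normB _ _)).
    by rewrite (normrM vratio) (ger0_norm vratio_ge0) !ger0_norm ?ramp_ge0.
rewrite ge0_integralD//; last 4 first.
- by move=> s _; rewrite lee_fin ramp_ge0.
- exact: mramp.
- by move=> s _; rewrite -EFinM lee_fin mulr_ge0 ?ramp_ge0 ?vratio_ge0.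
- by apply/measurable_EFinP; apply: measurable_funM => //; exact: mrampr.
rewrite ge0_integralZl//; last 3 first.
- exact: mramp.
- by move=> s _; rewrite lee_fin ramp_ge0.
- by rewrite lee_fin vratio_ge0.
have I0 := integral_ramp_le (t - r) (t + rho) al01 ler01.
have I1 := integral_ramp_le (t - r) (t + rho) al01 ler11.
rewrite ab0 in I0; rewrite ab1 in I1.
have P0 : 0 <= P by rewrite divr_ge0 ?powR_ge0// ltW.
have r2P : (r ^+ 2) `^ al / al <= P.
  apply: Pbound; first exact: sqr_ge0.
  by move: r0 r1 r_rho => *; nra.
have rP : r `^ al / al <= P by apply: Pbound; slra.
have {}I0 : (\int[lebesgue_measure]_(s in `[(t - r)%R, (t + rho)%R]) (ramp al a0 b0 s)%:E <=
    (r ^+ 2 * (2 * P))%:E)%E.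
  apply: (le_trans I0); rewrite lee_fin.
  rewrite [leRHS](_ : _ = P * r ^+ 2 + r ^+ 2 * P); last by ring.
  have mb : Num.max (t + rho - b0) 0 `^ al / al <= P by apply/mx/(le_trans a0P).
  by apply: lerD; [apply: ler_wpM2r|apply: ler_wpM2l]; rewrite ?sqr_ge0.
have {}I1 : (\int[lebesgue_measure]_(s in `[(t - r)%R, (t + rho)%R]) (ramp al a1 b1 s)%:E <=
    (r * (2 * P))%:E)%E.
  apply: (le_trans I1); rewrite lee_fin.
  rewrite [leRHS](_ : _ = P * r + r * P); last by ring.
  have mb : Num.max (t + rho - b1) 0 `^ al / al <= P by apply/mx/(le_trans a1P).
  by apply: lerD; [apply: ler_wpM2r|apply: ler_wpM2l]; rewrite // ltW.
(* 6 = 2 + 2 * 2: the needle costs twice [P], the step costs [2 * r] times twice [r * P]. *)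
rewrite (_ : r ^+ 2 * _ = r ^+ 2 * (2 * P) + (2 * r) * (r * (2 * P))); last first.
  by rewrite /P; field; rewrite gt_eqF.
rewrite EFinD [X in (_ <= _ + X)%E]EFinM; apply: leeD => //.
apply: lee_pmul => //.
- by rewrite lee_fin vratio_ge0.
- by apply: integral_ge0 => s _; rewrite lee_fin ramp_ge0.
- by rewrite lee_fin vratio_le.
Qed.

End corner_variation.

(** * Increments of the Lagrangian *)

Lemma increment_le (R : realType) (h h' : R -> R) (g eta c : R) :
  (forall s : R, `|s| <= `|c| -> is_derive s 1 h (h' s) /\ `|h' s - g| <= eta) ->
  `|h c - h 0 - g * c| <= eta * `|c|.
Proof.
move=> H.
have mvt a b : a <= b -> (forall x, a <= x <= b -> `|x| <= `|c|) ->
    exists2 x, `|x| <= `|c| & h b - h a = h' x * (b - a).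
  move=> ab abc; have [|||x] := @MVT_segment R h h' a b => //.
  - by move=> x; rewrite in_itv/= => /andP[ax xb]; apply: (H _ _).1; apply: abc; rewrite !ltW.
  - apply: derivable_within_continuous => x; rewrite in_itv/= => xab.
    by have [[]] := H x (abc x xab).
  - by rewrite in_itv/= => xab ->; exists x => //; exact: abc.
have [c0|c0] := leP 0 c.
  have [x|x xc] := mvt 0 c c0.
    by move=> /andP[x0 xc]; rewrite !ger0_norm.
  rewrite subr0 => ->; rewrite -mulrBl normrM ler_wpM2r//.
  by have [] := H x xc.
have [x|x xc E] := mvt c 0 (ltW c0).
  by move=> /andP[cx x0]; rewrite ler0_norm// ltr0_norm// lerN2.
rewrite -[h c - h 0]opprB E sub0r mulrN opprK -mulrBl normrM ler_wpM2r//.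
by have [] := H x xc.
Qed.

Lemma is_derive_line (R : realType) (n : nat) (f : 'rV[R]_n -> R) (z e : 'rV[R]_n) (s : R) :
  derivable f (z + s *: e) e -> is_derive s 1 (fun x => f (z + x *: e)) ('D_e f (z + s *: e)).
Proof.
have E : (fun h : R => h^-1 *: ((f \o shift (z + s *: e)) (h *: e) - f (z + s *: e))) =
  (fun h : R => h^-1 *: (((fun x : R => f (z + x *: e)) \o shift s) (h *: (1 : R)) -
     f (z + s *: e))).
  apply/funext => h /=; congr (_ *: (f _ - _)).
  by rewrite scalerDl addrCA [h *: 1]mulr1.
by move=> df; split; [rewrite /derivable -E|rewrite /derive -E].
Qed.

Lemma dotvDr (R : realType) (n : nat) (g u v : 'rV[R]_n) :
  dotv g (u + v) = dotv g u + dotv g v.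
Proof. by rewrite /dotv -big_split/=; apply: eq_bigr => i _; rewrite mxE mulrDr. Qed.

Lemma dotvZr (R : realType) (n : nat) (g u : 'rV[R]_n) (c : R) :
  dotv g (c *: u) = c * dotv g u.
Proof. by rewrite /dotv mulr_sumr; apply: eq_bigr => i _; rewrite mxE mulrCA. Qed.

Lemma dotv_delta (R : realType) (n : nat) (g : 'rV[R]_n) i : dotv g (delta_mx 0 i) = g 0 i.
Proof.
rewrite /dotv (bigD1 i)//= mxE !eqxx mulr1 big1 ?addr0// => j ji.
by rewrite mxE eqxx (negbTE ji) mulr0.
Qed.

(** One step of the path from 0 to w that restores the coordinates one after the other. *)
Lemma dotv_truncS (R : realType) (n : nat) (g w : 'rV[R]_n) (k : nat) (kn : (k < n)%N) :
  (\row_i (if (i < k.+1)%N then w 0 i else 0) : 'rV[R]_n) =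
  \row_i (if (i < k)%N then w 0 i else 0) + w 0 (Ordinal kn) *: delta_mx 0 (Ordinal kn) /\
  dotv g (\row_i (if (i < k.+1)%N then w 0 i else 0)) =
  dotv g (\row_i (if (i < k)%N then w 0 i else 0)) + g 0 (Ordinal kn) * w 0 (Ordinal kn).
Proof.
have E : (\row_i (if (i < k.+1)%N then w 0 i else 0) : 'rV[R]_n) =
  \row_i (if (i < k)%N then w 0 i else 0) + w 0 (Ordinal kn) *: delta_mx 0 (Ordinal kn).
  apply/rowP => i; rewrite !mxE eqxx/= -val_eqE/= ltnS leq_eqVlt.
  have [ik|ik] := eqVneq (i : nat) k.
    by rewrite ik ltnn add0r mulr1; congr (w 0 _); exact: val_inj.
  by rewrite mulr0 addr0.
by split => //; rewrite E dotvDr dotvZr dotv_delta mulrC.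
Qed.

(** Only partial derivatives are given, so w is added one coordinate at a time, with the mean value
    theorem on each segment. The intermediate points stay within distance [|w|] of v because the
    norm is the max norm. *)
Lemma grad_increment_le (R : realType) (n : nat) (f : 'rV[R]_n -> R) (v w g : 'rV[R]_n) (eta : R) :
  (forall z, `|z - v| <= `|w| ->
     has_grad f z /\ forall i, `|grad f z 0 i - g 0 i| <= eta) ->
  `|f (v + w) - f v - dotv g w| <= eta * n%:R * `|w|.
Proof.
move=> H; pose tr k : 'rV[R]_n := \row_i (if (i < k)%N then w 0 i else 0).
(* A negative eta contradicts the hypothesis as soon as there is a coordinate; for n = 0 both sides
   are 0. *)
have [eta0|eta0] := leP 0 eta; last first.
  case: n f v w g H @tr => [|n] f v w g H tr.
    have E (u u' : 'rV[R]_0) : u = u' by apply/rowP => -[].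
    by rewrite (E (v + w) v) subrr /dotv big_ord0 subrr normr0 mulr0 mul0r.
  have [|_ /(_ 0)] := H v; first by rewrite subrr normr0.
  by move=> /le_lt_trans/(_ eta0); rewrite normr_lt0.
have key k : (k <= n)%N -> `|f (v + tr k) - f v - dotv g (tr k)| <= eta * k%:R * `|w|.
  elim: k => [_|k ih kn].
    have -> : tr 0 = 0 by apply/rowP => i; rewrite !mxE.
    rewrite addr0 subrr sub0r normrN mulr0 mul0r /dotv big1 ?normr0// => i _.
    by rewrite mxE mulr0.
  have [E1 E2] := dotv_truncS g w kn.
  rewrite -/(tr k.+1) -/(tr k) in E1 E2; rewrite E2 E1.
  set j := Ordinal kn; set e : 'rV[R]_n := delta_mx 0 j; set z := v + tr k.
  have hs : `|f (z + w 0 j *: e) - f (z + 0 *: e) - g 0 j * w 0 j| <= eta * `|w 0 j|.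
    apply: (@increment_le _ (fun x => f (z + x *: e)) (fun s => 'D_e f (z + s *: e))) => s sw.
    have [|dz gz] := H (z + s *: e).
      rewrite /z -(addrA v) [v + _]addrC addrK.
      apply: rV_norm_le => // i; rewrite !mxE eqxx/=.
      have [->|ij] := eqVneq i j.
        by rewrite ltnn add0r mulr1 (le_trans sw)// ler_coord_norm.
      rewrite mulr0 addr0; case: ifP => _; first exact: ler_coord_norm.
      by rewrite normr0.
    split; first by apply: is_derive_line; exact: dz.
    by have := gz j; rewrite !mxE.
  rewrite scale0r addr0 in hs.
  rewrite (_ : _ - _ = (f z - f v - dotv g (tr k)) +
     (f (z + w 0 j *: e) - f z - g 0 j * w 0 j)); last by rewrite addrA; ring.
  apply: (le_trans (ler_normD _ _)); rewrite -natr1 mulrDr mulrDl lerD ?ih ?(ltnW kn)//.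
  by rewrite mulr1 (le_trans hs)// ler_wpM2l// ler_coord_norm.
have := key n (leqnn n); have -> // : tr n = w.
by apply/rowP => i; rewrite mxE ltn_ord.
Qed.

Lemma near_mul_le (R : realType) (c eta : R) : 0 < eta ->
  \forall r \near (0:R)^'+, c * r <= eta.
Proof.
move=> eta0; have [c0|c0] := leP c 0; near=> r.
  by rewrite (le_trans _ (ltW eta0))// mulr_le0_ge0.
rewrite mulrC -ler_pdivlMr//; near: r; apply: nbhs_right_le; exact: divr_gt0.
Unshelve. all: by end_near. Qed.

Lemma near_powR_le (R : realType) (al c eta : R) : 0 < al -> 0 < eta ->
  \forall r \near (0:R)^'+, c * r `^ al <= eta.
Proof.
move=> al0 eta0; have H : c * (x : R) `^ al @[x --> 0^'+] --> c * 0.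
  by apply: cvgMr; exact: powR_cvg0.
rewrite mulr0 in H; move/cvgr_norm_le : H => /(_ eta); rewrite normr0 eta0 => /(_ isT).
by apply: filterS => r; apply: le_trans; exact: ler_norm.
Qed.

Definition variation_geometry (R : realType) (t r a0 b0 a1 b1 : R) : Prop :=
  [/\ t - r <= a0 /\ b0 <= t + r, b0 - a0 = r ^+ 2, t - r <= a1 /\ b1 <= t + r
    & b1 - a1 = r].

(** First rho is chosen from eta, so that the part near t costs at most half of [eta * r ^+ 2]; then
    r is taken small in terms of rho, the cancellation beyond t + rho giving an extra factor r. The
    choice of r precedes the geometry, so one r serves both compensations. *)
Lemma vramp_small (R : realType) (al be t0 t t1 eta : R) :
  0 < al <= 1 -> 0 < be -> t0 < t < t1 -> 0 < eta ->
  \forall r \near (0:R)^'+, forall a0 b0 a1 b1, variation_geometry t r a0 b0 a1 b1 ->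
  [/\ vramp al t1 a0 b0 a1 b1 t1 = 0,
      forall s, s <= t - r -> vramp al t1 a0 b0 a1 b1 s = 0,
      forall s, `|vramp al t1 a0 b0 a1 b1 s| <= eta,
      0 <= vratio al t1 a0 b0 a1 b1 /\
        `|vratio al t1 a0 b0 a1 b1 / r - 1| <= eta
    & (\int[lebesgue_measure]_(s in `[t0, t1])
        ((t1 - s) `^ (be - 1) * `|vramp al t1 a0 b0 a1 b1 s|)%:E <= (eta * r ^+ 2)%:E)%E].
Proof.
move=> /[dup] al01 /andP[al0 al1] be0 /andP[t0t tt1] eta0.
pose T := t1 - t; have T0 : 0 < T by rewrite subr_gt0.
(* Bounds the weight up to t + rho for either sign of be - 1: there t1 - s lies between T / 2 and t1
   - t0. *)
pose Amax := (T / 2) `^ (be - 1) + (t1 - t0) `^ (be - 1).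
have Amax0 : 0 <= Amax by rewrite addr_ge0 ?powR_ge0.
pose IA := (t1 - t0) `^ be / be.
have IA0 : 0 <= IA by rewrite divr_ge0 ?powR_ge0// ltW.
have [rho [rho0 rhoT rhot0 rhoA]] : exists rho : R, [/\ 0 < rho, rho <= T / 2, rho <= t - t0 &
    Amax * (6 * (2 * rho) `^ al / al) <= eta / 2].
  suff /filter_ex[rho H] : \forall rho \near (0:R)^'+,
    [/\ 0 < rho, rho <= T / 2, rho <= t - t0 & Amax * (6 * (2 * rho) `^ al / al) <= eta / 2].
    by exists rho.
  near=> rho; split.
  - by [].
  - by near: rho; apply: nbhs_right_le; exact: divr_gt0.
  - by near: rho; apply: nbhs_right_le; rewrite subr_gt0.
  - rewrite powRM// (_ : _ * _ = (Amax * 6 * 2 `^ al / al) * rho `^ al); last first.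
      by field; rewrite gt_eqF.
    by near: rho; apply: near_powR_le => //; exact: divr_gt0.
near=> r => a0 b0 a1 b1 [[a0P b0P] ab0 [a1P b1P] ab1].
have r0 : 0 < r by [].
have r1 : r <= 1 by near: r; exact: nbhs_right_le.
have r_rho : 3 * r <= rho by near: r; exact: near_mul_le.
have rho_t1 : t + rho <= t1 by rewrite -lerBrDl (le_trans rhoT)// ler_pdivrMr// ler_peMr ?ler1n// ltW.
have rhor : 0 < rho - r by lra.
pose Q := (rho + r) / (rho - r).
have Q1 : Q - 1 <= 3 * r / rho.
  rewrite (_ : Q - 1 = 2 * r / (rho - r)); last by rewrite /Q; field; rewrite gt_eqF.
  by rewrite ler_pdivrMr// mulrAC ler_pdivlMr//; nra.
have Q_ge1 : 1 <= Q by rewrite ler_pdivlMr//; lra.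
have Q0 : 0 < Q by exact: lt_le_trans Q_ge1.
have Q_le2 : Q <= 2 by rewrite ler_pdivrMr//; lra.
have QV : 1 - Q^-1 <= Q - 1.
  rewrite -(ler_pM2r Q0) mulrBl mulVf ?gt_eqF// mul1r.
  by rewrite ler_peMr// subr_ge0.
have QVle1 : Q^-1 <= 1 by rewrite invf_le1.
set c := vratio al t1 a0 b0 a1 b1.
have /andP[clo chi] : r / Q <= c <= r * Q.
  exact: (vratio_bounds al01 r0 r1 r_rho rho_t1 a0P b0P ab0 a1P b1P ab1).
split.
- exact: (vramp_t1 al01 r0 r1 r_rho rho_t1 a0P b0P a1P b1P ab1).
- by move=> s; exact: (vramp_eq0 al t1 r0 a0P ab0 a1P ab1).
- move=> s; apply: (le_trans (vramp_sup al01 r0 r1 r_rho rho_t1 a0P b0P ab0 a1P b1P ab1 s)).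
  apply: (@le_trans _ _ (3 / al * r `^ al)); last by near: r; exact: near_powR_le.
  rewrite [leRHS]mulrAC ler_pM2r ?invr_gt0//.
  have : (r ^+ 2) `^ al <= r `^ al.
    apply: (ge0_ler_powR (ltW al0)); rewrite ?nnegrE ?sqr_ge0 ?(ltW r0)//.
    by rewrite expr2 ler_piMr// ltW.
  have : r * r `^ al <= 1 * r `^ al by rewrite ler_wpM2r// powR_ge0.
  by move=> *; lra.
- split; first exact: (vratio_ge0 t1 al01 r0 ab0 ab1).
  apply: (@le_trans _ _ (Q - 1)).
    rewrite ler_norml; apply/andP; split.
      have : Q^-1 <= c / r by rewrite ler_pdivlMr// mulrC.
      by move=> *; lra.
    by rewrite lerD2r ler_pdivrMr// mulrC.
  apply: (le_trans Q1); rewrite mulrAC.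
  by near: r; exact: near_mul_le.
(* The constant 12: Q^2 - 1 <= 3 (Q - 1) and 1 - 1/Q <= Q - 1 give Q^2 - 1/Q <= 4 (Q - 1), and Q - 1
   <= 3 r / rho. *)
- pose far := r ^+ 2 * (rho `^ (al - 1) * (12 * r / rho)).
  have far0 : 0 <= far.
    by rewrite !mulr_ge0 ?sqr_ge0 ?powR_ge0 ?invr_ge0// ltW.
  have mv : measurable_fun `[t0, t1] (fun s => `|vramp al t1 a0 b0 a1 b1 s|).
    apply: measurableT_comp => //; apply: measurable_funTS; apply: continuous_measurable_fun.
    exact: continuous_vramp.
  have mA : measurable_fun `[t0, t1] (fun s : R => (t1 - s) `^ (be - 1)).
    exact: measurable_powR_subr.
  pose Z := `[t - r, t + rho]%classic : set R.
  have mZ : measurable_fun `[t0, t1] (\1_Z : R -> R).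
    by apply: measurable_funTS; apply: measurable_indic; exact: measurable_itv.
  have mZv : measurable_fun `[t0, t1] (fun s => `|vramp al t1 a0 b0 a1 b1 s| * \1_Z s).
    exact: measurable_funM.
  (* Near t the weight is replaced by its bound; beyond t + rho it is kept, since it may blow up at
     t1 and is only integrable. *)
  apply: (@le_trans _ _ (\int[lebesgue_measure]_(s in `[t0, t1])
    (Amax%:E * (`|vramp al t1 a0 b0 a1 b1 s| * \1_Z s)%:E +
     far%:E * ((t1 - s) `^ (be - 1))%:E))%E).
    apply: ge0_le_integral => //.
    - by move=> s _; rewrite lee_fin mulr_ge0 ?powR_ge0.
    - by apply/measurable_EFinP; exact: measurable_funM.
    - by apply/measurable_EFinP; apply: measurable_funD; exact: measurable_funM.
    - move=> s; rewrite /= in_itv/= => /andP[t0s st1].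
      rewrite -!EFinM -EFinD lee_fin.
      have [sr|rs] := leP s (t - r).
        rewrite (vramp_eq0 al t1 r0 a0P ab0 a1P ab1 sr) normr0 mulr0 mul0r mulr0 add0r.
        by rewrite mulr_ge0 ?powR_ge0.
      have [srho|rhos] := leP s (t + rho).
        rewrite indicE mem_setE in_itv/= (ltW rs) srho mulr1 -[leLHS]addr0.
        apply: lerD; last by rewrite mulr_ge0 ?powR_ge0.
        rewrite ler_wpM2r//.
        have [b1'|b1'] := leP (be - 1) 0.
          apply: (@le_trans _ _ ((T / 2) `^ (be - 1))); last by rewrite lerDl powR_ge0.
          by apply: ler_powR_npos => //; [exact: divr_gt0|rewrite /T in rhoT *; lra].
        apply: (@le_trans _ _ ((t1 - t0) `^ (be - 1))); last by rewrite lerDr powR_ge0.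
        by apply: (ge0_ler_powR (ltW b1')); rewrite ?nnegrE; lra.
      rewrite indicE mem_setE in_itv/= [s <= t + rho]leNgt rhos andbF mulr0 mulr0 add0r.
      rewrite mulrC ler_wpM2r ?powR_ge0//.
      apply: (le_trans (vramp_far al01 r0 r1 r_rho rho_t1 a0P b0P ab0 a1P b1P ab1 (ltW rhos))).
      rewrite ler_wpM2l ?sqr_ge0// ler_wpM2l ?powR_ge0//.
      apply: (@le_trans _ _ (4 * (Q - 1))).
        rewrite -/Q; have : (Q - 1) * (Q + 1) <= (Q - 1) * 3.
          by rewrite ler_wpM2l ?subr_ge0//; lra.
        by rewrite -subr_sqr expr1n => *; lra.
      rewrite [leRHS](_ : _ = 4 * (3 * r / rho)); last by field; rewrite gt_eqF.
      by rewrite ler_wpM2l.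
  rewrite ge0_integralD//; last 4 first.
  - by move=> s _; rewrite -EFinM lee_fin !mulr_ge0 ?indicE.
  - by apply/measurable_EFinP; exact: measurable_funM.
  - by move=> s _; rewrite -EFinM lee_fin mulr_ge0 ?powR_ge0.
  - by apply/measurable_EFinP; exact: measurable_funM.
  rewrite ge0_integralZl//; last exact/measurable_EFinP.
  rewrite ge0_integralZl//; last 2 first.
  - exact/measurable_EFinP.
  - by move=> s _; rewrite lee_fin powR_ge0.
  have -> : (eta * r ^+ 2)%:E = ((eta / 2 * r ^+ 2)%:E + (eta / 2 * r ^+ 2)%:E)%E.
    by rewrite -EFinD; congr EFin; field.
  apply: leeD.
    apply: (@le_trans _ _ (Amax%:E * (r ^+ 2 * (6 * (2 * rho) `^ al / al))%:E)%E).
      apply: lee_wpmul2l; first by rewrite lee_fin.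
      apply: (le_trans _ (integral_vramp_near al01 r0 r1 r_rho rho_t1 a0P b0P ab0 a1P b1P ab1)).
      rewrite integral_mkcond [leRHS]integral_mkcond; apply: ge0_le_integral => //.
      - by move=> s _; rewrite patchE; case: ifP => // _; rewrite lee_fin mulr_ge0 ?indicE.
      - by apply/(measurable_restrictT _ _).1 => //; exact/measurable_EFinP.
      - apply/(measurable_restrictT _ _).1 => //; apply/measurable_EFinP.
        apply: measurableT_comp => //; apply: measurable_funTS; apply: continuous_measurable_fun.
        exact: continuous_vramp.
      - move=> s _; rewrite !patchE !mem_setE indicE /Z mem_setE.
        by case: ifP => _; case: ifP => _ /=; rewrite ?mulr1 ?mulr0 ?lexx// lee_fin.
    rewrite -EFinM lee_fin mulrCA mulrC ler_wpM2r ?sqr_ge0//.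
  apply: (@le_trans _ _ (far%:E * IA%:E)%E).
    apply: lee_wpmul2l; first by rewrite lee_fin.
    rewrite /IA -(integral_powR_right be0 (ltW (lt_trans t0t tt1))).
    by rewrite integral_itv_bndo_bndc//; apply/measurable_EFinP; exact: measurable_powR_subr.
  rewrite -EFinM lee_fin /far.
  rewrite [leLHS](_ : _ = (rho `^ (al - 1) * 12 / rho * IA) * r * r ^+ 2); last first.
    by field; rewrite gt_eqF.
  rewrite ler_wpM2r ?sqr_ge0//; near: r; apply: near_mul_le; exact: divr_gt0.
Unshelve. all: by end_near. Qed.

Lemma near_notin (R : realType) (S : seq R) (s : R) : s \notin S ->
  \forall u \near s, u \notin S.
Proof.
elim: S => [|x S ih]; first by move=> _; near=> u.
rewrite inE negb_or => /andP[sx /ih H].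
have Hx : \forall u \near s, u != x.
  by apply: open_nbhs_nbhs; split; [exact: open_neq|].
by near=> u; rewrite inE negb_or; apply/andP; split; near: u.
Unshelve. all: by end_near. Qed.

(** The point s may itself lie in S: it is filtered out first, being excluded anyway by u < s. *)
Lemma at_left_notin (R : realType) (S : seq R) (s : R) :
  \forall u \near s^'-, u \notin S.
Proof.
have : s \notin [seq x <- S | x != s] by rewrite mem_filter eqxx.
move=> /near_notin H; change (\forall u \near s, u < s -> u \notin S).
apply: filterS H => u; rewrite mem_filter negb_and negbK => /orP[/eqP -> |//].
by rewrite ltxx.
Qed.

Lemma at_right_notin (R : realType) (S : seq R) (s : R) :
  \forall u \near s^'+, u \notin S.
Proof.
have : s \notin [seq x <- S | x != s] by rewrite mem_filter eqxx.
move=> /near_notin H; change (\forall u \near s, s < u -> u \notin S).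
apply: filterS H => u; rewrite mem_filter negb_and negbK => /orP[/eqP -> |//].
by rewrite ltxx.
Qed.

(** * The Lagrangian near the graph *)

Definition C1_on (R : realType) (n : nat) (L : R -> 'rV[R]_n -> 'rV[R]_n -> R)
    (U : set (R * 'rV[R]_n * 'rV[R]_n)) : Prop := forall z, U z ->
  [/\ has_grad (fun u => L z.1.1 u z.2) z.1.2,
      has_grad (L z.1.1 z.1.2) z.2,
      {for z, continuous (fun w => L w.1.1 w.1.2 w.2)},
      {for z, continuous (fun w => gradx L w.1.1 w.1.2 w.2)}
    & {for z, continuous (fun w => grady L w.1.1 w.1.2 w.2)}].

Section lagrangian.
Context {R : realType} {n : nat}.
Variables (L : R -> 'rV[R]_n -> 'rV[R]_n -> R) (U : set (R * 'rV[R]_n * 'rV[R]_n)).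
Hypothesis oU : open U.
Hypothesis LU : C1_on L U.

Definition C1_close (z0 : R * 'rV[R]_n * 'rV[R]_n) (eta s : R) (u y : 'rV[R]_n) : Prop :=
  [/\ U (s, u, y), `|L s u y - L z0.1.1 z0.1.2 z0.2| <= eta,
      forall i, `|gradx L s u y 0 i - gradx L z0.1.1 z0.1.2 z0.2 0 i| <= eta
    & forall i, `|grady L s u y 0 i - grady L z0.1.1 z0.1.2 z0.2 0 i| <= eta].

Lemma C1_close_ball (t : R) (x p : 'rV[R]_n) (eta : R) : U (t, x, p) -> 0 < eta ->
  exists2 e : R, 0 < e & forall s u y,
    `|s - t| < e -> `|u - x| < e -> `|y - p| < e -> C1_close (t, x, p) eta s u y.
Proof.
move=> Uz eta0; have [_ _ cL cx cy] := LU Uz.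
have box (P : set (R * 'rV[R]_n * 'rV[R]_n)) :
    nbhs ((t, x, p) : (R * 'rV[R]_n * 'rV[R]_n)%type) P -> exists2 e : R, 0 < e &
    forall s u y, `|s - t| < e -> `|u - x| < e -> `|y - p| < e -> P (s, u, y).
  move=> /nbhs_ballP[e /= e0 He]; exists e => // s u y st ux yp.
  by apply: (He (s, u, y)); split; first split; rewrite -ball_normE/= distrC.
have [e1 e10 H1] : exists2 e : R, 0 < e &
    forall s u y, `|s - t| < e -> `|u - x| < e -> `|y - p| < e -> U (s, u, y).
  by apply: box; exact: open_nbhs_nbhs.
have [e2 e20 H2] := box _ ((cvgrPdist_le _ _).1 cL _ eta0).
have [e3 e30 H3] := box _ ((cvgrPdist_le _ _).1 cx _ eta0).
have [e4 e40 H4] := box _ ((cvgrPdist_le _ _).1 cy _ eta0).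
exists (Num.min (Num.min e1 e2) (Num.min e3 e4)); first by rewrite !lt_min e10 e20 e30 e40.
move=> s u y; rewrite !lt_min => /andP[/andP[? ?] /andP[? ?]].
move=> /andP[/andP[? ?] /andP[? ?]] /andP[/andP[? ?] /andP[? ?]]; split.
- exact: H1.
- by rewrite distrC; exact: H2.
- move=> i; apply: le_trans (H3 s u y _ _ _) => //; rewrite distrC.
  by apply: le_trans (ler_coord_norm _ i); rewrite !mxE.
- move=> i; apply: le_trans (H4 s u y _ _ _) => //; rewrite distrC.
  by apply: le_trans (ler_coord_norm _ i); rewrite !mxE.
Qed.

Lemma continuous_lagrangian (x phi : R -> 'rV[R]_n) (s : R) :
  {for s, continuous x} -> {for s, continuous phi} -> U (s, x s, phi s) ->
  {for s, continuous (fun v => L v (x v) (phi v))}.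
Proof.
move=> cx cphi Us; apply/cvgrPdist_le => eta eta0.
have [e e0 H] := C1_close_ball Us eta0.
have Hx : \forall v \near s, `|x v - x s| < e.
  by apply: filterS ((cvgrPdist_lt _ _).1 cx _ e0) => v; rewrite distrC.
have Hphi : \forall v \near s, `|phi v - phi s| < e.
  by apply: filterS ((cvgrPdist_lt _ _).1 cphi _ e0) => v; rewrite distrC.
have Hs : \forall v \near s, `|v - s| < e.
  by apply: filterS ((cvgrPdist_lt _ _).1 (@cvg_id _ (nbhs s)) _ e0) => v; rewrite distrC.
apply: filterS3 Hs Hx Hphi => v vs xv phiv; rewrite distrC.
by have [] := H v (x v) (phi v) vs xv phiv.
Qed.

(** Taking 0 as reference gradient turns the linearization estimate into a Lipschitz bound. *)
Lemma increment_x_le (s M : R) (u u' y : 'rV[R]_n) :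
  (forall v, `|v - u| <= `|u' - u| -> U (s, v, y) /\ forall i, `|gradx L s v y 0 i| <= M) ->
  `|L s u' y - L s u y| <= M * n%:R * `|u' - u|.
Proof.
move=> H; have := @grad_increment_le _ _ (fun v => L s v y) u (u' - u) 0 M.
rewrite addrCA subrr addr0 (_ : dotv 0 _ = 0) ?subr0; last first.
  by rewrite /dotv big1// => i _; rewrite mxE mul0r.
apply => z /H [/LU[hx _ _ _ _] b]; split => // i.
by rewrite [X in _ - X]mxE subr0; exact: b.
Qed.

Lemma increment_y_le (s eta : R) (u y w q : 'rV[R]_n) :
  (forall z, `|z - y| <= `|w| -> U (s, u, z) /\ forall i, `|grady L s u z 0 i - q 0 i| <= eta) ->
  `|L s u (y + w) - L s u y - dotv q w| <= eta * n%:R * `|w|.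
Proof.
move=> H; apply: (@grad_increment_le _ _ (L s u)) => z /H [/LU[_ hy _ _ _] b].
by split.
Qed.

End lagrangian.

Lemma integrable_co_cc (R : realType) (a b : R) (f : R -> R) :
  lebesgue_measure.-integrable `[a, b[ (EFin \o f) ->
  lebesgue_measure.-integrable `[a, b] (EFin \o f).
Proof.
move=> /integrableP[mf If]; apply/integrableP.
have mf' : measurable_fun `[a, b[ f by exact/measurable_EFinP.
split; first by apply/measurable_EFinP; exact: (measurable_fun_itv_cc mf').
rewrite -integral_itv_bndo_bndc//.
by apply/measurable_EFinP; apply: measurableT_comp.
Qed.

Lemma seq_bounded (R : realType) (F : seq R) (l : R -> R) :
  exists M, forall s, s \in F -> `|l s| <= M.
Proof.
elim: F => [|x F [M HM]]; first by exists 0.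
exists (Num.max M `|l x|) => s; rewrite inE le_max => /predU1P[->|/HM ->//].
by rewrite lexx orbT.
Qed.

(** The weight is the fractional kernel of order be at t1, so [integrable_fint] applies; the
    finitely many uncontrolled values are absorbed into the bound. *)
Lemma integrable_weighted_off (R : realType) (be t0 t1 M : R) (S : seq R) (l : R -> R) :
  0 < be ->
  (forall s, t0 < s < t1 -> s \notin S -> {for s, continuous l}) ->
  (forall s, t0 < s < t1 -> s \notin S -> `|l s| <= M) ->
  lebesgue_measure.-integrable `[t0, t1] (EFin \o (fun s => (t1 - s) `^ (be - 1) * l s)).
Proof.
move=> be0 cl bl; apply: integrable_co_cc.
have [M' HM'] := seq_bounded [:: t0, t1 & S] l.
apply: (integrable_fint (M := Num.max M M')) => //; first exact: (measurable_fun_off_seq cl).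
move=> s /andP[t0s st1]; rewrite le_max.
have [/HM' ->|] := boolP (s \in [:: t0, t1 & S]); first by rewrite orbT.
rewrite !inE !negb_or => /and3P[st0 _ sS]; rewrite bl// st1 andbT.
by rewrite lt_neqAle eq_sym st0.
Qed.

(** A single parameter k serves as radius and, through its inverse, as bound: both conditions relax
    as k -> 0, so one compactness argument gives them together. At a jump both limits must lie in U,
    since phi comes close to each of them. *)
Lemma tube (R : realType) (n : nat) (L : R -> 'rV[R]_n -> 'rV[R]_n -> R)
    (U : set (R * 'rV[R]_n * 'rV[R]_n)) (t0 t1 : R) (S : seq R) (x phi : R -> 'rV[R]_n) :
  open U ->
  C1_on L U ->
  {within `[t0, t1], continuous x} ->
  (forall s, t0 < s <= t1 -> exists2 p, phi @ s^'- --> p & U (s, x s, p)) ->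
  (forall s, t0 <= s < t1 -> exists2 p, phi @ s^'+ --> p & U (s, x s, p)) ->
  (forall s, t0 < s < t1 -> s \notin S -> U (s, x s, phi s)) ->
  exists kappa M : R, 0 < kappa /\
    forall s, t0 < s < t1 -> s \notin S -> forall u, `|u - x s| < kappa ->
    [/\ U (s, u, phi s), `|L s u (phi s)| <= M & forall i, `|gradx L s u (phi s) 0 i| <= M].
Proof.
move=> oU LU /subspace_continuousP cx Hl Hr Hc.
pose P (k s : R) := t0 < s < t1 -> s \notin S -> forall u, `|u - x s| < k ->
    [/\ U (s, u, phi s), `|L s u (phi s)| <= k^-1 & forall i, `|gradx L s u (phi s) 0 i| <= k^-1].
have box t p : U (t, x t, p) -> exists2 e : R, 0 < e & forall s,
    `|s - t| < e -> `|x s - x t| < e -> `|phi s - p| < e ->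
    forall k, 0 < k -> k < e -> P k s.
  move=> Uz; have [e e0 H] := C1_close_ball oU LU Uz ltr01.
  pose M := `|L t (x t) p| + `|gradx L t (x t) p| + 1.
  have M0 : 0 < M by rewrite ltr_wpDl// addr_ge0.
  (* The first half of e is kept for the motion of x; the second entry forces k^-1 >= M. *)
  exists (Num.min (e / 2) M^-1); first by rewrite lt_min divr_gt0// invr_gt0.
  move=> s; rewrite !lt_min => /andP[st _] /andP[xs _] /andP[ph _] k k0.
  rewrite lt_min => /andP[ke kM] _ _ u ux.
  have e2 : e / 2 < e by rewrite ltr_pdivrMr// ltr_pMr// ltr1n.
  have Mk : M <= k^-1 by rewrite -(invrK M) lef_pV2 ?posrE ?invr_gt0// ltW.
  have [||| hU hL hx _] := H s u (phi s).
  - exact: lt_trans e2.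
  - rewrite -(subrK (x s) u) -addrA (le_lt_trans (ler_normD _ _))// (splitr e) ltrD//.
    exact: lt_trans ke.
  - exact: lt_trans e2.
  have near1 (a b : R) : `|a - b| <= 1 -> `|a| <= `|b| + 1.
    by move=> ab; rewrite -(subrK b a) (le_trans (ler_normD _ _))// addrC lerD2l.
  split => //; first by apply: le_trans Mk; rewrite (le_trans (near1 _ _ hL))// /M lerD2r lerDl.
  move=> i; apply: le_trans Mk; rewrite (le_trans (near1 _ _ (hx i)))// /M lerD2r.
  by rewrite (le_trans (ler_coord_norm _ i))// lerDr.
have small_k e : 0 < e -> \forall k \near (0:R)^'+, 0 < k /\ k < e.
  by move=> e0; near=> k; split => //; near: k; exact: nbhs_right_lt.
have step (G : set_system R) t p : Filter G -> G --> nbhs t ->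
    x @ G --> x t -> phi @ G --> p -> U (t, x t, p) ->
    \forall s \near G & k \near (0:R)^'+, P k s.
  move=> FG Gt xG phiG /box[e e0 He].
  have H1 : \forall s \near G, `|s - t| < e.
    by apply: filterS ((cvgrPdist_lt _ _).1 Gt _ e0) => s; rewrite distrC.
  have H2 : \forall s \near G, `|x s - x t| < e.
    by apply: filterS ((cvgrPdist_lt _ _).1 xG _ e0) => s; rewrite distrC.
  have H3 : \forall s \near G, `|phi s - p| < e.
    by apply: filterS ((cvgrPdist_lt _ _).1 phiG _ e0) => s; rewrite distrC.
  exists ([set s | [/\ `|s - t| < e, `|x s - x t| < e & `|phi s - p| < e]], [set k | 0 < k /\ k < e]).
    split; last exact: small_k.
    by apply: filterS3 H1 H2 H3 => s h1 h2 h3; split.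
  by move=> [s k] /= [[h1 h2 h3] [k0 ke]]; exact: He.
have : \forall k \near (0:R)^'+, `[t0, t1] `<=` P k.
  apply: segment_near => t tt.
  - have [p php Up] := Hl t tt; have /andP[t0t tt1] := tt.
    apply: (@step _ t p) => //; first exact: cvg_within.
    apply: cvg_trans (cx t _); last by rewrite /= in_itv/= (ltW t0t).
    by apply: cvg_app; exact: at_left_within.
  - have [p php Up] := Hr t tt; have /andP[t0t tt1] := tt.
    apply: (@step _ t p) => //; first exact: cvg_within.
    apply: cvg_trans (cx t _); last by rewrite /= in_itv/= t0t ltW.
    by apply: cvg_app; exact: at_right_within.
  - have [t01|nt] := pselect (t0 < t < t1 /\ t \notin S); last first.
      by apply: nearW => k h1 h2; exfalso; exact: nt.
    have [e e0 He] := box t (phi t) (Hc t t01.1 t01.2).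
    apply: filterS (small_k e e0) => k [k0 ke].
    by apply: He; rewrite ?subrr ?normr0.
move=> H; have : \forall k \near (0:R)^'+, 0 < k /\ `[t0, t1] `<=` P k.
  by near=> k; split => //; near: k.
move=> /filter_ex[k [k0 Hk]]; exists k, k^-1; split => // s s01 sS u us.
have /andP[t0s st1] := s01.
by apply: (Hk s) => //=; rewrite in_itv/= !ltW.
Unshelve. all: by end_near. Qed.

Lemma Cnorm_lt (R : realType) (n : nat) (t0 t1 e d : R) (f : R -> 'rV[R]_n) :
  t0 <= t1 -> (forall t, t0 <= t <= t1 -> `|f t| <= e) -> e < d -> Cnorm t0 t1 f < d.
Proof.
move=> t01 H; apply: le_lt_trans; apply: ge_sup.
  by exists `|f t0|; exists t0 => //=; rewrite in_itv/= lexx.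
by move=> _ [t /= + <-]; rewrite in_itv/=; exact: H.
Qed.

(** * The variation of the extremal *)

Lemma cvg_step_left (R : realType) (a b s : R) : cvg (step a b @ s^'-).
Proof.
have H c : \forall u \near s^'-, (c <= u) = (c < s).
  have [cs|sc] := ltP c s.
    by near=> u; apply/ltW; near: u; exact: nbhs_left_gt.
  near=> u; apply/negbTE; rewrite -ltNge (lt_le_trans _ sc)//.
apply/cvg_ex; exists ((a < s)%R%:R - (b < s)%R%:R).
apply: cvg_near_cst; near=> u; rewrite /step.
by congr (_%:R - _%:R); congr nat_of_bool; near: u; exact: H.
Unshelve. all: by end_near. Qed.

Lemma cvg_step_right (R : realType) (a b s : R) : cvg (step a b @ s^'+).
Proof.
have H c : \forall u \near s^'+, (c <= u) = (c <= s).
  have [cs|sc] := leP c s.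
    by near=> u; rewrite (le_trans cs)// ltW.
  near=> u; apply/negbTE; rewrite -ltNge; near: u; exact: nbhs_right_lt.
apply/cvg_ex; exists ((a <= s)%R%:R - (b <= s)%R%:R).
apply: cvg_near_cst; near=> u; rewrite /step.
by congr (_%:R - _%:R); congr nat_of_bool; near: u; exact: H.
Unshelve. all: by end_near. Qed.

Lemma continuous_step (R : realType) (a b s : R) : s != a -> s != b ->
  {for s, continuous (step a b)}.
Proof.
have H c : s != c -> \forall u \near s, (c <= u) = (c <= s).
  rewrite neq_lt => /orP[sc|cs].
    by near=> u; rewrite [c <= s]leNgt sc; apply/negbTE; rewrite -ltNge; near: u; exact: lt_nbhsl.
  by near=> u; rewrite (ltW cs); apply/ltW; near: u; exact: lt_nbhsr.
move=> sa sb; apply: (@near_cst_continuous _ _ (step a b s)); near=> u; rewrite /step.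
by congr (_%:R - _%:R); congr nat_of_bool; near: u; exact: H.
Unshelve. all: by end_near. Qed.

Section variation.
Context {R : realType} {n : nat}.
Variables (al t0 t1 : R) (psi x : R -> 'rV[R]_n) (S : seq R).
Hypothesis al01 : 0 < al <= 1.
Hypothesis St : forall t, t \in S -> t0 < t < t1.
Hypothesis cS : forall t, t0 <= t <= t1 -> t \notin S ->
  psi @ within `[t0, t1] (nbhs t) --> psi t.
Hypothesis jS : forall t, t \in S -> cvg (psi @ t^'-) /\ cvg (psi @ t^'+).
Hypothesis cx : {within `[t0, t1], continuous x}.
Hypothesis xE : forall t, t0 <= t <= t1 -> x t = x t0 + fracint al t0 psi t.
Hypothesis K0 : caputo_const al != 0.
Variables (a b c d c' d' : R).
Hypothesis D : forall s, s \in [:: a; b; c; d; c'; d'] -> t0 < s < t1.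
Hypothesis ab : a <= b.
Hypothesis cd : c <= d.
Hypothesis cd' : c' <= d'.
Hypothesis G1 : vramp al t1 a b c d t1 = 0.
Hypothesis G2 : vramp al t1 a b c' d' t1 = 0.
Variables (v w : 'rV[R]_n).

Let h (s : R) : 'rV[R]_n := vstep al t1 a b c d s *: v + vstep al t1 a b c' d' s *: w.

(** The Caputo derivative is [caputo_const] times the density, so adding [h] to the derivative means
    adding [h] divided by that constant to [psi]. The factor 1 / Gamma(al) comes from [fracint]. *)
Definition variation (s : R) : 'rV[R]_n :=
  x s + ((eulerGamma al)^-1 * (caputo_const al)^-1) *:
    (vramp al t1 a b c d s *: v + vramp al t1 a b c' d' s *: w).

Let psi' (s : R) : 'rV[R]_n := psi s + (caputo_const al)^-1 *: h s.

Let S' := S ++ [:: a; b; c; d; c'; d'].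

Let vstep_cvg (F : set_system R) (p q p' q' : R) : Filter F ->
  cvg (step p q @ F) -> cvg (step p' q' @ F) ->
  cvg (vstep al t1 p q p' q' @ F).
Proof.
move=> FF cpq cpq'; apply: is_cvgB => //; apply: is_cvgM => //; exact: is_cvg_cst.
Qed.

Let h_cvg (F : set_system R) : Filter F ->
  (forall p q, p \in [:: a; b; c; d; c'; d'] -> q \in [:: a; b; c; d; c'; d'] ->
    cvg (step p q @ F)) -> cvg (h @ F).
Proof.
move=> FF H; apply: is_cvgD; (apply: is_cvgZ; last exact: is_cvg_cst);
  by apply: vstep_cvg; apply: H; rewrite !inE eqxx ?orbT.
Qed.

Lemma variation_St t : t \in S' -> t0 < t < t1.
Proof. by rewrite mem_cat => /orP[/St//|/D]. Qed.

Let h_cont t : t \notin S' -> {for t, continuous h}.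
Proof.
rewrite mem_cat negb_or !inE !negb_or => /andP[_].
move=> /and5P[ta tb tc td /andP[tc' td']].
have vs p q p' q' : t != p -> t != q -> t != p' -> t != q' ->
    {for t, continuous (vstep al t1 p q p' q')}.
  move=> *; apply: cvgB; first exact: continuous_step.
  by apply: cvgMr; exact: continuous_step.
by apply: cvgD; (apply: cvgZ; last exact: cvg_cst); apply: vs.
Qed.

Lemma variation_cS t : t0 <= t <= t1 -> t \notin S' ->
  psi' @ within `[t0, t1] (nbhs t) --> psi' t.
Proof.
move=> t01 tS'; have tS : t \notin S by move: tS'; rewrite mem_cat negb_or => /andP[].
apply: cvgD; first exact: cS.
by apply: cvgZ; [exact: cvg_cst|apply: cvg_within_filter; exact: h_cont].
Qed.

Lemma variation_jS t : t \in S' -> cvg (psi' @ t^'-) /\ cvg (psi' @ t^'+).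
Proof.
move=> /variation_St /andP[t0t tt1]; split.
- apply: is_cvgD; first by apply: (pc_cvg_left cS jS); rewrite t0t ltW.
  apply: is_cvgZ; first exact: is_cvg_cst.
  apply: h_cvg => p q _ _; exact: cvg_step_left.
- apply: is_cvgD; first by apply: (pc_cvg_right cS jS); rewrite tt1 ltW.
  apply: is_cvgZ; first exact: is_cvg_cst.
  apply: h_cvg => p q _ _; exact: cvg_step_right.
Qed.

Let t0D p : p \in [:: a; b; c; d; c'; d'] -> t0 <= p.
Proof. by move=> /D /andP[/ltW]. Qed.

Let int_step p q s : lebesgue_measure.-integrable `[t0, s[
  (EFin \o (fun u => (s - u) `^ (al - 1) * step p q u)).
Proof.
have /andP[al0 _] := al01.
apply: (integrable_fint (M := 2)) => //; first exact: measurable_step.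
move=> u _; rewrite /step; case: (p <= u); case: (q <= u) => /=;
  by rewrite ?subrr ?subr0 ?sub0r ?normrN ?normr0 ?normr1 ?ler1n.
Qed.

Let int_scale (e s : R) (g : R -> R) :
  lebesgue_measure.-integrable `[t0, s[ (EFin \o (fun u => (s - u) `^ (al - 1) * g u)) ->
  lebesgue_measure.-integrable `[t0, s[ (EFin \o (fun u => (s - u) `^ (al - 1) * (e * g u))).
Proof.
move=> ig; rewrite (_ : (fun _ => _) = (fun u => e * ((s - u) `^ (al - 1) * g u))).
  exact: (@integrableZl _ _ _ lebesgue_measure _ (measurable_itv _) e _ ig).
by apply/funext => u; rewrite mulrCA.
Qed.

Let int_add (s : R) (f g : R -> R) :
  lebesgue_measure.-integrable `[t0, s[ (EFin \o (fun u => (s - u) `^ (al - 1) * f u)) ->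
  lebesgue_measure.-integrable `[t0, s[ (EFin \o (fun u => (s - u) `^ (al - 1) * g u)) ->
  lebesgue_measure.-integrable `[t0, s[ (EFin \o (fun u => (s - u) `^ (al - 1) * (f u + g u))).
Proof.
move=> jf jg; rewrite (_ : (fun _ => _) =
  (fun u => (s - u) `^ (al - 1) * f u + (s - u) `^ (al - 1) * g u)).
  exact: (@integrableD _ _ _ lebesgue_measure _ (measurable_itv _) _ _ jf jg).
by apply/funext => u; rewrite mulrDr.
Qed.

Let int_vstep p q p' q' s : lebesgue_measure.-integrable `[t0, s[
  (EFin \o (fun u => (s - u) `^ (al - 1) * vstep al t1 p q p' q' u)).
Proof.
rewrite (_ : vstep _ _ _ _ _ _ = (fun u => step p q u + - vratio al t1 p q p' q' * step p' q' u)).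
  by apply: int_add; [exact: int_step|apply: int_scale; exact: int_step].
by apply/funext => u; rewrite mulNr.
Qed.

Let fint_vstep p q p' q' s : t0 <= p -> t0 <= q -> t0 <= p' -> t0 <= q' ->
  fint al t0 (vstep al t1 p q p' q') s = vramp al t1 p q p' q' s.
Proof.
move=> *; rewrite (_ : vstep _ _ _ _ _ _ =
    (fun u => step p q u + - vratio al t1 p q p' q' * step p' q' u)); last first.
  by apply/funext => u; rewrite mulNr.
rewrite fintD; [|exact: int_step|by apply: int_scale; exact: int_step].
rewrite fintZ; last exact: int_step.
by rewrite !fint_step// mulNr.
Qed.

Lemma variation_fracint t : t0 <= t <= t1 ->
  variation t = variation t0 + fracint al t0 psi' t.
Proof.
move=> /[dup] t01 /andP[t0t tt1].
have vr0 p q p' q' : t0 <= p -> p <= q -> t0 <= p' -> p' <= q' ->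
    vramp al t1 p q p' q' t0 = 0.
  by move=> *; rewrite /vramp !ramp_eq0// mulr0 subrr.
have [a_ b_ c_] : [/\ t0 <= a, t0 <= b & t0 <= c].
  by split; apply: t0D; rewrite !inE eqxx ?orbT.
have [d_ c'_ d'_] : [/\ t0 <= d, t0 <= c' & t0 <= d'].
  by split; apply: t0D; rewrite !inE eqxx ?orbT.
rewrite /variation !vr0// !scale0r addr0 scaler0 addr0 xE// -addrA; congr (_ + _).
apply/rowP => i; rewrite mxE !fracintE.
rewrite -(@fint_vstep a b c d)// -(@fint_vstep a b c' d')//.
have [M HM] := pc_coord_bounded cS jS i.
have /andP[al0 _] := al01.
have ipsi : lebesgue_measure.-integrable `[t0, t[
    (EFin \o (fun u => (t - u) `^ (al - 1) * psi u 0 i)).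
  apply: (integrable_fint (M := M)) => //; first exact: (pc_coord_measurable cS).
  by move=> u /andP[t0u ut]; rewrite HM// t0u ltW// (lt_le_trans ut).
have iv := int_vstep a b c d t; have iw := int_vstep a b c' d' t.
rewrite (@eq_fint _ _ _ _ (fun u => psi' u 0 i) (fun u => psi u 0 i + (caputo_const al)^-1 *
    (v 0 i * vstep al t1 a b c d u + w 0 i * vstep al t1 a b c' d' u))); last first.
  by move=> u _; rewrite /psi' /h !mxE (mulrC (v 0 i)) (mulrC (w 0 i)).
rewrite fintD//; last by apply: int_scale; apply: int_add; exact: int_scale.
rewrite fintZ; last by apply: int_add; exact: int_scale.
rewrite (fintD (int_scale (v 0 i) iv) (int_scale (w 0 i) iw)).
by rewrite (fintZ (v 0 i) iv) (fintZ (w 0 i) iw) !mxE; ring.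
Qed.

Lemma variation_continuous : {within `[t0, t1], continuous variation}.
Proof.
have cd0 : continuous (fun s => ((eulerGamma al)^-1 * (caputo_const al)^-1) *:
    (vramp al t1 a b c d s *: v + vramp al t1 a b c' d' s *: w)).
  move=> s; apply: cvgZ; first exact: cvg_cst.
  by apply: cvgD; (apply: cvgZ; last exact: cvg_cst); exact: continuous_vramp.
apply/subspace_continuousP => s s01; apply: cvgD.
  by move/subspace_continuousP : cx; exact.
by apply: cvg_within_filter; exact: cd0.
Qed.

Lemma variation_t0 : variation t0 = x t0.
Proof.
rewrite /variation.
have vr0 p q p' q' : t0 <= p -> p <= q -> t0 <= p' -> p' <= q' ->
    vramp al t1 p q p' q' t0 = 0.
  by move=> *; rewrite /vramp !ramp_eq0// mulr0 subrr.
have [a_ c_ c'_] : [/\ t0 <= a, t0 <= c & t0 <= c'].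
  by split; apply: t0D; rewrite !inE eqxx ?orbT.
by rewrite !vr0// !scale0r addr0 scaler0 addr0.
Qed.

Lemma variation_t1 : variation t1 = x t1.
Proof. by rewrite /variation G1 G2 !scale0r addr0 scaler0 addr0. Qed.

Lemma variation_PCalpha : PCalpha al t0 t1 variation.
Proof.
split; first exact: variation_continuous.
exists psi'; last exact: variation_fracint.
exists S'; split; [exact: variation_St|exact: variation_cS|exact: variation_jS].
Qed.

Lemma caputo_variation s : t0 < s < t1 -> s \notin S' ->
  caputo al t0 variation s = caputo_const al *: psi s + h s.
Proof.
move=> s01 sS'.
rewrite (caputo_pc variation_cS variation_jS al01 variation_fracint s01 sS').
by rewrite scalerDr scalerA mulfV// scale1r.
Qed.

End variation.

(** * The cost: integrability and increments *)

(** Minimality is asserted only against competitors whose cost is defined. Off a finite set the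
    integrand is the weight times a bounded continuous function, hence integrable. *)
Lemma J_defined_off (R : realType) (n : nat) (al be t0 t1 M : R)
    (L : R -> 'rV[R]_n -> 'rV[R]_n -> R) (U : set (R * 'rV[R]_n * 'rV[R]_n))
    (F : seq R) (y phi : R -> 'rV[R]_n) :
  0 < be -> open U ->
  C1_on L U ->
  {within `[t0, t1], continuous y} ->
  (forall s, t0 < s < t1 -> s \notin F -> {for s, continuous phi}) ->
  (forall s, t0 < s < t1 -> s \notin F -> caputo al t0 y s = phi s) ->
  (forall s, t0 < s < t1 -> s \notin F -> U (s, y s, phi s) /\ `|L s (y s) (phi s)| <= M) ->
  J_defined al be t0 t1 L y.
Proof.
move=> be0 oU LU cy cphi cap bd.
have cy' s : t0 < s < t1 -> {for s, continuous y}.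
  move=> /andP[t0s st1]; move/subspace_continuousP : cy => /(_ s).
  rewrite /= in_itv/= !ltW// => /(_ isT); rewrite within_interior//.
  suff : `]t0, t1[ `<=` interior `[t0, t1] by apply; rewrite /= in_itv/= t0s.
  by rewrite -open_subsetE; [exact: subset_itvW|exact: interval_open].
apply: (@integrable_weighted_off _ be t0 t1 M F (fun s => L s (y s) (caputo al t0 y s))) => //.
  move=> s s01 sF.
  have H := continuous_lagrangian oU LU (cy' s s01) (cphi s s01 sF) (bd s s01 sF).1.
  have /andP[t0s st1] := s01; have nF := near_notin sF.
  have E : \forall u \near s, L u (y u) (phi u) = L u (y u) (caputo al t0 y u).
    near=> u; rewrite cap//; last by near: u.
    by apply/andP; split; near: u; [exact: lt_nbhsr|exact: lt_nbhsl].
  rewrite /prop_for /continuous_at /= -(nbhs_singleton E).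
  by apply: cvg_trans H; exact: near_eq_cvg.
by move=> s s01 sF; rewrite cap//; exact: (bd s s01 sF).2.
Unshelve. all: by end_near. Qed.

(** Used on the compensations: As and At are the weights at s and t, c the coefficient close to r.
    Freezing As * c / r at At costs eta |X|, and the linearization error keeps the factor At + 1. *)
Lemma weighted_comp_le (R : realType) (As At eta r c X Y D : R) :
  0 < r -> 0 <= c -> 0 <= As -> 0 <= At -> 0 <= eta <= 1 -> 0 <= Y ->
  `|As * (c / r) - At| <= eta -> D <= c * X + c * (eta * Y) ->
  As * D <= r * (At * X + eta * (`|X| + (At + 1) * Y)).
Proof.
move=> r0 c0 As0 At0 /andP[eta0 eta1] Y0 aA DX.
set a := As * (c / r) in aA.
apply: (@le_trans _ _ (As * (c * X + c * (eta * Y)))); first by rewrite ler_wpM2l.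
rewrite [leLHS](_ : _ = r * (a * X + a * (eta * Y))); last by rewrite /a; field; rewrite gt_eqF.
rewrite ler_pM2l//.
have aX : a * X <= At * X + eta * `|X|.
  rewrite -lerBlDl -mulrBl (le_trans (ler_norm _))// normrM ler_wpM2r//.
have aAt : a <= At + 1 by rewrite -lerBlDl (le_trans (ler_norm _))// (le_trans aA).
have : a * (eta * Y) <= (At + 1) * (eta * Y) by rewrite ler_wpM2r// mulr_ge0.
by move=> *; rewrite [eta * (_ + _)]mulrDr addrA lerD// [leRHS]mulrCA.
Qed.

(** Used on the needle, where nothing is linearized: the increment D is known up to 2 eta because
    both values of L are within eta of their limits. *)
Lemma weighted_needle_le (R : realType) (As At eta X D : R) :
  0 <= As -> 0 <= At -> 0 <= eta <= 1 -> `|As - At| <= eta -> D <= X + 2 * eta ->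
  As * D <= At * X + eta * (`|X| + 2 * (At + 1)).
Proof.
move=> As0 At0 /andP[eta0 eta1] aA DX.
apply: (@le_trans _ _ (As * (X + 2 * eta))); first by rewrite ler_wpM2l.
have aX : As * X <= At * X + eta * `|X|.
  by rewrite -lerBlDl -mulrBl (le_trans (ler_norm _))// normrM ler_wpM2r.
have aAt : As <= At + 1 by rewrite -lerBlDl (le_trans (ler_norm _))// (le_trans aA).
have : As * (2 * eta) <= (At + 1) * (2 * eta) by rewrite ler_wpM2r// mulr_ge0.
by move=> H; rewrite mulrDr [eta * (_ + _)]mulrDr addrA lerD// (le_trans H)//; lra.
Qed.

Lemma at_left_interval (R : realType) (t : R) (P : R -> Prop) :
  (\forall s \near t^'-, P s) -> exists2 d, 0 < d & forall s, t - d < s < t -> P s.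
Proof.
move=> H; have /nbhs_ballP[d /= d0 Hd] : \forall s \near t, s < t -> P s by exact: H.
exists d => // s /andP[ds st]; apply: Hd => //=.
by rewrite -ball_normE/= ltr_distlC; apply/andP; split; lra.
Qed.

Lemma at_right_interval (R : realType) (t : R) (P : R -> Prop) :
  (\forall s \near t^'+, P s) -> exists2 d, 0 < d & forall s, t < s < t + d -> P s.
Proof.
move=> H; have /nbhs_ballP[d /= d0 Hd] : \forall s \near t, t < s -> P s by exact: H.
exists d => // s /andP[ts sd]; apply: Hd => //=.
by rewrite -ball_normE/= ltr_distlC; apply/andP; split; lra.
Qed.

Lemma integral_step (R : realType) (t0 t1 a b e : R) : t0 <= a -> a <= b -> b < t1 ->
  lebesgue_measure.-integrable `[t0, t1] (EFin \o (fun s => step a b s * e)) /\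
  \int[lebesgue_measure]_(s in `[t0, t1]) (step a b s * e) = (b - a) * e.
Proof.
move=> t0a ab bt1; split.
  apply: (bounded_integrable_itv (M := 2 * `|e|)).
    by apply: measurable_funM => //; exact: measurable_step.
  move=> s _; rewrite normrM ler_wpM2r// /step; case: (a <= s); case: (b <= s) => /=;
    by rewrite ?subrr ?subr0 ?sub0r ?normrN ?normr0 ?normr1 ?ler1n.
transitivity (\int[lebesgue_measure]_(s in `[t0, t1]) (((fun=> e) \_ `[a, b[) s)).
  apply: eq_Rintegral => s _; rewrite patchE mem_setE in_itv/=.
  case: ifPn => H; first by rewrite step_in// mul1r.
  by rewrite step_out// mul0r.
rewrite -Rintegral_mkcondr (_ : _ `&` _ = `[a, b[%classic); last first.
  apply/seteqP; split=> u/=; rewrite !in_itv/=; first by case.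
  by move=> /andP[au ub]; rewrite au ub (le_trans t0a)//= ltW// (lt_trans ub).
rewrite /Rintegral integral_cst//= lebesgue_measure_itv/= lte_fin mulrC.
by move: ab; rewrite le_eqVlt => /predU1P[->|->//]; rewrite ltxx subrr mule0 mulr0.
Qed.

Lemma integrable_of_integral_le (R : realType) (D : set R) (f : R -> R) (c : R) :
  measurable D -> measurable_fun D f -> (forall s, 0 <= f s) ->
  (\int[lebesgue_measure]_(s in D) (f s)%:E <= c%:E)%E ->
  lebesgue_measure.-integrable D (EFin \o f) /\
  \int[lebesgue_measure]_(s in D) f s <= c.
Proof.
move=> mD mf f0 fc.
have i0 : (0 <= \int[lebesgue_measure]_(s in D) (f s)%:E)%E.
  by apply: integral_ge0 => s _; rewrite lee_fin.
have fin : (\int[lebesgue_measure]_(s in D) (f s)%:E)%E \is a fin_num.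
  by rewrite ge0_fin_numE// (le_lt_trans fc) ?ltry.
split; last by rewrite -lee_fin /Rintegral fineK.
apply/integrableP; split; first exact/measurable_EFinP.
under eq_integral do rewrite /= ger0_norm//.
by rewrite (le_lt_trans fc) ?ltry.
Qed.

(** The pointwise comparison fails to be known at the jumps, at the ends of the steps and at t0, t1;
    this null set is removed from the integrals. *)
Lemma Rintegral_ge0_off (R : realType) (t0 t1 : R) (F : seq R) (f g e : R -> R) :
  lebesgue_measure.-integrable `[t0, t1] (EFin \o f) ->
  lebesgue_measure.-integrable `[t0, t1] (EFin \o g) ->
  lebesgue_measure.-integrable `[t0, t1] (EFin \o e) ->
  (forall s, t0 < s < t1 -> s \notin F -> g s - f s <= e s) ->
  \int[lebesgue_measure]_(s in `[t0, t1]) f s <=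
  \int[lebesgue_measure]_(s in `[t0, t1]) g s ->
  0 <= \int[lebesgue_measure]_(s in `[t0, t1]) e s.
Proof.
move=> jf jg je le_e fg; rewrite -subr_ge0 in fg; apply: (le_trans fg).
have jgf : lebesgue_measure.-integrable `[t0, t1] (EFin \o (fun s => g s - f s)).
  exact: (@integrableB _ _ _ lebesgue_measure _ (measurable_itv _) _ _ jg jf).
rewrite -RintegralB//; rewrite /Rintegral.
pose N := [set` [:: t0, t1 & F]] : set R.
have mN : measurable (N : set (measurableTypeR R)).
  apply: countable_measurable => [s|]; first exact: measurable_set1.
  by apply: finite_set_countable; exact: finite_seq.
have N0 : lebesgue_measure N = 0%E.
  by apply: countable_lebesgue_measure0; apply: finite_set_countable; exact: finite_seq.
have mD : measurable (`[t0, t1]%classic : set (measurableTypeR R)) by exact: measurable_itv.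
rewrite (negligible_integral mN mD jgf N0)// (negligible_integral mN mD je N0)//.
have mDN := measurableD mD mN.
have sub : `[t0, t1] `\` N `<=` `[t0, t1] by move=> s [].
have jgf' := integrableS mD mDN sub jgf.
have je' := integrableS mD mDN sub je.
apply: fine_le; [exact: integrable_fin_num|exact: integrable_fin_num|].
apply: le_integral => // s; rewrite inE => -[/= + /negP].
rewrite in_itv/= !inE !negb_or => /andP[t0s st1] /and3P[st0 st1' sF].
rewrite lee_fin le_e//; apply/andP; split; rewrite lt_neqAle.
  by rewrite eq_sym st0.
by rewrite st1'.
Qed.

(* The interval [side_lo t c l, side_hi t c l[ has length l and lies on the left of
   t when c = true, on the right when c = false. *)
Definition side_lo (R : realType) (t : R) (c : bool) (l : R) := if c then t - l else t.
Definition side_hi (R : realType) (t : R) (c : bool) (l : R) := if c then t else t + l.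

Lemma side_geometry (R : realType) (t r : R) (b c : bool) : 0 < r -> r <= 1 ->
  variation_geometry t r (side_lo t b (r ^+ 2)) (side_hi t b (r ^+ 2)) (side_lo t c r) (side_hi t c r).
Proof.
move=> r0 r1; have r2 : r ^+ 2 <= r by rewrite expr2 ler_piMr// ltW.
have r20 : 0 <= r ^+ 2 by rewrite sqr_ge0.
by rewrite /variation_geometry /side_lo /side_hi; case: b; case: c; (do ![split]; lra).
Qed.

Section local_increment.
Context {R : realType} {n : nat}.
Variables (L : R -> 'rV[R]_n -> 'rV[R]_n -> R) (U : set (R * 'rV[R]_n * 'rV[R]_n)).
Hypothesis LU : C1_on L U.

(** Passes through the point (s, u, y + w): moving u costs a Lipschitz term, moving y is linearized
    at the corner. Radii e / 2 keep every intermediate point in the box of radius e. *)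
Lemma local_increment_le (t : R) (x p : 'rV[R]_n) (e eta M s : R) (u u' y w : 'rV[R]_n) :
  (forall s u y, `|s - t| < e -> `|u - x| < e -> `|y - p| < e ->
    C1_close L U (t, x, p) eta s u y) ->
  `|gradx L t x p| + eta <= M ->
  `|s - t| < e -> `|u - x| < e / 2 -> `|u' - u| < e / 2 -> `|y - p| < e / 2 -> `|w| < e / 2 ->
  L s u' (y + w) - L s u y <=
  M * n%:R * `|u' - u| + (dotv (grady L t x p) w + eta * n%:R * `|w|).
Proof.
move=> H gM st ux u'u yp wr.
have tri (a b c : 'rV[R]_n) : `|a - b| <= `|c| -> `|c| < e / 2 -> forall d, `|b - d| < e / 2 ->
    `|a - d| < e.
  move=> ab c2 d bd; rewrite -(subrK b a) -addrA (le_lt_trans (ler_normD _ _))//.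
  by rewrite (splitr e) ltrD// (le_lt_trans ab).
have yw : `|y + w - p| < e by apply: (tri _ y w) => //; rewrite addrC addKr.
have ue : `|u - x| < e by apply: (tri _ u (u' - u)); rewrite ?subrr ?normr0.
have ye : `|y - p| < e by apply: (tri _ y w); rewrite ?subrr ?normr0.
have Hx : `|L s u' (y + w) - L s u (y + w)| <= M * n%:R * `|u' - u|.
  apply: (increment_x_le LU) => v vu.
  have [| | |hU _ hx _] := H s v (y + w) => //; first exact: (tri _ u (u' - u)).
  split => // i; apply: le_trans gM; rewrite -(subrK (gradx L t x p 0 i) (gradx L s v (y + w) 0 i)).
  by rewrite (le_trans (ler_normD _ _))// addrC lerD// ?ler_coord_norm//; exact: hx.
have Hy : `|L s u (y + w) - L s u y - dotv (grady L t x p) w| <= eta * n%:R * `|w|.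
  apply: (increment_y_le LU) => z zy.
  by have [| | |hU _ _ hy] := H s u z => //; exact: (tri _ y w).
move: (le_trans (ler_norm _) Hx) (le_trans (ler_norm _) Hy); lra.
Qed.

End local_increment.

(** The needle lies inside the step of its own side, so the regions are the needle, the rest of that
    step, the opposite step and the outside. *)
Lemma side_cases (R : realType) (t r s : R) (b : bool) : 0 < r -> r <= 1 ->
  s \notin [:: side_lo t b (r ^+ 2); side_hi t b (r ^+ 2); side_lo t (~~ b) r;
               side_hi t (~~ b) r; side_lo t b r; side_hi t b r] ->
  let stepN := step (side_lo t b (r ^+ 2)) (side_hi t b (r ^+ 2)) s in
  let step_on := step (side_lo t b r) (side_hi t b r) s in
  let step_opp := step (side_lo t (~~ b) r) (side_hi t (~~ b) r) s in
  [\/ [/\ stepN = 1, step_on = 1, step_opp = 0 & side_lo t b r < s < side_hi t b r],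
      [/\ stepN = 0, step_on = 1, step_opp = 0 & side_lo t b r < s < side_hi t b r],
      [/\ stepN = 0, step_on = 0, step_opp = 1 & side_lo t (~~ b) r < s < side_hi t (~~ b) r]
    | [/\ stepN = 0, step_on = 0 & step_opp = 0]].
Proof.
move=> r0 r1; have r2 : r ^+ 2 <= r by rewrite expr2 ler_piMr// ltW.
have r20 : 0 < r ^+ 2 by rewrite exprn_gt0.
rewrite /side_lo /side_hi !inE !negb_or => /and5P[].
have out a c : a <= c -> (s < a) || (c <= s) -> step a c s = 0.
  by move=> ac H; apply: step_out => //; rewrite negb_and -ltNge -leNgt.
case: b => /= H1 H2 H3 H4 /andP[H5 H6].
  have [a1|a1] := ltP s (t - r).
    by apply: Or44; split; apply: out; lra.
  have [a2|a2] := ltP s (t - r ^+ 2).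
    apply: Or42; split; [apply: out|apply: step_in|apply: out|]; lra.
  have [a3|a3] := ltP s t.
    apply: Or41; split; [apply: step_in|apply: step_in|apply: out|]; lra.
  have [a4|a4] := ltP s (t + r).
    apply: Or43; split; [apply: out|apply: out|apply: step_in|]; lra.
  by apply: Or44; split; apply: out; lra.
have [a1|a1] := ltP s (t - r).
  by apply: Or44; split; apply: out; lra.
have [a2|a2] := ltP s t.
  apply: Or43; split; [apply: out|apply: out|apply: step_in|]; lra.
have [a3|a3] := ltP s (t + r ^+ 2).
  apply: Or41; split; [apply: step_in|apply: step_in|apply: out|]; lra.
have [a4|a4] := ltP s (t + r).
  apply: Or42; split; [apply: out|apply: step_in|apply: out|]; lra.
by apply: Or44; split; apply: out; lra.
Qed.

Lemma side_lo_le_hi (R : realType) (t l : R) (c : bool) : 0 <= l -> side_lo t c l <= side_hi t c l.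
Proof. by rewrite /side_lo /side_hi; case: c => ?; lra. Qed.

Lemma side_inside (R : realType) (t0 t1 t r s : R) (b : bool) : 0 < r -> r <= 1 ->
  t0 < t - r -> t + r < t1 ->
  s \in [:: side_lo t b (r ^+ 2); side_hi t b (r ^+ 2); side_lo t (~~ b) r;
            side_hi t (~~ b) r; side_lo t b r; side_hi t b r] ->
  t0 < s < t1.
Proof.
move=> r0 r1; have : r ^+ 2 <= r by rewrite expr2 ler_piMr// ltW.
have : 0 < r ^+ 2 by rewrite exprn_gt0.
move: (r ^+ 2) => q q0 qr t0r rt1.
rewrite !inE /side_lo /side_hi.
by case: b => /=; do ![case/predU1P => [->|]; first lra]; move=> /eqP ->; lra.
Qed.

Lemma norm_lincomb_le (R : realType) (n : nat) (k a b : R) (v w : 'rV[R]_n) :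
  `|k *: (a *: v + b *: w)| <= `|k| * (`|v| + `|w|) * (`|a| + `|b|).
Proof.
rewrite normrZ -mulrA ler_wpM2l// (le_trans (ler_normD _ _))// !normrZ.
have := mulr_ge0 (normr_ge0 a) (normr_ge0 w); have := mulr_ge0 (normr_ge0 b) (normr_ge0 v).
lra.
Qed.

(** Common to both compensations, with sg = 1 on the side of the needle and sg = -1 on the other.
    The term in [|u' - u|] stays under the weight As, because it is o(r^2) only after
    integration. *)
Lemma weighted_increment_le (R : realType) (n : nat) (L : R -> 'rV[R]_n -> 'rV[R]_n -> R)
    (U : set (R * 'rV[R]_n * 'rV[R]_n))
    (t e eta M As At r c sg s : R) (x p u u' y : 'rV[R]_n) :
  C1_on L U ->
  (forall s u y, `|s - t| < e -> `|u - x| < e -> `|y - p| < e ->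
    C1_close L U (t, x, p) eta s u y) ->
  `|gradx L t x p| + eta <= M ->
  0 < r -> 0 <= c -> 0 <= As -> 0 <= At -> 0 <= eta <= 1 -> `|sg| = 1 ->
  `|As * (c / r) - At| <= eta ->
  `|s - t| < e -> `|u - x| < e / 2 -> `|u' - u| < e / 2 -> `|y - p| < e / 2 ->
  c * `|p| < e / 2 ->
  let X := dotv (grady L t x p) p in
  let z := y + (c * sg) *: p in
  [/\ U (s, u', z), `|L s u' z - L t x p| <= eta
    & As * (L s u' z - L s u y) <= As * (M * n%:R * `|u' - u|) +
      r * (At * (sg * X) + eta * (`|X| + (At + 1) * (n%:R * `|p|)))].
Proof.
move=> LU H gM r0 c0 As0 At0 eta01 sg1 aA st ux u'u yp cp X z.
have nc : `|(c * sg) *: p| = c * `|p| by rewrite normrZ normrM sg1 mulr1 ger0_norm.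
have [| | |hU hL _ _] := H s u' z => //.
- by rewrite -(subrK u u') -addrA (le_lt_trans (ler_normD _ _))// (splitr e) ltrD.
- by rewrite /z addrAC (le_lt_trans (ler_normD _ _))// (splitr e) ltrD// nc.
split => //.
have := local_increment_le LU H gM st ux u'u yp (w := (c * sg) *: p).
rewrite nc => /(_ cp); rewrite -/z dotvZr -/X => D.
have W := @weighted_comp_le _ As At eta r c (sg * X) (n%:R * `|p|)
  (c * sg * X + eta * n%:R * (c * `|p|)).
rewrite normrM sg1 mul1r in W.
apply: le_trans (lerD (lexx _) (W _ _ _ _ _ _ _ _)) => //.
- by rewrite -mulrDr ler_wpM2l.
- by lra.
Qed.
Lemma Rintegral_majorant (R : realType) (t0 t1 c a b a' b' a2 b2 e e' e2 : R) (f g : R -> R) :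
  lebesgue_measure.-integrable `[t0, t1] (EFin \o f) ->
  lebesgue_measure.-integrable `[t0, t1] (EFin \o g) ->
  t0 <= a -> a <= b -> b < t1 -> t0 <= a' -> a' <= b' -> b' < t1 ->
  t0 <= a2 -> a2 <= b2 -> b2 < t1 ->
  let E s := c * (f s + g s) + (step a b s * e + (step a' b' s * e' + step a2 b2 s * e2)) in
  lebesgue_measure.-integrable `[t0, t1] (EFin \o E) /\
  \int[lebesgue_measure]_(s in `[t0, t1]) E s =
    c * (\int[lebesgue_measure]_(s in `[t0, t1]) f s + \int[lebesgue_measure]_(s in `[t0, t1]) g s)
    + ((b - a) * e + ((b' - a') * e' + (b2 - a2) * e2)).
Proof.
move=> jf jg ? ? ? ? ? ? ? ? ?.
have mD : measurable (`[t0, t1]%classic : set (measurableTypeR R)) by exact: measurable_itv.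
have add (f1 f2 : R -> R) i1 i2 :
    lebesgue_measure.-integrable `[t0, t1] (EFin \o f1) /\
      \int[lebesgue_measure]_(s in `[t0, t1]) f1 s = i1 ->
    lebesgue_measure.-integrable `[t0, t1] (EFin \o f2) /\
      \int[lebesgue_measure]_(s in `[t0, t1]) f2 s = i2 ->
    lebesgue_measure.-integrable `[t0, t1] (EFin \o (fun s => f1 s + f2 s)) /\
      \int[lebesgue_measure]_(s in `[t0, t1]) (f1 s + f2 s) = i1 + i2.
  move=> [j1 <-] [j2 <-]; split; last by rewrite RintegralD.
  exact: (@integrableD _ _ _ lebesgue_measure _ mD _ _ j1 j2).
apply: (add (fun s => c * (f s + g s)) _ _ _ _
  (add _ _ _ _ (integral_step e _ _ _) (add _ _ _ _ (integral_step e' _ _ _) (integral_step e2 _ _ _)))) => //.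
have [jfg <-] := add _ _ _ _ (conj jf erefl) (conj jg erefl).
split; last by rewrite RintegralZl.
exact: (@integrableZl _ _ _ lebesgue_measure _ mD c _ jfg).
Qed.

Lemma side_close (R : realType) (t r d s : R) (c : bool) : r <= d ->
  side_lo t c r < s < side_hi t c r -> `|s - t| < r /\ side_lo t c d < s < side_hi t c d.
Proof.
by move=> rd; rewrite /side_lo /side_hi ltr_norml; case: c => /andP[? ?];
  split; apply/andP; split; lra.
Qed.

Lemma weight_ratio_close (R : realType) (As At q eta eta' : R) : 0 <= As ->
  `|As - At| <= eta / 2 -> eta <= 1 -> `|q - 1| <= eta' -> (At + 1) * eta' <= eta / 2 ->
  `|As * q - At| <= eta.
Proof.
move=> As0 aA eta1 q1 H; rewrite (_ : _ - At = As * (q - 1) + (As - At)); last by ring.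
rewrite (le_trans (ler_normD _ _))// (splitr eta) lerD// normrM ger0_norm// (le_trans _ H)//.
apply: ler_pM => //; move: aA; rewrite ler_norml => /andP[? ?]; lra.
Qed.

(** * The corner inequality *)

Section corner.
Context {R : realType} {n : nat}.
Variables (al be t0 t1 t : R) (x0 x1 : 'rV[R]_n).
Variables (L : R -> 'rV[R]_n -> 'rV[R]_n -> R) (U : set (R * 'rV[R]_n * 'rV[R]_n)).
Variables (x psi : R -> 'rV[R]_n) (S : seq R) (kappa M : R) (p : bool -> 'rV[R]_n).
Hypothesis al01 : 0 < al <= 1.
Hypothesis be0 : 0 < be.
Hypothesis oU : open U.
Hypothesis LU : C1_on L U.
Hypothesis St : forall t, t \in S -> t0 < t < t1.
Hypothesis cS : forall t, t0 <= t <= t1 -> t \notin S ->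
  psi @ within `[t0, t1] (nbhs t) --> psi t.
Hypothesis jS : forall t, t \in S -> cvg (psi @ t^'-) /\ cvg (psi @ t^'+).
Hypothesis cx : {within `[t0, t1], continuous x}.
Hypothesis xE : forall t, t0 <= t <= t1 -> x t = x t0 + fracint al t0 psi t.
Hypothesis K0 : caputo_const al != 0.
Hypothesis xmin : strong_local_min al be t0 t1 x0 x1 L x.
Hypothesis kappa0 : 0 < kappa.
Hypothesis tubeU : forall s, t0 < s < t1 -> s \notin S -> forall u, `|u - x s| < kappa ->
  [/\ U (s, u, caputo_const al *: psi s), `|L s u (caputo_const al *: psi s)| <= M
    & forall i, `|gradx L s u (caputo_const al *: psi s) 0 i| <= M].
Hypothesis t01 : t0 < t < t1.
Hypothesis Up : forall c, U (t, x t, p c).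
(* p true and p false are the left and the right limit of the derivative. *)
Hypothesis pl : caputo_const al *: psi s @[s --> t^'-] --> p true.
Hypothesis pr : caputo_const al *: psi s @[s --> t^'+] --> p false.

Let phi (s : R) := caputo_const al *: psi s.

Let near_corner (e : R) : 0 < e ->
  exists2 d : R, 0 < d & forall c s, side_lo t c d < s < side_hi t c d -> `|phi s - p c| < e.
Proof.
move=> e0.
have Hl : \forall s \near t^'-, `|phi s - p true| < e.
  by apply: filterS ((cvgrPdist_lt _ _).1 pl _ e0) => s; rewrite distrC.
have Hr : \forall s \near t^'+, `|phi s - p false| < e.
  by apply: filterS ((cvgrPdist_lt _ _).1 pr _ e0) => s; rewrite distrC.
have [d1 d10 H1] := at_left_interval Hl; have [d2 d20 H2] := at_right_interval Hr.
exists (Num.min d1 d2); first by rewrite lt_min d10 d20.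
have m1 : Num.min d1 d2 <= d1 by rewrite ge_min lexx.
have m2 : Num.min d1 d2 <= d2 by rewrite ge_min lexx orbT.
by case=> s; rewrite /side_lo /side_hi => /andP[? ?]; [apply: H1|apply: H2]; apply/andP; split; lra.
Qed.

Let near_continuous (e : R) : 0 < e -> exists2 d : R, 0 < d & forall s, `|s - t| < d ->
  [/\ `|x s - x t| < e & `|(t1 - s) `^ (be - 1) - (t1 - t) `^ (be - 1)| <= e].
Proof.
move=> e0.
have Hx : \forall s \near t, `|x s - x t| < e.
  have cxt : {for t, continuous x}.
    have /andP[t0t tt1] := t01.
    move/subspace_continuousP : (cx) => /(_ t).
    rewrite /= in_itv/= !ltW// => /(_ isT); rewrite within_interior//.
    suff : `]t0, t1[ `<=` interior `[t0, t1] by apply; rewrite /= in_itv/= t0t.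
    by rewrite -open_subsetE; [exact: subset_itvW|exact: interval_open].
  by apply: filterS ((cvgrPdist_lt _ _).1 cxt _ e0) => s; rewrite distrC.
have HA : \forall s \near t, `|(t1 - s) `^ (be - 1) - (t1 - t) `^ (be - 1)| <= e.
  have cA : (t1 - s) `^ (be - 1) @[s --> t] --> (t1 - t) `^ (be - 1).
    apply: (@continuous_comp _ _ _ (fun s => t1 - s) (fun u => u `^ (be - 1))).
      by apply: cvgB; [exact: cvg_cst|exact: cvg_id].
    by apply: continuous_powR_gt0; rewrite subr_gt0; have /andP[] := t01.
  by apply: filterS ((cvgrPdist_le _ _).1 cA _ e0) => s; rewrite distrC.
have : \forall s \near t,
    `|x s - x t| < e /\ `|(t1 - s) `^ (be - 1) - (t1 - t) `^ (be - 1)| <= e.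
  by apply: filterS2 Hx HA => s; split.
move=> /nbhs_ballP[d /= d0 H]; exists d => // s st.
by have [] := H s; rewrite // -ball_normE/= distrC.
Qed.

Let Jx : J_defined al be t0 t1 L x.
Proof.
have cphi s : t0 < s < t1 -> s \notin S -> {for s, continuous phi}.
  move=> s01 sS; apply: cvgZ; first exact: cvg_cst.
  exact: (pc_continuous cS s01).
have cap s : t0 < s < t1 -> s \notin S -> caputo al t0 x s = phi s.
  exact: (caputo_pc cS jS al01 xE).
apply: (J_defined_off (M := M) be0 oU LU cx cphi cap) => s s01 sS.
by have [] := tubeU s01 sS (u := x s); rewrite ?subrr ?normr0.
Qed.

Let cphih (a b c d c' d' : R) (v w : 'rV[R]_n) (s : R) : t0 < s < t1 ->
  s \notin S ++ [:: a; b; c; d; c'; d'] ->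
  {for s, continuous (fun s => phi s +
    (vstep al t1 a b c d s *: v + vstep al t1 a b c' d' s *: w))}.
Proof.
move=> s01 sF; have H := pc_continuous (@variation_cS _ _ al t0 t1 psi S cS a b c d c' d' v w) s01 sF.
have -> : (fun s => phi s + (vstep al t1 a b c d s *: v + vstep al t1 a b c' d' s *: w)) =
  (fun s => caputo_const al *: (psi s + (caputo_const al)^-1 *:
    (vstep al t1 a b c d s *: v + vstep al t1 a b c' d' s *: w))).
  by apply/funext => u; rewrite scalerDr scalerA mulfV// scale1r.
by apply: cvgZ; first exact: cvg_cst.
Qed.

Lemma corner_inequality (b : bool) :
  0 <= L t (x t) (p (~~ b)) - L t (x t) (p b) + dotv (grady L t (x t) (p b)) (p b)
       - dotv (grady L t (x t) (p (~~ b))) (p (~~ b)).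
Proof.
have /andP[t0t tt1] := t01.
(* Bounds the gradient in x in the tube by [|M|], and near the corner by the other summands, the 1
   standing for eta. *)
pose M1 := `|M| + `|gradx L t (x t) (p b)| + `|gradx L t (x t) (p (~~ b))| + 1.
pose kap := (eulerGamma al)^-1 * (caputo_const al)^-1.
pose Cv := `|kap| * (`|p b| + `|p (~~ b)|).
pose C1 := M1 * n%:R * Cv.
pose At := (t1 - t) `^ (be - 1).
pose X c := dotv (grady L t (x t) (p c)) (p c).
pose XN := L t (x t) (p (~~ b)) - L t (x t) (p b).
pose B c := `|X c| + (At + 1) * (n%:R * `|p c|).
(* Total coefficient of eta: [2 * C1] from the two displacement integrals, the parenthesis from the
   needle, and [B] from each compensation. *)
pose C := 2 * C1 + (`|XN| + 2 * (At + 1) + 1) + B b + B (~~ b).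
have At0 : 0 < At by rewrite powR_gt0// subr_gt0.
have M10 : 0 <= M1 by rewrite !addr_ge0.
have Cv0 : 0 <= Cv by rewrite mulr_ge0// addr_ge0.
have C10 : 0 <= C1 by rewrite !mulr_ge0.
have B0 c : 0 <= B c by rewrite addr_ge0// !mulr_ge0// addr_ge0// ltW.
have C0 : 0 < C.
  have := B0 b; have := B0 (~~ b); have := normr_ge0 XN; rewrite /C; lra.
suff H eta : 0 < eta -> eta <= 1 -> 0 <= At * (XN + X b - X (~~ b)) + eta * C.
  rewrite -/XN -/(X b) -/(X (~~ b)) -(pmulr_rge0 _ At0).
  apply/ler_addgt0Pr => e e0; pose eta := Num.min 1 (e / C).
  have eta0 : 0 < eta by rewrite lt_min ltr01 divr_gt0.
  have eta1 : eta <= 1 by rewrite ge_min lexx.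
  apply: (le_trans (H eta eta0 eta1)); rewrite lerD2l -ler_pdivlMr//.
  by rewrite ge_min lexx orbT.
move=> eta0 eta1.
have [e e0 He] : exists2 e : R, 0 < e & forall c s u y,
    `|s - t| < e -> `|u - x t| < e -> `|y - p c| < e -> C1_close L U (t, x t, p c) eta s u y.
  have [e1 e10 H1] := C1_close_ball oU LU (Up true) eta0.
  have [e2 e20 H2] := C1_close_ball oU LU (Up false) eta0.
  exists (Num.min e1 e2); first by rewrite lt_min e10.
  by case=> s u y; rewrite !lt_min => /andP[? ?] /andP[? ?] /andP[? ?]; [exact: H1|exact: H2].
have [_ [delta delta0 xmin']] := xmin.
have e20 : 0 < e / 2 by rewrite divr_gt0.
have [d1 d10 Hd1] := near_corner e20.
have [d2 d20 Hd2] : exists2 d : R, 0 < d & forall s, `|s - t| < d ->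
    `|x s - x t| < e / 2 /\ `|(t1 - s) `^ (be - 1) - At| <= eta / 2.
  have m0 : 0 < Num.min (e / 2) (eta / 2) by rewrite lt_min e20 divr_gt0.
  have [d d0 Hd] := near_continuous m0; exists d => // s /Hd[].
  by rewrite lt_min le_min => /andP[? _] /andP[_ ?].
(* The displacement has to stay in the tube, in the neighbourhood of minimality and in the box
   around the corner. *)
pose m := Num.min kappa (Num.min delta (e / 2)).
have m0 : 0 < m by rewrite !lt_min kappa0 delta0.
(* Its three entries control the integrals of the displacement, the deviation of the ratios from r,
   and the sup norm through [m]. *)
pose eta3 := Num.min (Num.min eta (eta / (2 * (At + 1)))) (m / (2 * (Cv + 1)) / 2).
have At1 : 0 < At + 1 by rewrite addr_gt0.
have Cv1 : 0 < Cv + 1 by rewrite ltr_wpDl.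
have eta30 : 0 < eta3 by rewrite !lt_min eta0 !divr_gt0// mulr_gt0.
have eta3_eta : eta3 <= eta by rewrite !ge_min lexx.
have eta3_At : (At + 1) * eta3 <= eta / 2.
  have : eta3 <= eta / (2 * (At + 1)) by rewrite !ge_min lexx !orbT.
  rewrite ler_pdivlMr ?mulr_gt0// => ?; lra.
have eta3_m : Cv * (2 * eta3) < m.
  have : eta3 <= m / (2 * (Cv + 1)) / 2 by rewrite !ge_min lexx !orbT.
  rewrite ler_pdivlMr// ler_pdivlMr ?mulr_gt0// => ?; nra.
have [r [[r0 r1 rd1 rd2] [re t0r rt1 rsmall] [reb vs]]] : exists r : R,
  [/\ [/\ 0 < r, r <= 1, r < d1 & r < d2],
    [/\ r < e, t0 < t - r, t + r < t1 & 2 * r * (`|p b| + `|p (~~ b)|) <= e / 4],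
    (At * `|X b| + eta * B b) * r <= eta
  & forall a0 b0 a1 b1, variation_geometry t r a0 b0 a1 b1 ->
  [/\ vramp al t1 a0 b0 a1 b1 t1 = 0,
      forall s, s <= t - r -> vramp al t1 a0 b0 a1 b1 s = 0,
      forall s, `|vramp al t1 a0 b0 a1 b1 s| <= eta3,
      0 <= vratio al t1 a0 b0 a1 b1 /\
        `|vratio al t1 a0 b0 a1 b1 / r - 1| <= eta3
    & (\int[lebesgue_measure]_(s in `[t0, t1])
        ((t1 - s) `^ (be - 1) * `|vramp al t1 a0 b0 a1 b1 s|)%:E <= (eta3 * r ^+ 2)%:E)%E]].
  have Hv := vramp_small al01 be0 t01 eta30.
  have lim0 (c : R) : 0 < c -> \forall r \near (0:R)^'+, r < c.
    by move=> c0; apply: nbhs_right_lt.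
  have L1 := lim0 _ d10; have L2 := lim0 _ d20; have L3 := lim0 _ e0.
  have L4 := lim0 (t - t0) ltac:(by rewrite subr_gt0).
  have L5 := lim0 (t1 - t) ltac:(by rewrite subr_gt0).
  have L6 := lim0 1 ltr01.
  have L7 : \forall r \near (0:R)^'+, 2 * (`|p b| + `|p (~~ b)|) * r <= e / 4.
    by apply: near_mul_le; rewrite divr_gt0.
  have L8 : \forall r \near (0:R)^'+, (At * `|X b| + eta * B b) * r <= eta.
    exact: near_mul_le.
  apply: (@filter_ex _ ((0:R)^'+)).
  near=> r; split; last by near: r; exact: Hv.
  - by split => //; [apply/ltW|..]; near: r.
  - have r4 : r < t - t0 by near: r.
    have r5 : r < t1 - t by near: r.
    have r7 : 2 * (`|p b| + `|p (~~ b)|) * r <= e / 4 by near: r.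
    by split; [near: r|lra|lra|lra].
  - by near: r.
have r2r : r ^+ 2 <= r by rewrite expr2 ler_piMr// ltW.
have r20 : 0 < r ^+ 2 by rewrite exprn_gt0.
set lo0 := side_lo t b (r ^+ 2); set hi0 := side_hi t b (r ^+ 2).
set lo1 := side_lo t (~~ b) r; set hi1 := side_hi t (~~ b) r.
set lo2 := side_lo t b r; set hi2 := side_hi t b r.
have [G1 _ S1 [c1ge c1le] I1] := vs _ _ _ _ (side_geometry t b (~~ b) r0 r1).
have [G2 _ S2 [c2ge c2le] I2] := vs _ _ _ _ (side_geometry t b b r0 r1).
rewrite -/lo0 -/hi0 -/lo1 -/hi1 -/lo2 -/hi2 in G1 S1 c1ge c1le I1 G2 S2 c2ge c2le I2.
set vr1 := vramp al t1 lo0 hi0 lo1 hi1 in G1 S1 I1.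
set vr2 := vramp al t1 lo0 hi0 lo2 hi2 in G2 S2 I2.
set c1 := vratio al t1 lo0 hi0 lo1 hi1 in c1ge c1le.
set c2 := vratio al t1 lo0 hi0 lo2 hi2 in c2ge c2le.
(* Two profiles share the needle; each vector is compensated on the side of which it is the limit,
   up to sign. *)
pose y := variation al t1 x lo0 hi0 lo1 hi1 lo2 hi2 (p (~~ b)) (- p b).
pose h s : 'rV[R]_n := vstep al t1 lo0 hi0 lo1 hi1 s *: p (~~ b) +
  vstep al t1 lo0 hi0 lo2 hi2 s *: - p b.
pose F := S ++ [:: lo0; hi0; lo1; hi1; lo2; hi2].
have D s := @side_inside _ t0 t1 t r s b r0 r1 t0r rt1.
have lh0 : lo0 <= hi0 by apply: side_lo_le_hi; exact: ltW.
have lh1 : lo1 <= hi1 by apply: side_lo_le_hi; exact: ltW.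
have lh2 : lo2 <= hi2 by apply: side_lo_le_hi; exact: ltW.
have capy s : t0 < s < t1 -> s \notin F -> caputo al t0 y s = phi s + h s.
  exact: (caputo_variation al01 St cS jS xE K0 D lh0 lh1 lh2).
have capx s : t0 < s < t1 -> s \notin F -> caputo al t0 x s = phi s.
  by move=> s01; rewrite mem_cat negb_or => /andP[sS _]; exact: (caputo_pc cS jS al01 xE).
have dy s : `|y s - x s| <= Cv * (`|vr1 s| + `|vr2 s|).
  by rewrite /y /variation addrC addKr (le_trans (norm_lincomb_le _ _ _ _ _))// normrN addrC.
have dym s : `|y s - x s| < m.
  by rewrite (le_lt_trans (dy s))// (le_lt_trans _ eta3_m)// ler_wpM2l// mulr_natl mulr2n lerD.
have Dx s : M1 * n%:R * `|y s - x s| <= C1 * (`|vr1 s| + `|vr2 s|).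
  by rewrite /C1 -[leRHS]mulrA ler_wpM2l// mulr_ge0.
have [m_kappa m_delta m_e] : [/\ m <= kappa, m <= delta & m <= e / 2].
  by rewrite /m !ge_min !lexx !orbT.
pose As s := (t1 - s) `^ (be - 1).
have As0 s : 0 <= As s by exact: powR_ge0.
pose eN := At * XN + eta * (`|XN| + 2 * (At + 1)) + eta.
pose eb := r * (At * X b + eta * B b).
pose e' := r * (At * - X (~~ b) + eta * B (~~ b)).
(* Integrable majorant of the increment of the integrand of J: the first term
   controls the change of x, the others that of the derivative near t. *)
pose E s := C1 * (As s * `|vr1 s| + As s * `|vr2 s|) +
  (step lo0 hi0 s * eN + (step lo2 hi2 s * eb + step lo1 hi1 s * e')).
pose M2 := `|M| + `|L t (x t) (p b)| + `|L t (x t) (p (~~ b))| + 1.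
have loc c s : side_lo t c r < s < side_hi t c r ->
    [/\ `|s - t| < e, `|x s - x t| < e / 2, `|phi s - p c| < e / 2 & `|As s - At| <= eta / 2].
  move=> sr; have [st sd] := side_close (ltW rd1) sr.
  have [xs ?] := Hd2 s (lt_trans st rd2).
  by split; [exact: lt_trans re|exact: xs|exact: Hd1|].
have As_ratio s cc : `|As s - At| <= eta / 2 -> `|cc / r - 1| <= eta3 ->
    `|As s * (cc / r) - At| <= eta.
  by move=> ? H; exact: weight_ratio_close H eta3_At.
(* As eta3 <= 1, the coefficient is at most [2 * r]. *)
have small cc c : 0 <= cc -> `|cc / r - 1| <= eta3 -> cc * `|p c| <= e / 4.
  move=> cc0 /(le_trans (ler_norm _)) H; apply: le_trans rsmall; apply: ler_pM => //.
    rewrite lerBlDr in H; rewrite -ler_pdivrMr// (le_trans H)// (_ : 2 = 1 + 1) ?lerD//.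
    exact: le_trans eta1.
  by case: (b) c => -[]; rewrite ?lerDl ?lerDr.
have e4 : e / 4 < e / 2 by rewrite ltr_pM2l// ltf_pV2 ?posrE// ltr_nat.
have AsD s : As s * (M1 * n%:R * `|y s - x s|) <= C1 * (As s * `|vr1 s| + As s * `|vr2 s|).
  by rewrite -mulrDr [leRHS]mulrCA ler_wpM2l.
(* On the needle [E] also contains [eb], since the needle lies in the step of the same side; the
   last summand of [eN] absorbs it if [eb] is negative. *)
have ebN : - eta <= eb.
  suff : `|eb| <= eta by rewrite ler_norml => /andP[].
  rewrite /eb normrM (gtr0_norm r0) mulrC (le_trans _ reb)// ler_wpM2r ?(ltW r0)//.
  rewrite (le_trans (ler_normD _ _))// !normrM (gtr0_norm At0) (gtr0_norm eta0).
  by rewrite (ger0_norm (B0 b)).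
have Lbd c u : `|u - L t (x t) (p c)| <= eta -> `|u| <= M2.
  move=> uL; rewrite -(subrK (L t (x t) (p c)) u) (le_trans (ler_normD _ _))// addrC /M2.
  rewrite lerD// ?(le_trans uL)// -addrA (le_trans _ (lerD (normr_ge0 M) (lexx _)))// add0r.
  by case: (b) c {uL} => -[]; rewrite ?lerDl ?lerDr.
have gM1 c : `|gradx L t (x t) (p c)| + eta <= M1.
  rewrite /M1 lerD// -addrA (le_trans _ (lerD (normr_ge0 M) (lexx _)))// add0r.
  by case: (b) c => -[]; rewrite ?lerDl ?lerDr.
have eta01 : 0 <= eta <= 1 by rewrite ltW.
have pointwise s : t0 < s < t1 -> s \notin F ->
  [/\ U (s, y s, phi s + h s), `|L s (y s) (phi s + h s)| <= M2
    & As s * (L s (y s) (phi s + h s) - L s (x s) (phi s)) <= E s].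
  move=> s01; rewrite mem_cat negb_or => /andP[sS sF].
  rewrite /E; have := side_cases r0 r1 sF; rewrite /h /vstep -/c1 -/c2 -/lo0 -/hi0 -/lo1 -/hi1 -/lo2 -/hi2.
  have AE0 : 0 <= C1 * (As s * `|vr1 s| + As s * `|vr2 s|).
    by rewrite mulr_ge0// addr_ge0// mulr_ge0.
  case=> [[-> -> -> sI]|[-> -> -> sI]|[-> -> -> sI]|[-> -> ->]].
  (* Needle: the new derivative is near [p (~~ b)], up to the small term [c2 *: p b], so L is
     compared directly at the two limits. *)
  - have [st xs ps aA] := loc _ _ sI.
    rewrite mulr0 subr0 scale1r mulr1 scalerN scalerBl scale1r opprB !mul1r mul0r addr0.
    have zE : phi s + (p (~~ b) + (c2 *: p b - p b)) - p (~~ b) = phi s - p b + c2 *: p b.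
      by rewrite [p (~~ b) + _]addrC (addrA (phi s)) addrK addrA [RHS]addrAC.
    have yx : `|y s - x t| < e.
      rewrite -(subrK (x s) (y s)) -addrA (le_lt_trans (ler_normD _ _))// (splitr e) ltrD//.
      exact: lt_le_trans m_e.
    have [|hU hL _ _] := He (~~ b) s (y s) (phi s + (p (~~ b) + (c2 *: p b - p b))) st yx.
      rewrite zE (le_lt_trans (ler_normD _ _))// (splitr e) ltrD// normrZ ger0_norm//.
      by rewrite (le_lt_trans _ e4)// small.
    have ee : e / 2 < e by rewrite ltr_pdivrMr// ltr_pMr// ltr1n.
    have [_ hL' _ _] := He b s (x s) (phi s) st (lt_trans xs ee) (lt_trans ps ee).
    split => //; first exact: Lbd hL.
    apply: (le_trans (weighted_needle_le (X := XN) (As0 s) (ltW At0) eta01 _ _)).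
    + by rewrite (le_trans aA)// ler_pdivrMr// ler_peMr ?ler1n// ltW.
    + move: hL hL' => /=; rewrite !ler_norml => /andP[_ h1] /andP[h2 _]; rewrite /XN; lra.
    + rewrite -[leLHS]add0r lerD// /eN -addrA lerDl addrC -lerBlDr sub0r//.
  (* Rest of the step on the side b: the derivative moves by [c2 *: p b]. *)
  - have [st xs ps aA] := loc _ _ sI.
    have zE : (0 - c1 * 0) *: p (~~ b) + (0 - c2 * 1) *: - p b = (c2 * 1) *: p b.
      by rewrite mulr0 subrr scale0r add0r sub0r scaleNr scalerN opprK.
    have [hU hL hD] := weighted_increment_le LU (He b) (gM1 b) r0 c2ge (As0 s) (ltW At0) eta01
      (normr1 _) (As_ratio _ _ aA c2le) st xs (lt_le_trans (dym s) m_e) ps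
      (le_lt_trans (small _ _ c2ge c2le) e4).
    rewrite zE; split => //; first exact: Lbd hL.
    by rewrite !mul0r add0r addr0 mul1r (le_trans hD)// mul1r lerD.
  (* Opposite side: the derivative moves by [- c1 *: p (~~ b)]. *)
  - have [st xs ps aA] := loc _ _ sI.
    have zE : (0 - c1 * 1) *: p (~~ b) + (0 - c2 * 0) *: - p b = (c1 * -1) *: p (~~ b).
      by rewrite mulr0 subrr scale0r addr0 sub0r -mulrN.
    have [hU hL hD] := weighted_increment_le LU (He (~~ b)) (gM1 (~~ b)) r0 c1ge (As0 s) (ltW At0)
      eta01 (normrN1 _) (As_ratio _ _ aA c1le) st xs (lt_le_trans (dym s) m_e) ps
      (le_lt_trans (small _ _ c1ge c1le) e4).
    rewrite zE; split => //; first exact: Lbd hL.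
    by rewrite !mul0r !add0r mul1r (le_trans hD)// mulN1r lerD.
  (* Outside the support of [h] only the trajectory moves, and the tube gives a Lipschitz bound. *)
  - rewrite !mulr0 subrr !scale0r !addr0 !mul0r !addr0.
    have [hU hL _] := tubeU s01 sS (lt_le_trans (dym s) m_kappa).
    split => //; first by rewrite (le_trans hL)// (le_trans (ler_norm M))// /M2 -!addrA lerDl !addr_ge0.
    apply: le_trans (AsD s); rewrite ler_wpM2l// (le_trans (ler_norm _))//.
    apply: (increment_x_le LU) => v vx.
    have [hvU _ hvx] := tubeU s01 sS (le_lt_trans vx (lt_le_trans (dym s) m_kappa)).
    split => // i; rewrite (le_trans (hvx i))// (le_trans (ler_norm M))// /M1 -!addrA lerDl.
    by rewrite !addr_ge0.
have Jy : J_defined al be t0 t1 L y.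
  have cy : {within `[t0, t1], continuous y} by exact: variation_continuous.
  apply: (J_defined_off (M := M2) be0 oU LU cy (@cphih _ _ _ _ _ _ _ _) capy) => s s01 sF.
  by have [] := pointwise s s01 sF.
have yadm : admissible al t0 t1 x0 x1 y.
  have [[_ xt0 xt1] _] := xmin; split.
  - exact: (variation_PCalpha al01 St cS jS cx xE D lh0 lh1 lh2).
  - by rewrite -xt0; exact: (variation_t0 al x D lh0 lh1 lh2).
  - by rewrite -xt1; exact: (variation_t1 x G1 G2).
have Cy : Cnorm t0 t1 (fun s => y s - x s) < delta.
  apply: (@Cnorm_lt _ _ t0 t1 (Cv * (2 * eta3))); last exact: lt_le_trans m_delta.
    by rewrite ltW// (lt_trans t0t).
  by move=> s _; rewrite (le_trans (dy s))// ler_wpM2l// mulr_natl mulr2n lerD.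
have JJ := xmin' y yadm Cy Jy.
have mvr c d c' d' : measurable_fun `[t0, t1]
    (fun s => As s * `|vramp al t1 c d c' d' s|).
  apply: measurable_funM; first exact: measurable_powR_subr.
  apply: measurableT_comp => //; apply: measurable_funTS; apply: continuous_measurable_fun.
  exact: continuous_vramp.
have [iv1 Iv1] := integrable_of_integral_le (measurable_itv _) (mvr _ _ _ _)
  (fun s => mulr_ge0 (As0 s) (normr_ge0 _)) I1.
have [iv2 Iv2] := integrable_of_integral_le (measurable_itv _) (mvr _ _ _ _)
  (fun s => mulr_ge0 (As0 s) (normr_ge0 _)) I2.
have [lo0t hi0t] := (D lo0 ltac:(by rewrite !inE eqxx), D hi0 ltac:(by rewrite !inE eqxx ?orbT)).
have [lo1t hi1t] := (D lo1 ltac:(by rewrite !inE eqxx ?orbT), D hi1 ltac:(by rewrite !inE eqxx ?orbT)).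
have [lo2t hi2t] := (D lo2 ltac:(by rewrite !inE eqxx ?orbT), D hi2 ltac:(by rewrite !inE eqxx ?orbT)).
have [jE IE] := @Rintegral_majorant _ t0 t1 C1 lo0 hi0 lo2 hi2 lo1 hi1 eN eb e' _ _ iv1 iv2
  (ltW (andP lo0t).1) lh0 (andP hi0t).2 (ltW (andP lo2t).1) lh2 (andP hi2t).2
  (ltW (andP lo1t).1) lh1 (andP hi1t).2.
(* Minimality makes the increment of the cost nonnegative, hence also the integral of its
   majorant. *)
have : 0 <= \int[lebesgue_measure]_(s in `[t0, t1]) E s.
  apply: (Rintegral_ge0_off (F := F) Jx Jy jE) => // s s01 sF.
  rewrite /integrand capy// capx// -mulrBr.
  by have [] := pointwise s s01 sF.
rewrite IE -/vr1 -/vr2.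
have [_ d0 _ d_1] := side_geometry t b (~~ b) r0 r1; have [_ _ _ d_2] := side_geometry t b b r0 r1.
rewrite [hi0 - _]d0 [hi1 - _]d_1 [hi2 - _]d_2.
have Ile : C1 * (\int[lebesgue_measure]_(s in `[t0, t1]) (As s * `|vr1 s|) +
    \int[lebesgue_measure]_(s in `[t0, t1]) (As s * `|vr2 s|)) <= C1 * (2 * (eta * r ^+ 2)).
  rewrite ler_wpM2l// mulr_natl mulr2n lerD//.
    by apply: (le_trans Iv1); rewrite ler_wpM2r// ltW.
  by apply: (le_trans Iv2); rewrite ler_wpM2r// ltW.
move=> I0; have {Ile}I0 := le_trans I0 (lerD Ile (lexx _)).
(* Every term has the factor r^2: [eN] from the length of the needle, [eb] and [e'] from their own
   factor r and the length r. *)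
rewrite -(pmulr_rge0 _ r20); apply: (le_trans I0).
by rewrite le_eqVlt; apply/orP; left; apply/eqP; rewrite /eN /eb /e' /C; ring.
Unshelve. all: by end_near. Qed.

End corner.

(** * The equality at a corner point *)

Theorem corollary4 (R : realType) (n : nat) (t0 t1 alpha beta : R)
    (x0 x1 : 'rV[R]_n) (L : R -> 'rV[R]_n -> 'rV[R]_n -> R)
    (xm : R -> 'rV[R]_n)
    (ht : t0 < t1) (halpha : 0 < alpha <= 1) (hbeta : 0 < beta)
    (hmin : strong_local_min alpha beta t0 t1 x0 x1 L xm)
    (hL : C01_near L (graph_caputo alpha t0 t1 xm))
    (t : R) (hA : corner_point alpha t0 t1 xm t) :
  let pm := lim (caputo alpha t0 xm @ t^'-) in
  let pp := lim (caputo alpha t0 xm @ t^'+) in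
  L t (xm t) pm - dotv (grady L t (xm t) pm) pm =
  L t (xm t) pp - dotv (grady L t (xm t) pp) pp.
Proof.
move=> pm pp; have [t01 _ cl cr] := hA; have [U [oU GU LU]] := hL.
have [[[cx [psi [S [St cS jS]] xE]] xt0 xt1] _] := hmin.
pose phi s := caputo_const alpha *: psi s.
have cap s : t0 < s < t1 -> s \notin S -> caputo alpha t0 xm s = phi s.
  exact: (caputo_pc cS jS halpha xE).
(* The derivative is identified with [phi] only off S; as S is finite, this determines all one-sided
   limits. *)
have capl s : t0 < s <= t1 -> \forall u \near s^'-, caputo alpha t0 xm u = phi u.
  move=> /andP[t0s st1]; have nS := at_left_notin S s; near=> u; apply: cap; last by near: u.
  apply/andP; split; first by near: u; exact: nbhs_left_gt.
  by rewrite (lt_le_trans _ st1).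
have capr s : t0 <= s < t1 -> \forall u \near s^'+, caputo alpha t0 xm u = phi u.
  move=> /andP[t0s st1]; have nS := at_right_notin S s; near=> u; apply: cap; last by near: u.
  apply/andP; split; first by rewrite (le_lt_trans t0s).
  by near: u; exact: nbhs_right_lt.
have phi_pm : phi @ t^'- --> pm.
  apply: cvg_trans cl; apply: near_eq_cvg; apply: capl.
  by case/andP: t01 => -> /ltW.
have phi_pp : phi @ t^'+ --> pp.
  apply: cvg_trans cr; apply: near_eq_cvg; apply: capr.
  by case/andP: t01 => /ltW ->.
(* The variation divides by [caputo_const]. If that constant were 0, the derivative would vanish off
   S and both limits would be 0, which makes the claim trivial. *)
have [K0|K0] := eqVneq (caputo_const alpha) 0.
  have phi0 : phi = fun=> 0 by apply/funext => s; rewrite /phi K0 scale0r.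
  rewrite phi0 in phi_pm phi_pp.
  have pm0 : pm = 0 by apply: (cvg_unique (@norm_hausdorff _ _) phi_pm (cvg_cst _)).
  by have -> : pp = pm by rewrite pm0; apply: (cvg_unique (@norm_hausdorff _ _) phi_pp (cvg_cst _)).
have Ul s q : t0 < s <= t1 -> phi @ s^'- --> q -> U (s, xm s, q).
  move=> s01 sq; apply: GU; exists s, q; have /andP[t0s st1] := s01.
  split; [by rewrite ltW|by []|left; split => //].
  apply: cvg_trans sq; apply: near_eq_cvg.
  by apply: filterS (capl s s01) => u ->.
have Ur s q : t0 <= s < t1 -> phi @ s^'+ --> q -> U (s, xm s, q).
  move=> s01 sq; apply: GU; exists s, q; have /andP[t0s st1] := s01.
  split; [by rewrite t0s ltW|by []|right; split => //].
  apply: cvg_trans sq; apply: near_eq_cvg.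
  by apply: filterS (capr s s01) => u ->.
have [kappa [M [kappa0 tubeU]]] : exists kappa M : R, 0 < kappa /\
    forall s, t0 < s < t1 -> s \notin S -> forall u, `|u - xm s| < kappa ->
    [/\ U (s, u, phi s), `|L s u (phi s)| <= M & forall i, `|gradx L s u (phi s) 0 i| <= M].
  apply: (tube oU LU cx) => s s01.
  - have /cvg_ex[l psil] := pc_cvg_left cS jS s01.
    have sq : phi @ s^'- --> caputo_const alpha *: l by apply: cvgZ psil; exact: cvg_cst.
    by exists (caputo_const alpha *: l) => //; exact: Ul.
  - have /cvg_ex[l psil] := pc_cvg_right cS jS s01.
    have sq : phi @ s^'+ --> caputo_const alpha *: l by apply: cvgZ psil; exact: cvg_cst.
    by exists (caputo_const alpha *: l) => //; exact: Ur.
  (* At a continuity point the value of [phi] is its own left limit, hence gives a point of the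
     graph. *)
  - move=> sS; apply: Ul; first by case/andP: s01 => -> /ltW.
    apply: cvg_at_left_filter; apply: cvgZ; first exact: cvg_cst.
    exact: (pc_continuous cS s01).
pose p (c : bool) := if c then pm else pp.
have Up c : U (t, xm t, p c).
  by case/andP: (t01) => a b; case: c; [apply: Ul|apply: Ur] => //; rewrite ?a ?b ltW.
have H := @corner_inequality _ _ alpha beta t0 t1 t x0 x1 L U xm psi S kappa M p halpha hbeta
  oU LU St cS jS cx xE K0 hmin kappa0 tubeU t01 Up phi_pm phi_pp.
have := H true; have := H false; rewrite /p /=; lra.
Unshelve. all: by end_near. Qed.
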